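(* Let $I\in\mathcal Q$ and let $X$ be an r.i. space such that $S_I$ is bounded on $X'$. Then $$\|f\|_{Y_X}\approx\left\|\frac{I(t)}{t}\big(f^{**}(t)-f^*(t)\big)\right\|_X+\|f\|_1,\quad f\in\mathcal M_+(0,1).$$
   Context: Functions live on $(0,1)$; $\mathcal M_+(0,1)$ nonnegative measurable functions; $f^*$ nonincreasing rearrangement; $f^{**}(t)=\frac1t\int_0^tf^*$. An r.i. space is a rearrangement-invariant Banach function space on $(0,1)$, $X'$ its associate space. $S_If(t)=\frac1{I(t)}\sup_{0<s\le t}I(s)f^*(s)$, bounded on $X'$ meaning $\|S_If\|_{X'}\lesssim\|f\|_{X'}$. $H_If(t)=\int_t^1\frac{f(s)}{I(s)}ds$; $Y_X$ is the optimal target space of $X$ under $H_I$ ($H_I:X\to Y_X$ bounded and $Y_X\hookrightarrow W$ for every r.i. $W$ with $H_I:X\to W$ bounded). Class $\mathcal Q$: a quasiconcave function is a nondecreasing bijection $I:(0,1)\to(0,1)$ with $I(0+)=0$, $I(1-)=1$ and $I(t)/t$ nonincreasing; $I\in\mathcal Q$ if it is quasiconcave, satisfies for $t\in(0,1)$: $\int_0^t\frac{I(s)}{s}ds\lesssim I(t)$, $\int_0^t\frac{ds}{I(s)}\lesssim\frac t{I(t)}$, $\int_t^1\frac{I(s)}{s^2}ds\lesssim\frac1t\int_0^t\frac{I(s)}{s}ds$, and $(1-c)d\le c$ where $c=\sup\{\lambda\ge0:\lambda(\frac{I(t)}{t^2}-1)\le\int_t^1\frac{I(s)}{s^3}ds\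 \forall t\in(0,1)\}$ and $d$ is the smallest positive number with $\int_t^1\frac{I(s)}{s^2}ds\le d\frac{I(t)}{t}$ for all $t\in(0,1)$. $\approx$: up to constants independent of $f$. *)

(* Defs.v *)
From HB Require Import structures.
From mathcomp Require Import all_boot all_order all_algebra.
From mathcomp Require Import all_classical all_reals all_analysis.
From mathcomp Require Import measurable_realfun.
Set Implicit Arguments. Unset Strict Implicit. Unset Printing Implicit Defensive.
Import Order.TTheory GRing.Theory Num.Theory.
Import numFieldNormedType.Exports.
Local Open Scope classical_set_scope.
Local Open Scope ring_scope.
Local Open Scope ereal_scope.

Definition I01 (R : realType) : set R := `]0%R, 1%R[.
Arguments I01 R : clear implicits.

Notation lebm R := (@lebesgue_measure R).

(* M_+(0,1): nonnegative measurable [0,+oo]-valued functions (only their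
   values on (0,1) matter). *)
Definition Mplus (R : realType) (f : R -> \bar R) : Prop :=
  measurable_fun (I01 R) f /\ (forall x, I01 R x -> 0 <= f x).

Definition distf (R : realType) (f : R -> \bar R) (l : R) : \bar R :=
  lebm R (I01 R `&` [set x | l%:E < f x]).

Definition fstar (R : realType) (f : R -> \bar R) (t : R) : \bar R :=
  ereal_inf [set l%:E | l in [set l : R | (0 <= l)%R /\ distf f l <= t%:E]].

Definition fstarstar (R : realType) (f : R -> \bar R) (t : R) : \bar R :=
  (t^-1)%:E * \int[lebm R]_(s in `]0%R, t[) fstar f s.

Definition L1norm (R : realType) (f : R -> \bar R) : \bar R :=
  \int[lebm R]_(x in I01 R) f x.

Definition ae_zero (R : realType) (f : R -> \bar R) : Prop :=
  {ae lebm R, forall x, I01 R x -> f x = 0}.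

(* Rearrangement-invariant Banach function norm on (0,1)
   (Bennett--Sharpley, Def. I.1.1 (P1)-(P5) and Def. II.4.1),
   given as a functional on M_+(0,1). *)
Record ri_norm (R : realType) (rho : (R -> \bar R) -> \bar R) : Prop := {
  rho_ge0 : forall f, Mplus f -> 0 <= rho f;
  rho_eq0 : forall f, Mplus f -> (rho f = 0 <-> ae_zero f);
  rho_scale : forall (a : R) f, (0 <= a)%R -> Mplus f ->
      rho (fun x => a%:E * f x) = a%:E * rho f;
  rho_add : forall f g, Mplus f -> Mplus g -> rho (f \+ g) <= rho f + rho g;
  rho_mono : forall f g, Mplus f -> Mplus g ->
      {ae lebm R, forall x, I01 R x -> g x <= f x} -> rho g <= rho f;
  rho_fatou : forall (fn : nat -> R -> \bar R) f,
      (forall n, Mplus (fn n)) -> Mplus f ->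
      {ae lebm R, forall x, I01 R x ->
          {homo (fun n => fn n x) : n m / (n <= m)%N >-> n <= m} /\
          (fun n => fn n x) @ \oo --> f x} ->
      (fun n => rho (fn n)) @ \oo --> rho f;
  rho_indic : forall E : set R, measurable E -> E `<=` I01 R ->
      rho (fun x => (\1_E x)%:E) < +oo;
  rho_local : forall E : set R, measurable E -> E `<=` I01 R ->
      exists C : R, (0 <= C)%R /\
        forall f, Mplus f -> \int[lebm R]_(x in E) f x <= C%:E * rho f;
  rho_ri : forall f g, Mplus f -> Mplus g ->
      (forall l : R, (0 <= l)%R -> distf f l = distf g l) -> rho f = rho g }.

Definition assoc_norm (R : realType) (rho : (R -> \bar R) -> \bar R)
    (g : R -> \bar R) : \bar R :=
  ereal_sup [set \int[lebm R]_(x in I01 R) (f x * g x) |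
               f in [set f | Mplus f /\ rho f <= 1]].

Definition S_op (R : realType) (I : R -> R) (f : R -> \bar R) (t : R) : \bar R :=
  ((I t)^-1)%:E * ereal_sup [set (I s)%:E * fstar f s | s in `]0%R, t]].

Definition H_op (R : realType) (I : R -> R) (f : R -> \bar R) (t : R) : \bar R :=
  \int[lebm R]_(s in `]t, 1%R[) (((I s)^-1)%:E * f s).

(* T : X -> W bounded (T a positive operator, checked on M_+) *)
Definition op_bounded (R : realType) (T : (R -> \bar R) -> (R -> \bar R))
    (rhoX rhoW : (R -> \bar R) -> \bar R) : Prop :=
  exists C : R, (0 < C)%R /\ forall f, Mplus f -> rhoW (T f) <= C%:E * rhoX f.

Definition S_bounded_on_assoc (R : realType) (I : R -> R)
    (rhoX : (R -> \bar R) -> \bar R) : Prop :=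
  op_bounded (S_op I) (assoc_norm rhoX) (assoc_norm rhoX).

Definition embeds (R : realType) (rhoY rhoW : (R -> \bar R) -> \bar R) : Prop :=
  exists C : R, (0 < C)%R /\ forall f, Mplus f -> rhoW f <= C%:E * rhoY f.

Definition optimal_target (R : realType) (I : R -> R)
    (rhoX rhoY : (R -> \bar R) -> \bar R) : Prop :=
  [/\ ri_norm rhoY, op_bounded (H_op I) rhoX rhoY &
      (forall rhoW, ri_norm rhoW -> op_bounded (H_op I) rhoX rhoW ->
        embeds rhoY rhoW)].

Definition quasiconcave (R : realType) (I : R -> R) : Prop :=
  [/\
      [/\ (forall t, I01 R t -> I01 R (I t)),
        (forall s t, I01 R s -> I01 R t -> I s = I t -> s = t) &
        (forall u, I01 R u -> exists t, I01 R t /\ I t = u)],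
      (forall s t, I01 R s -> I01 R t -> (s <= t)%R -> (I s <= I t)%R),
      (I x @[x --> (0%R : R)^'+] --> (0%R : R)),
      (I x @[x --> (1%R : R)^'-] --> (1%R : R)) &
      (forall s t, I01 R s -> I01 R t -> (s <= t)%R -> (I t / t <= I s / s)%R)].

Definition cQ (R : realType) (I : R -> R) : \bar R :=
  ereal_sup [set l%:E | l in [set l : R | (0 <= l)%R /\
     forall t, I01 R t ->
       (l * (I t / t ^+ 2 - 1))%:E <=
         \int[lebm R]_(s in `]t, 1%R[) (I s / s ^+ 3)%:E]].

Definition dQ (R : realType) (I : R -> R) : \bar R :=
  ereal_inf [set d%:E | d in [set d : R | (0 < d)%R /\
     forall t, I01 R t ->
       \int[lebm R]_(s in `]t, 1%R[) (I s / s ^+ 2)%:E <= (d * (I t / t))%:E]].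

Definition classQ (R : realType) (I : R -> R) : Prop :=
  [/\ quasiconcave I,
      (exists C : R, (0 < C)%R /\ forall t, I01 R t ->
         \int[lebm R]_(s in `]0%R, t[) (I s / s)%:E <= (C * I t)%:E),
      (exists C : R, (0 < C)%R /\ forall t, I01 R t ->
         \int[lebm R]_(s in `]0%R, t[) ((I s)^-1)%:E <= (C * (t / I t))%:E),
      (exists C : R, (0 < C)%R /\ forall t, I01 R t ->
         \int[lebm R]_(s in `]t, 1%R[) (I s / s ^+ 2)%:E <=
           (C / t)%:E * \int[lebm R]_(s in `]0%R, t[) (I s / s)%:E) &
      (1 - cQ I) * dQ I <= cQ I].

Definition osc (R : realType) (I : R -> R) (f : R -> \bar R) (t : R) : \bar R :=
  (I t / t)%:E * (fstarstar f t - fstar f t).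

(* Main.v *)
Require Import Defs.
From HB Require Import structures.
From mathcomp Require Import all_boot all_order all_algebra.
From mathcomp Require Import all_classical all_reals all_analysis.
From mathcomp Require Import measurable_realfun ring lra.
Import Order.TTheory GRing.Theory Num.Theory.
Import numFieldNormedType.Exports.
Local Open Scope classical_set_scope.
Local Open Scope ring_scope.
Local Open Scope ereal_scope.
Set Implicit Arguments.
Unset Strict Implicit.
Unset Printing Implicit Defensive.

(** For a level l write D(l) for the distribution function of f.  Then
    osc f (t) = I(t)/t^2 * int_l D(l) 1_{D(l) <= t}, and by Tonelli
    H (osc f) + |f|_1 = int_l D(l) / max(D(l), t) >= f^*, which gives the upper
    bound for the norm of Y.

    For the lower bound one uses the optimality of Y against the norm
    W f = sup int_l k(D(l)), where k runs over the concave functions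
    k = int_y w(y) min(., sg(y)) with k / I in the unit ball of X'; Fubini shows
    that H : X -> W is bounded.  It remains to bound int (osc f) g by W f for g in
    the unit ball of X' (Lorentz--Luxemburg).  This integral is int_l K(D(l)),
    where K(s) = s * int_s^1 I g / t^2, and K has the concave majorant
    k(t) = int_y min(t / sg(y), 1) with sg(y) = inf {K > y}.  Finally k / I is
    dominated by G (S_I (G g)) plus a constant, where
    G g (t) = t / I(t) * int_t^1 I g / s^2 is bounded on X' because it is bounded on
    L1 and on Linfty. *)

(** The function K(s) = s P(s), with P the nonincreasing tail integral, need not be concave or even
    monotone. Its explicit majorant is preferred to the least concave one because it is by
    construction a positive combination of the functions min(., s); no derivative of a concave
    function is ever taken. Such a k acts on f through [kfun], since int_l k(D(l)) = int_y w(y) kfun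
    f (sg y), and the subadditivity of [kfun] gives W its triangle inequality. The boundedness of G
    on X' is obtained by hand: Tonelli gives int_E G g <= d kfun g(|E|) for every set E, and a
    function h with distribution function below that of f is built so that these bounds add up to
    one pairing of h with g. The operator S sees only rearrangements, whereas G g is not monotone,
    so S (G g) is bounded below through the values of G g on whole intervals [r/2, r[. The additive
    constant in the bound for k / I comes from writing 1 / s = 1 + int_s^1 dr / r^2. Finally P may
    be infinite, so g is cut off near 0, with constants that do not depend on the cutoff. *)

Definition halfline (R : realType) : set R := `]0%R, +oo[.
Arguments halfline R : clear implicits.

(** The argument is a boolean rather than a set, so that one term such as [chi (l%:E < f x)] can be
    integrated in x as well as in the level l. *)
Definition chi (R : realType) (b : bool) : \bar R := (b%:R)%:E.
Arguments chi {R} b.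

(** * Indicators, Tonelli on product sets, layer-cake formula *)

Section Tools.
Context {R : realType}.
Implicit Types (A B D : set R) (f g : R -> \bar R) (k : R -> R -> \bar R).

Local Notation leb := (lebm R).

Lemma mI01 : measurable (I01 R). Proof. exact: measurable_itv. Qed.

Lemma mhalfline : measurable (halfline R). Proof. exact: measurable_itv. Qed.

Lemma I01P (x : R) : I01 R x <-> (0 < x)%R /\ (x < 1)%R.
Proof. by rewrite /I01 /= in_itv /=; split => [/andP|[-> ->]]. Qed.

Lemma halflineP (x : R) : halfline R x <-> (0 < x)%R.
Proof. by rewrite /halfline /= in_itv /= andbT. Qed.

Lemma chi_ge0 b : (0 : \bar R) <= chi b.
Proof. by rewrite lee_fin ler0n. Qed.

Lemma chi_le1 b : chi b <= (1 : \bar R).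
Proof. by rewrite lee_fin; case: b. Qed.

Lemma chi1 : chi true = 1 :> \bar R. Proof. by []. Qed.

Lemma chi0 : chi false = 0 :> \bar R. Proof. by []. Qed.

Lemma chi_mem (A : set R) x : chi (x \in A) = (\1_A x)%:E :> \bar R.
Proof. by rewrite indicE. Qed.

Lemma le_chi (b c : bool) : (b -> c) -> (chi b : \bar R) <= chi c.
Proof. by case: b c => -[] // /(_ isT). Qed.

Lemma measurable_chi d (T : measurableType d) (D : set T) (b : T -> bool) :
  measurable_fun D b -> measurable_fun D (fun x => chi (b x) : \bar R).
Proof.
move=> mb; apply/measurable_EFinP.
rewrite (_ : (fun x => _) = (fun c : bool => (c%:R : R)) \o b)//.
exact: measurableT_comp.
Qed.

Lemma measurable_chi_lt d (T : measurableType d) (D : set T) (f g : T -> \bar R) :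
  measurable_fun D f -> measurable_fun D g ->
  measurable_fun D (fun x => chi (f x < g x) : \bar R).
Proof. by move=> mf mg; apply/measurable_chi/measurable_fun_lte. Qed.

Lemma measurable_chi_le d (T : measurableType d) (D : set T) (f g : T -> \bar R) :
  measurable_fun D f -> measurable_fun D g ->
  measurable_fun D (fun x => chi (f x <= g x) : \bar R).
Proof. by move=> mf mg; apply/measurable_chi/measurable_fun_lee. Qed.

Lemma measurable_chi_mem d (T : measurableType d) (D E : set T) :
  measurable E -> measurable_fun D (fun x => chi (x \in E) : \bar R).
Proof.
move=> mE; apply/measurable_EFinP.
by rewrite (_ : (fun x => _) = \1_E)//; exact: measurable_indic.
Qed.

Lemma measurable_EFin_id D : measurable_fun D (EFin : R -> \bar R).
Proof. by apply/measurable_EFinP. Qed.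

Lemma measurable_fst_on A B f : measurable A -> measurable B ->
  measurable_fun A f -> measurable_fun (A `*` B) (fun z : R * R => f z.1).
Proof.
move=> mA mB mf; apply: (measurable_comp mA _ mf) => [_ [[x y] [Ax By] <-]//|].
by apply: measurable_funTS; exact: measurable_fst.
Qed.

Lemma measurable_snd_on A B f : measurable A -> measurable B ->
  measurable_fun B f -> measurable_fun (A `*` B) (fun z : R * R => f z.2).
Proof.
move=> mA mB mf; apply: (measurable_comp mB _ mf) => [_ [[x y] [Ax By] <-]//|].
by apply: measurable_funTS; exact: measurable_snd.
Qed.

Section Tonelli.
Variables (A B : set R) (k : R -> R -> \bar R).
Hypotheses (mA : measurable A) (mB : measurable B).
Hypothesis mk : measurable_fun (A `*` B) (fun z : R * R => k z.1 z.2).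
Hypothesis k0 : forall x y, A x -> B y -> 0 <= k x y.

(** Extending the kernel by zero outside A x B reduces everything to Fubini-Tonelli on the whole
    plane. *)
Let F := (fun z : R * R => k z.1 z.2) \_ (A `*` B).

Let mF : measurable_fun setT F.
Proof. by apply/(measurable_restrictT _ _).1 => //; exact: measurableX. Qed.

Let F0 z : 0 <= F z.
Proof.
rewrite /F patchE; case: ifPn => // /set_mem [Ax By]; exact: k0.
Qed.

Let FA x : \int[leb]_y F (x, y) = ((fun x => \int[leb]_(y in B) k x y) \_ A) x.
Proof.
rewrite patchE; case: ifPn => [/set_mem Ax|/negP Ax].
  rewrite [RHS]integral_mkcond; apply: eq_integral => y _.
  rewrite /F !patchE; congr (if _ then _ else _).
  by apply/idP/idP => /set_mem => [[_ By]|By]; apply/mem_set.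
rewrite integral0_eq// => y _.
by rewrite /F patchE; case: ifPn => // /set_mem [/mem_set].
Qed.

Let FB y : \int[leb]_x F (x, y) = ((fun y => \int[leb]_(x in A) k x y) \_ B) y.
Proof.
rewrite patchE; case: ifPn => [/set_mem By|/negP By].
  rewrite [RHS]integral_mkcond; apply: eq_integral => x _.
  rewrite /F !patchE; congr (if _ then _ else _).
  by apply/idP/idP => /set_mem => [[Ax _]|Ax]; apply/mem_set.
rewrite integral0_eq// => x _.
by rewrite /F patchE; case: ifPn => // /set_mem [_ /mem_set].
Qed.

Lemma tonelli_measurablel : measurable_fun A (fun x => \int[leb]_(y in B) k x y).
Proof.
apply/(measurable_restrictT (fun x => \int[leb]_(y in B) k x y) mA).
have : measurable_fun setT (fun x => \int[leb]_y F (x, y)).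
  exact: measurable_fun_fubini_tonelli_F.
by apply: eq_measurable_fun => x _; rewrite FA.
Qed.

Lemma tonelli_measurabler : measurable_fun B (fun y => \int[leb]_(x in A) k x y).
Proof.
apply/(measurable_restrictT (fun y => \int[leb]_(x in A) k x y) mB).
have : measurable_fun setT (fun y => \int[leb]_x F (x, y)).
  exact: measurable_fun_fubini_tonelli_G.
by apply: eq_measurable_fun => y _; rewrite FB.
Qed.

Lemma tonelli : \int[leb]_(x in A) \int[leb]_(y in B) k x y =
                \int[leb]_(y in B) \int[leb]_(x in A) k x y.
Proof.
rewrite [LHS]integral_mkcond [RHS]integral_mkcond.
under eq_integral do rewrite -FA.
under [RHS]eq_integral do rewrite -FB.
exact: fubini_tonelli.
Qed.

End Tonelli.

(** Superlevel sets of a monotone function on an interval are intervals. This fact and its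
    nonincreasing twin give the measurability of the rearrangement, of the kernels built from [I]
    and of the levels [sg]. *)
Lemma monotone_measurable D f : is_interval D ->
  (forall x y, D x -> D y -> (x <= y)%R -> f x <= f y) -> measurable_fun D f.
Proof.
move=> iD mf; apply: (measurability (@ErealGenOInfty.G R)) => [|/= _ [_] [r] -> <-].
  exact: ErealGenOInfty.measurableE.
apply: is_interval_measurable => x y [/= Dx fx] [/= Dy fy] z /andP[xz zy].
have Dz : D z by apply: (iD x y) => //; rewrite xz.
split => //; move: fx fy; rewrite /= !in_itv/= !andbT => fx fy.
by rewrite (lt_le_trans fx)// mf.
Qed.

Lemma antitone_measurable D f : is_interval D ->
  (forall x y, D x -> D y -> (x <= y)%R -> f y <= f x) -> measurable_fun D f.
Proof.
move=> iD mf; apply: (measurability (@ErealGenOInfty.G R)) => [|/= _ [_] [r] -> <-].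
  exact: ErealGenOInfty.measurableE.
apply: is_interval_measurable => x y [/= Dx fx] [/= Dy fy] z /andP[xz zy].
have Dz : D z by apply: (iD x y) => //; rewrite xz.
split => //; move: fx fy; rewrite /= !in_itv/= !andbT => fx fy.
by rewrite (lt_le_trans fy)// mf.
Qed.

(* The next three lemmas fix the measurable structure carried by [R]: the
   generic ones leave rewriting with another, convertible, structure. *)
Lemma le_int D f g : measurable D -> (forall x, D x -> 0 <= f x) ->
  measurable_fun D f -> measurable_fun D g -> (forall x, D x -> f x <= g x) ->
  \int[leb]_(x in D) f x <= \int[leb]_(x in D) g x.
Proof. by move=> mD f0 mf mg fg; exact: ge0_le_integral. Qed.

Lemma int_mull D (c : \bar R) f : measurable D -> measurable_fun D f ->
  (forall x, D x -> 0 <= f x) -> 0 <= c ->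
  \int[leb]_(x in D) (c * f x) = c * \int[leb]_(x in D) f x.
Proof. by move=> mD mf f0 c0; exact: ge0_integralZl. Qed.

Lemma int_mulr D (c : \bar R) f : measurable D -> measurable_fun D f ->
  (forall x, D x -> 0 <= f x) -> 0 <= c ->
  \int[leb]_(x in D) (f x * c) = \int[leb]_(x in D) f x * c.
Proof. by move=> mD mf f0 c0; exact: ge0_integralZr. Qed.

Lemma integral_chi_mem D (E : set R) : measurable D -> measurable E ->
  \int[leb]_(x in D) chi (x \in E) = leb (E `&` D).
Proof. by move=> mD mE; rewrite -integral_indic//; apply: eq_integral => x _; rewrite chi_mem. Qed.

Lemma integral_mul_chi_mem D (E : set R) f : measurable D -> measurable E ->
  \int[leb]_(x in D) (f x * chi (x \in E)) = \int[leb]_(x in D `&` E) f x.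
Proof.
move=> mD mE; rewrite integral_mkcondr; apply: eq_integral => x _.
by rewrite patchE; case: (x \in E); rewrite ?chi1 ?chi0 ?mule1 ?mule0.
Qed.

(** The layer-cake identity for a single value, +oo included. It is applied pointwise to functions,
    to [fstar] and to suprema before exchanging integrals. *)
Lemma layer (y : \bar R) : 0 <= y ->
  \int[leb]_(l in halfline R) chi (l%:E < y) = y.
Proof.
case: y => [y||]// y0; last first.
- rewrite (eq_integral (cst 1)) => [|l _]; last by rewrite ltry.
  rewrite integral_cst ?mul1e; last exact: mhalfline.
  by apply: (etrans (lebesgue_measure_itv _)) => /=; rewrite ltry.
- transitivity (\int[leb]_(l in halfline R) chi (l \in (`]0%R, y[%classic : set R))).
    apply: eq_integral => l; rewrite inE => /halflineP l0; congr chi.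
    apply/idP/idP => [ly|/set_mem].
      by apply/mem_set; rewrite /= in_itv/= l0 -lte_fin.
    by rewrite /= in_itv/= lte_fin => /andP[].
  rewrite integral_chi_mem; [|exact: mhalfline|exact: measurable_itv].
  rewrite (_ : _ `&` _ = `]0%R, y[%classic); last first.
    by apply/seteqP; split => [x []//|x /=]; rewrite /halfline/= !in_itv/= => /andP[-> ->].
  apply: (etrans (lebesgue_measure_itv _)) => /=; rewrite lte_fin -EFinD subr0.
  by case: ltP => // y0'; apply/le_anti; rewrite y0/= lee_fin.
Qed.

End Tools.

(** * Closure properties of nonnegative measurable functions, monotone convergence *)

Section Mplus_closure.
Context {R : realType}.
Implicit Types (f g : R -> \bar R).

Lemma Mplus_measurable f : Mplus f -> measurable_fun (I01 R) f.
Proof. by case. Qed.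

Lemma Mplus_ge0 f x : Mplus f -> I01 R x -> 0 <= f x.
Proof. by case=> _; apply. Qed.

Lemma Mplus_add f g : Mplus f -> Mplus g -> Mplus (fun x => f x + g x).
Proof.
move=> [mf f0] [mg g0]; split; first exact: emeasurable_funD.
by move=> x Ix; rewrite adde_ge0 ?f0 ?g0.
Qed.

Lemma Mplus_mul f g : Mplus f -> Mplus g -> Mplus (fun x => f x * g x).
Proof.
move=> [mf f0] [mg g0]; split; first exact: emeasurable_funM.
by move=> x Ix; rewrite mule_ge0 ?f0 ?g0.
Qed.

Lemma Mplus_cst (c : \bar R) : 0 <= c -> Mplus (cst c : R -> \bar R).
Proof. by move=> c0; split => // *; exact: measurable_cst. Qed.

Lemma Mplus_scale (c : \bar R) f : 0 <= c -> Mplus f -> Mplus (fun x => c * f x).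
Proof. by move=> c0 mf; apply: Mplus_mul => //; exact: Mplus_cst. Qed.

Lemma Mplus_chi_mem (E : set R) : measurable E -> Mplus (fun x => chi (x \in E) : \bar R).
Proof.
by move=> mE; split=> [|x _]; [exact: measurable_chi_mem|exact: chi_ge0].
Qed.

Lemma Mplus_chi_gt f (l : R) : Mplus f -> Mplus (fun x => chi (l%:E < f x) : \bar R).
Proof.
move=> [mf f0]; split=> [|x _]; last exact: chi_ge0.
by apply: measurable_chi_lt => //; exact: measurable_cst.
Qed.

Lemma Mplus_mine f g : Mplus f -> Mplus g -> Mplus (fun x => mine (f x) (g x)).
Proof.
move=> [mf f0] [mg g0]; split; first exact: measurable_mine.
by move=> x Ix; rewrite le_min f0 ?g0.
Qed.

Lemma is_interval_I01 : is_interval (I01 R).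
Proof. exact: interval_is_interval. Qed.

Lemma is_interval_halfline : is_interval (halfline R).
Proof. exact: interval_is_interval. Qed.

Lemma eq_int01 g f : (forall x, I01 R x -> f x = g x) ->
  \int[lebm R]_(x in I01 R) f x = \int[lebm R]_(x in I01 R) g x.
Proof. by move=> fg; apply: eq_integral => x; rewrite inE; exact: fg. Qed.

Lemma integral_mono f g : Mplus f -> Mplus g ->
  (forall x, I01 R x -> f x <= g x) ->
  \int[lebm R]_(x in I01 R) f x <= \int[lebm R]_(x in I01 R) g x.
Proof.
move=> [mf f0] [mg g0] fg.
by apply: ge0_le_integral => //; exact: mI01.
Qed.

Lemma int_add f g : Mplus f -> Mplus g ->
  \int[lebm R]_(x in I01 R) (f x + g x) =
  \int[lebm R]_(x in I01 R) f x + \int[lebm R]_(x in I01 R) g x.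
Proof. by move=> [mf f0] [mg g0]; apply: ge0_integralD => //; exact: mI01. Qed.

Lemma int_scale (c : \bar R) f : 0 <= c -> Mplus f ->
  \int[lebm R]_(x in I01 R) (c * f x) = c * \int[lebm R]_(x in I01 R) f x.
Proof. by move=> c0 [mf f0]; apply: ge0_integralZl => //; exact: mI01. Qed.

Lemma int_ge0 f : Mplus f -> 0 <= \int[lebm R]_(x in I01 R) f x.
Proof. by move=> [_ f0]; exact: integral_ge0. Qed.

Lemma int_cvg (fn : nat -> R -> \bar R) f : (forall n, Mplus (fn n)) ->
  (forall x, I01 R x -> {homo fn ^~ x : n m / (n <= m)%N >-> n <= m}) ->
  (forall x, I01 R x -> fn n x @[n --> \oo] --> f x) ->
  \int[lebm R]_(x in I01 R) fn n x @[n --> \oo] --> \int[lebm R]_(x in I01 R) f x.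
Proof.
move=> Mfn nd fnf.
have -> : \int[lebm R]_(x in I01 R) f x =
    \int[lebm R]_(x in I01 R) limn (fn ^~ x).
  by apply: eq_int01 => x Ix; apply/esym/cvg_lim => //; exact: fnf.
apply: cvg_monotone_convergence => //; first exact: mI01.
- by move=> n; case: (Mfn n).
- by move=> n x Ix; case: (Mfn n) => _; apply.
Qed.

Lemma ae_imp (P Q : R -> Prop) : (forall x, P x -> Q x) ->
  {ae lebm R, forall x, P x} -> {ae lebm R, forall x, Q x}.
Proof.
move=> PQ [N [mN N0 PN]]; exists N; split => // x /= Qx; apply: PN => /= Px.
exact/Qx/PQ.
Qed.

Lemma ae_null_set (P : R -> Prop) : {ae lebm R, forall x, P x} ->
  exists N, [/\ measurable N, lebm R N = 0 & forall x, ~ N x -> P x].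
Proof.
move=> [N [mN N0 PN]]; exists N; split => // x Nx; apply: contrapT => Px.
by apply: Nx; apply: PN.
Qed.

(** Multiplying by the indicator of the complement of the exceptional null set makes the hypotheses
    hold everywhere and changes no integral. *)
Lemma int_cvg_ae (fn : nat -> R -> \bar R) f : (forall n, Mplus (fn n)) -> Mplus f ->
  {ae lebm R, forall x, I01 R x ->
    {homo fn ^~ x : n m / (n <= m)%N >-> n <= m} /\ fn n x @[n --> \oo] --> f x} ->
  \int[lebm R]_(x in I01 R) fn n x @[n --> \oo] --> \int[lebm R]_(x in I01 R) f x.
Proof.
move=> Mfn Mf /ae_null_set[N [mN N0 HN]].
have MN : Mplus (fun x => chi (x \in ~` N) : \bar R).
  by apply: Mplus_chi_mem; exact: measurableC.
have cut g : Mplus g -> \int[lebm R]_(x in I01 R) g x =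
    \int[lebm R]_(x in I01 R) (g x * chi (x \in ~` N)).
  move=> Mg; have [mg g0] := Mg; have [mg' g0'] := Mplus_mul Mg MN.
  apply: ge0_ae_eq_integral => //; first exact: mI01.
  exists N; split => // x; apply: contra_notP => Nx _.
  by rewrite mem_set// mule1.
rewrite (cut f Mf) (_ : (fun n => _) =
  fun n => \int[lebm R]_(x in I01 R) (fn n x * chi (x \in ~` N))); last first.
  by apply/funext => n; exact: cut.
apply: int_cvg => [n|x Ix n m nm|x Ix]; first exact: Mplus_mul.
  have [Nx|Nx] := pselect (N x).
    by rewrite (_ : (x \in ~` N) = false) ?chi0 ?mule0//; apply/negP => /set_mem.
  by apply: lee_wpmul2r; [exact: chi_ge0|case: (HN x Nx Ix) => + _; apply].
have [Nx|Nx] := pselect (N x).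
  rewrite (_ : (x \in ~` N) = false); last by apply/negP => /set_mem.
  by rewrite chi0 mule0; under eq_fun do rewrite mule0; exact: cvg_cst.
rewrite mem_set// mule1; under eq_fun do rewrite mule1.
by case: (HN x Nx Ix).
Qed.

Lemma mine_nat_homo (y : \bar R) :
  {homo (fun n : nat => mine y n%:R%:E) : n m / (n <= m)%N >-> n <= m}.
Proof. by move=> n m nm; rewrite le_min !ge_min lexx/= lee_fin ler_nat nm orbT. Qed.

Lemma mine_nat_cvg (y : \bar R) : 0 <= y -> mine y n%:R%:E @[n --> \oo] --> y.
Proof.
move=> y0; have := ereal_nondecreasing_cvgn (@mine_nat_homo y).
set s := ereal_sup _; suff -> : s = y by [].
apply/eqP; rewrite eq_le; apply/andP; split.
  by apply: ge_ereal_sup => _ [n _ <-]; rewrite ge_min lexx.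
case: y y0 @s => [y||]// y0 s; last first.
  rewrite leye_eq; apply/eqP/eq_infty => r; pose n := Num.bound `|r|%R.
  apply: (@le_trans _ _ (mine +oo n%:R%:E)); last by rewrite /s; apply: ereal_sup_ubound; exists n.
  rewrite le_min leey lee_fin (le_trans (ler_norm r))//.
  exact: ltW (archi_boundP (normr_ge0 r)).
rewrite /s; pose n := Num.bound y.
apply: (@le_trans _ _ (mine y%:E n%:R%:E)); last by apply: ereal_sup_ubound; exists n.
by rewrite le_min lexx lee_fin ltW// archi_boundP.
Qed.

End Mplus_closure.

(** * Distribution function and nonincreasing rearrangement *)

Section Distribution.
Context {R : realType}.
Implicit Types (f g k : R -> \bar R) (l t : R).

Local Notation leb := (lebm R).

Lemma measurable_superlevel f l : Mplus f ->
  measurable (I01 R `&` [set x | l%:E < f x]).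
Proof. by move=> [mf _]; apply: emeasurable_fun_o_infty => //; exact: mI01. Qed.

Lemma distf_int f l : Mplus f ->
  distf f l = \int[leb]_(x in I01 R) chi (l%:E < f x).
Proof.
move=> Mf; have mE := measurable_superlevel l Mf.
transitivity (\int[leb]_(x in I01 R) chi (x \in I01 R `&` [set x | l%:E < f x])).
  rewrite integral_chi_mem//; last exact: mI01.
  by rewrite /distf -setIA (setIC _ (I01 R)) setIA setIid.
apply: eq_integral => x; rewrite inE => Ix; congr chi.
by apply/idP/idP => [/set_mem[]//|?]; apply/mem_set.
Qed.

Lemma leb_I01 : leb (I01 R) = 1.
Proof. by apply: (etrans (lebesgue_measure_itv _)) => /=; rewrite lte_fin ltr01 sube0. Qed.

Lemma int_cst (c : \bar R) : \int[leb]_(x in I01 R) c = c.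
Proof.
transitivity (c * leb (I01 R)); last by rewrite leb_I01 mule1.
by apply: integral_cst; exact: mI01.
Qed.

Lemma distf_ge0 f l : 0 <= distf f l.
Proof. exact: measure_ge0. Qed.

Lemma distf_le1 f l : Mplus f -> distf f l <= 1.
Proof.
move=> Mf; rewrite -leb_I01; apply: le_measure; rewrite ?inE; last exact: subIsetl.
  exact: measurable_superlevel.
exact: mI01.
Qed.

Lemma distf_fin f l : Mplus f -> distf f l \is a fin_num.
Proof.
move=> Mf; rewrite ge0_fin_numE ?distf_ge0//.
by rewrite (le_lt_trans (distf_le1 l Mf))// ltry.
Qed.

Lemma distf_anti f l l' : Mplus f -> (l <= l')%R -> distf f l' <= distf f l.
Proof.
move=> Mf ll'; apply: le_measure; rewrite ?inE; [exact: measurable_superlevel..|].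
move=> x [Ix /= lf]; split => //=; apply: le_lt_trans lf.
by rewrite lee_fin.
Qed.

Lemma measurable_distf f (D : set R) : Mplus f -> measurable D ->
  measurable_fun D (distf f).
Proof.
move=> Mf mD; apply: (@measurable_funS _ _ _ _ setT) => //.
by apply: antitone_measurable => // x y _ _; exact: distf_anti.
Qed.

Lemma cvg_gt_ex (u : nat -> \bar R) a b : u n @[n --> \oo] --> a -> b < a ->
  exists n, b < u n.
Proof.
move=> ua; apply: contraPP => /forallNP H; apply/negP; rewrite -leNgt.
by apply: (cvge_to_le ua); apply: nearW => n; rewrite leNgt; apply/negP.
Qed.

(** Right continuity of the distribution function: the sets {f > l + 1/(n+1)} increase to {f >
    l}. *)
Lemma distf_gt_right f l t : Mplus f -> t%:E < distf f l ->
  exists2 l', (l < l')%R & t%:E < distf f l'.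
Proof.
move=> Mf tD.
pose F n := I01 R `&` [set x | (l + n.+1%:R^-1)%:E < f x].
have UF : \bigcup_n F n = I01 R `&` [set x | l%:E < f x].
  apply/seteqP; split=> [x [n _ [Ix /= lf]]|x [Ix /= lf]].
    by split => //=; apply: le_lt_trans lf; rewrite lee_fin lerDl invr_ge0.
  move: lf; case fx: (f x) => [r| |]// lr.
    have rl : (0 < r - l)%R by rewrite subr_gt0 -lte_fin.
    exists (Num.bound (r - l)^-1) => //; split => //=; rewrite fx lte_fin -ltrBrDl.
    rewrite invf_plt ?posrE//.
    have := archi_boundP (ltW (_ : 0 < (r - l)^-1)%R); rewrite invr_gt0 => /(_ rl).
    by move=> /lt_le_trans; apply; rewrite ler_nat.
  by exists 0%N => //; split => //=; rewrite fx ltry.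
have mF n : measurable (F n) by exact: measurable_superlevel.
have cF : (leb \o F) n @[n --> \oo] --> distf f l.
  rewrite /distf -UF; apply: nondecreasing_cvg_mu => //.
    by apply: bigcup_measurable => n _; exact: mF.
  move=> n m nm; apply/subsetPset => x [Ix /= lf]; split => //=.
  by apply: le_lt_trans lf; rewrite lee_fin lerD2l lef_pV2 ?posrE// ler_nat.
have [n tn] := cvg_gt_ex cF tD.
by exists (l + n.+1%:R^-1)%R => //; rewrite ltrDl invr_gt0.
Qed.

(** [fstar] is the generalized inverse of [distf]. Strict inequalities correspond to each other
    because [distf f] is right continuous. Later passages between levels and rearrangements rely on
    this equivalence. *)
Lemma fstar_gt f l t : Mplus f -> (0 <= l)%R ->
  (l%:E < fstar f t) = (t%:E < distf f l).
Proof.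
move=> Mf l0; apply/idP/idP.
  apply: contraTT; rewrite -!leNgt => Dt.
  by apply: ereal_inf_lbound; exists l.
move=> /(distf_gt_right Mf)[l' ll' tD].
apply: (@lt_le_trans _ _ l'%:E); first by rewrite lte_fin.
apply: le_ereal_inf_tmp => _ [m [m0 Dm] <-]; rewrite lee_fin leNgt.
apply/negP => ml'; move: tD; apply/negP; rewrite -leNgt.
by rewrite (le_trans _ Dm)// distf_anti// ltW.
Qed.

Lemma fstar_ge0 f t : 0 <= fstar f t.
Proof. by apply: le_ereal_inf_tmp => _ [m [m0 _] <-]; rewrite lee_fin. Qed.

Lemma fstar_anti f s t : (s <= t)%R -> fstar f t <= fstar f s.
Proof.
move=> st; apply: ereal_inf_le_tmp => _ [m [m0 Dm] <-]; exists m => //; split => //.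
by rewrite (le_trans Dm)// lee_fin.
Qed.

Lemma measurable_fstar f D : measurable D -> measurable_fun D (fstar f).
Proof.
move=> mD; apply: (@measurable_funS _ _ _ _ setT) => //.
by apply: antitone_measurable => // x y _ _; exact: fstar_anti.
Qed.

Lemma Mplus_fstar f : Mplus (fstar f).
Proof.
by split=> [|x _]; [apply: measurable_fstar; exact: mI01|exact: fstar_ge0].
Qed.

Lemma distf_fstar f l : Mplus f -> (0 <= l)%R -> distf (fstar f) l = distf f l.
Proof.
move=> Mf l0; rewrite {1}/distf.
have D1 := distf_le1 l Mf; have D0 := distf_ge0 f l.
have /fineK dE := distf_fin l Mf.
rewrite (_ : _ `&` _ = `]0%R, fine (distf f l)[%classic); last first.
  apply/seteqP; split=> [x [/I01P[x0 x1] /=]|x /=].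
    by rewrite fstar_gt// -{1}dE lte_fin in_itv/= x0.
  rewrite in_itv/= => /andP[x0 xd]; split; last by rewrite /= fstar_gt// -dE lte_fin.
  by apply/I01P; split => //; rewrite (lt_le_trans xd)// -lee_fin dE.
apply: (etrans (lebesgue_measure_itv _)) => /=; rewrite dE sube0.
by case: ltP => // D0'; apply/le_anti; rewrite D0 D0'.
Qed.

Lemma fstar_le f g t : (forall l, (0 <= l)%R -> distf g l <= distf f l) ->
  fstar g t <= fstar f t.
Proof.
move=> gf; apply: ereal_inf_le_tmp => _ [m [m0 Dm] <-]; exists m => //; split => //.
by rewrite (le_trans (gf _ m0)).
Qed.

Lemma rho_le (rho : (R -> \bar R) -> \bar R) f g : ri_norm rho ->
  Mplus f -> Mplus g -> (forall x, I01 R x -> g x <= f x) -> rho g <= rho f.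
Proof.
by move=> nr Mf Mg gf; apply: (rho_mono nr) => //; apply: aeW.
Qed.

Lemma rho_fstar (rho : (R -> \bar R) -> \bar R) f : ri_norm rho ->
  Mplus f -> rho (fstar f) = rho f.
Proof.
move=> nr Mf; apply: (rho_ri nr) => //; first exact: Mplus_fstar.
by move=> l l0; exact: distf_fstar.
Qed.

(** Rearrangement invariance speaks of equal distribution functions only. Replacing both functions
    by their rearrangements turns an inequality between distribution functions into a pointwise
    one. *)
Lemma rho_distf_le (rho : (R -> \bar R) -> \bar R) f g : ri_norm rho ->
  Mplus f -> Mplus g -> (forall l, (0 <= l)%R -> distf g l <= distf f l) ->
  rho g <= rho f.
Proof.
move=> nr Mf Mg gf; rewrite -(rho_fstar nr Mf) -(rho_fstar nr Mg).
apply: (rho_le nr); [exact: Mplus_fstar..|].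
by move=> x _; exact: fstar_le.
Qed.

Lemma distf_ae_le f g l : Mplus f -> Mplus g ->
  {ae leb, forall x, I01 R x -> g x <= f x} -> distf g l <= distf f l.
Proof.
move=> Mf Mg gf; rewrite !distf_int//.
have [mcf cf0] := Mplus_chi_gt l Mf; have [mcg cg0] := Mplus_chi_gt l Mg.
apply: ae_ge0_le_integral => //; first exact: mI01.
move: gf; apply: ae_imp => x gf Ix; apply: le_chi => lg.
exact: lt_le_trans lg (gf Ix).
Qed.

Lemma measurable_superlevel_prod f : Mplus f ->
  measurable_fun (I01 R `*` halfline R)
    (fun z : R * R => chi (z.2%:E < f z.1) : \bar R).
Proof.
move=> [mf _]; apply: measurable_chi_lt.
  exact: (@measurable_snd_on _ _ _ EFin mI01 mhalfline (@measurable_EFin_id R _)).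
exact: (@measurable_fst_on _ _ _ f mI01 mhalfline mf).
Qed.

Lemma layer_cake_measurable f k : Mplus f -> Mplus k ->
  measurable_fun (halfline R)
    (fun l => \int[leb]_(x in I01 R) (k x * chi (l%:E < f x))).
Proof.
move=> Mf Mk; apply: (tonelli_measurabler (k := fun x l => k x * chi (l%:E < f x))).
- exact: mI01.
- exact: mhalfline.
- apply: emeasurable_funM (measurable_superlevel_prod Mf).
  exact: (@measurable_fst_on _ _ _ k mI01 mhalfline (Mplus_measurable Mk)).
- by move=> x y Ix _; rewrite mule_ge0 ?chi_ge0// Mplus_ge0.
Qed.

Lemma layer_cake f k : Mplus f -> Mplus k ->
  \int[leb]_(x in I01 R) (f x * k x) =
  \int[leb]_(l in halfline R) \int[leb]_(x in I01 R) (k x * chi (l%:E < f x)).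
Proof.
move=> Mf Mk; rewrite -(tonelli (k := fun x l => k x * chi (l%:E < f x))); first last.
- by move=> x y Ix _; rewrite mule_ge0 ?chi_ge0// Mplus_ge0.
- apply: emeasurable_funM (measurable_superlevel_prod Mf).
  exact: (@measurable_fst_on _ _ _ k mI01 mhalfline (Mplus_measurable Mk)).
- exact: mhalfline.
- exact: mI01.
apply: eq_integral => x; rewrite inE => Ix.
rewrite ge0_integralZl//.
- by rewrite layer 1?muleC// Mplus_ge0.
- exact: mhalfline.
- by apply: measurable_chi_lt; [exact: measurable_EFin_id|exact: measurable_cst].
- by move=> l _; exact: chi_ge0.
- by rewrite Mplus_ge0.
Qed.

Lemma integral_distf f : Mplus f ->
  \int[leb]_(x in I01 R) f x = \int[leb]_(l in halfline R) distf f l.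
Proof.
move=> Mf; transitivity (\int[leb]_(x in I01 R) (f x * (cst 1 x))).
  by apply: eq_integral => x _; rewrite mule1.
rewrite (layer_cake Mf (Mplus_cst lee01)).
apply: eq_integral => l _; rewrite distf_int//.
by apply: eq_integral => x _; rewrite mul1e.
Qed.

End Distribution.

(** * Sets of prescribed measure *)

Section IntermediateSet.
Context {R : realType}.
Local Notation leb := (lebm R).

Lemma le_leb (A B : set R) : measurable A -> measurable B -> A `<=` B -> leb A <= leb B.
Proof. by move=> mA mB AB; apply: le_measure => //; rewrite inE; assumption. Qed.

Lemma leb_sub1_fin (A : set R) : measurable A -> A `<=` I01 R -> leb A \is a fin_num.
Proof.
move=> mA A1; rewrite ge0_fin_numE ?measure_ge0//.
apply: (@le_lt_trans _ _ 1); last exact: ltry.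
by rewrite -leb_I01; apply: le_leb => //; exact: mI01.
Qed.

(** The measure of the union of A with the part of B in ]0, x[ is nondecreasing and 1-Lipschitz in
    x, so the intermediate value theorem applies. *)
Lemma intermediate_set (A B : set R) (s : R) : measurable A -> measurable B ->
  A `<=` B -> B `<=` I01 R -> leb A <= s%:E -> s%:E <= leb B ->
  exists E, [/\ measurable E, A `<=` E, E `<=` B & leb E = s%:E].
Proof.
move=> mA mB AB B1 As sB.
pose F x := A `|` (B `&` `]0%R, x[%classic).
have mF x : measurable (F x) by apply: measurableU => //; exact: measurableI.
have FB x : F x `<=` B by move=> y [/AB//|[]].
have F1 x : F x `<=` I01 R by move=> y /FB /B1.
have FE x : (fine (leb (F x)))%:E = leb (F x) by rewrite fineK// leb_sub1_fin.
have Fle x y : (x <= y)%R -> (fine (leb (F x)) <= fine (leb (F y)))%R.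
  move=> xy; rewrite -lee_fin !FE. apply: le_leb => // z [Az|[Bz]].
    by left.
  by rewrite /= in_itv/= => /andP[z0 zx]; right; split => //=; rewrite in_itv/= z0 (lt_le_trans zx).
have Flip x y : (x <= y)%R -> (fine (leb (F y)) <= fine (leb (F x)) + (y - x))%R.
  move=> xy; rewrite -lee_fin EFinD !FE.
  have <- : leb (`[x, y[%classic : set R) = (y - x)%:E.
    apply: (etrans (lebesgue_measure_itv _)) => /=; rewrite lte_fin -EFinD.
    by case: ltP => // yx; congr EFin; apply/esym/eqP; rewrite subr_eq0 eq_le xy yx.
  have mI : measurable (`[x, y[%classic : set R) by exact: measurable_itv.
  apply: le_trans (measureU2 leb (mF x) mI).
  apply: le_leb => //; first exact: measurableU.
  move=> z [Az|[Bz]]; first by left; left.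
  rewrite /= in_itv/= => /andP[z0 zy]; have [zx|xz] := ltP z x.
    by left; right; split => //=; rewrite in_itv/= z0.
  by right; rewrite /= in_itv/= xz.
have cF : continuous (fun x => fine (leb (F x))).
  move=> x; apply/cvgrPdist_le => e e0; near=> y.
  apply: (@le_trans _ _ `|x - y|%R); last first.
    near: y; apply/nbhs_ballP; exists e => // z; rewrite /ball/= => /ltW.
    by [].
  have [xy|/ltW yx] := leP x y.
    by rewrite distrC (distrC x) !ger0_norm ?subr_ge0 ?Fle// lerBlDl Flip.
  by rewrite !ger0_norm ?subr_ge0 ?Fle// lerBlDl Flip.
have [c _ Fc] : exists2 c, c \in `[0%R, 1%R]%R & fine (leb (F c)) = s.
  apply: IVT => //; first exact: continuous_subspaceT.
  have F0 : F 0%R = A.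
    rewrite /F (_ : _ `&` _ = set0) ?setU0//; apply/seteqP; split=> // z [_] /=.
    by rewrite in_itv/= => /andP[/lt_trans h /h]; rewrite ltxx.
  have F1E : F 1%R = B by apply/seteqP; split => [//|z Bz]; right; split => //; exact: B1.
  rewrite ge_min le_max -!lee_fin !FE F0 F1E As sB orbT.
  by [].
by exists (F c); split => //; [move=> z Az; left|rewrite -FE Fc].
Unshelve. all: by end_near.
Qed.

End IntermediateSet.

(** * The K-functional and its extremal sets *)

Section Kfun.
Context {R : realType}.
Implicit Types (f g k : R -> \bar R) (l s : R).

Local Notation leb := (lebm R).

(* Integral of [fstar f] over ]0, s[, that is, the K-functional of the couple
   (L1, Linfty), written through the distribution function. *)
Definition kfun f (s : R) : \bar R :=
  \int[leb]_(l in halfline R) mine (distf f l) s%:E.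

Lemma measurable_mine_distf f (s : R) (D : set R) : Mplus f -> measurable D ->
  measurable_fun D (fun l => mine (distf f l) s%:E).
Proof.
by move=> Mf mD; apply: measurable_mine; [exact: measurable_distf|exact: measurable_cst].
Qed.

(** At each level l the mass of k on {f > l} is at most D(l), because k <= 1, and at most s.
    [kfun_attained] provides the converse, with k an indicator. *)
Lemma int_mul_le_kfun f k s : Mplus f -> Mplus k ->
  (forall x, I01 R x -> k x <= 1) -> \int[leb]_(x in I01 R) k x <= s%:E ->
  \int[leb]_(x in I01 R) (f x * k x) <= kfun f s.
Proof.
move=> Mf Mk k1 ks; rewrite layer_cake//; apply: ge0_le_integral.
- exact: mhalfline.
- move=> l _; apply: integral_ge0 => x Ix.
  by rewrite mule_ge0 ?chi_ge0// Mplus_ge0.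
- exact: layer_cake_measurable.
- by apply: measurable_mine_distf => //; exact: mhalfline.
move=> l _; rewrite le_min; apply/andP; split.
  rewrite distf_int//; apply: integral_mono.
  - by apply: Mplus_mul => //; exact: Mplus_chi_gt.
  - exact: Mplus_chi_gt.
  - by move=> x Ix; rewrite -[leRHS]mul1e lee_pmul ?chi_ge0 ?k1// Mplus_ge0.
apply: le_trans ks; apply: integral_mono => //.
  by apply: Mplus_mul => //; exact: Mplus_chi_gt.
by move=> x Ix; rewrite -[leRHS]mule1 lee_pmul ?chi_ge0 ?chi_le1// Mplus_ge0.
Qed.

(** Nonnegative real levels increasing to a, for finite and infinite a alike. They exhibit {a <= f}
    as an intersection of strict superlevel sets. *)
Lemma ereal_left_seq (a : \bar R) : 0 < a -> exists u : nat -> R,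
  [/\ forall n, (0 <= u n)%R, forall n, (u n)%:E < a,
      {homo u : n m / (n <= m)%N >-> (n <= m)%R} &
      forall y, (forall n, (u n)%:E < y) -> a <= y].
Proof.
case: a => [a||]//; last first.
  move=> _; exists (fun n => n%:R); split => //; [by move=> n; rewrite ltry
    |by move=> n m nm; rewrite ler_nat|].
  move=> [y||] H//; [|by have := H 0%N].
  have := H (Num.bound `|y|%R).
  by rewrite lte_fin ltNge (le_trans (ler_norm y) (ltW (archi_boundP (normr_ge0 y)))).
rewrite lte_fin => a0; exists (fun n => a * (1 - n.+1%:R^-1))%R; split.
- by move=> n; rewrite mulr_ge0 ?(ltW a0)// subr_ge0 invf_le1// ler1n.
- by move=> n; rewrite lte_fin gtr_pMr// gtrBl invr_gt0.
- by move=> n m nm; rewrite ler_pM2l// lerB// lef_pV2 ?posrE// ler_nat.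
move=> [y||] H; [|by rewrite leey|by have := H 0%N].
rewrite lee_fin leNgt; apply/negP => ya.
have e0 : (0 < 1 - y / a)%R by rewrite subr_gt0 ltr_pdivrMr// mul1r.
set e := (1 - y / a)%R in e0; set n := Num.bound e^-1.
have ne : (n.+1%:R^-1 <= e)%R.
  rewrite invf_ple ?posrE//; apply: (@le_trans _ _ n%:R); last by rewrite ler_nat.
  by apply/ltW/archi_boundP; rewrite invr_ge0 ltW.
have ae : (a * e = a - y)%R by rewrite /e; field; exact: lt0r_neq0.
have := H n; rewrite lte_fin mulrBr mulr1; have := ler_wpM2l (ltW a0) ne.
by rewrite ae; move: (a * _)%R => w; lra.
Qed.

(** With a = [fstar f s] one has |{f > a}| <= s <= |{f >= a}|, so a set E of measure s fits in
    between. It lies inside {f > l} for l < a and contains {f > l} for l >= a, hence meets {f > l}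
    in measure min(D(l), s). *)
Lemma kfun_attained f s : Mplus f -> (0 <= s <= 1)%R ->
  exists E, [/\ measurable E, E `<=` I01 R, leb E = s%:E &
    kfun f s <= \int[leb]_(x in I01 R) (f x * chi (x \in E))].
Proof.
move=> Mf /andP[s0 s1]; set a := fstar f s.
have a0 : 0 <= a by exact: fstar_ge0.
pose A := I01 R `&` [set x | a < f x]; pose B := I01 R `&` [set x | a <= f x].
have mf := Mplus_measurable Mf.
have mA : measurable A by apply: emeasurable_fun_o_infty => //; exact: mI01.
have mB : measurable B by apply: emeasurable_fun_c_infty => //; exact: mI01.
have As : leb A <= s%:E.
  have [ay|ay] := eqVneq a +oo.
    rewrite /A ay (_ : _ `&` _ = set0) ?measure0 ?lee_fin//.
    by apply/seteqP; split => // x [_ /=]; rewrite ltNge leey.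
  have ar : (fine a)%:E = a by rewrite fineK// ge0_fin_numE// lt_neqAle ay leey.
  rewrite /A -ar leNgt -/(distf f (fine a)); apply/negP.
  by rewrite -fstar_gt ?fine_ge0// ar ltxx.
have sB : s%:E <= leb B.
  (* There is no nonnegative level below a = 0 to approximate from, but then B is the whole
     interval. *)
  have [a00|] := eqVneq a 0.
    rewrite (_ : B = I01 R) ?leb_I01 ?lee_fin//; apply/seteqP; split => [x []//|x Ix].
    by split => //=; rewrite a00 Mplus_ge0.
  rewrite neq_lt ltNge a0/= => /ereal_left_seq[u [u0 ua und ule]].
  pose F n := I01 R `&` [set x | (u n)%:E < f x].
  have mF n : measurable (F n) by exact: measurable_superlevel.
  have BF : B = \bigcap_n F n.
    apply/seteqP; split => [x [Ix /= ax] n _|x Fx].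
      by split => //=; apply: lt_le_trans ax.
    split; first by case: (Fx 0%N).
    by apply: ule => n; case: (Fx n).
  have : (leb \o F) n @[n --> \oo] --> leb B.
    rewrite BF; apply: nonincreasing_cvg_mu => //.
    - by rewrite (le_lt_trans (distf_le1 _ Mf))// ltry.
    - by rewrite -BF.
    - move=> n m nm; apply/subsetPset => x [Ix /= lf]; split => //=.
      by apply: le_lt_trans lf; rewrite lee_fin und.
  move/cvge_to_ge; apply; apply: nearW => n /=; apply: ltW.
  by rewrite -/(distf f (u n)) -fstar_gt.
have AB : A `<=` B by move=> x [Ix /ltW ?].
have B1 : B `<=` I01 R by move=> x [].
have [E [mE AE EB Es]] := intermediate_set mA mB AB B1 As sB.
have E1 : E `<=` I01 R by move=> x /EB /B1.
have ME := Mplus_chi_mem mE.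
exists E; split => //; rewrite layer_cake//; apply: ge0_le_integral.
- exact: mhalfline.
- by move=> l _; rewrite le_min distf_ge0 lee_fin.
- by apply: measurable_mine_distf => //; exact: mhalfline.
- exact: layer_cake_measurable.
move=> l _; have [la|al] := ltP l%:E a.
  rewrite (@eq_int01 _ (fun x => chi (x \in E))) => [|x Ix]; last first.
    case: (boolP (x \in E)) => [/set_mem/EB[_ /= ax]|_]; last by rewrite chi0 mul0e.
    by rewrite (lt_le_trans la ax) mule1.
  by rewrite integral_chi_mem ?(setIidl E1) ?Es ?ge_min ?lexx ?orbT//; exact: mI01.
rewrite (@eq_int01 _ (fun x => chi (l%:E < f x))) => [|x Ix]; last first.
  case: ltP => lf; last by rewrite chi0 mule0.
  by rewrite mem_set ?mule1//; apply: AE; split => //=; apply: le_lt_trans lf.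
by rewrite -distf_int// ge_min lexx.
Qed.

Lemma kfun_ge0 f s : (0 <= s)%R -> 0 <= kfun f s.
Proof. by move=> s0; apply: integral_ge0 => l _; rewrite le_min distf_ge0 lee_fin. Qed.

Lemma int_mem_le_kfun f (E : set R) s : Mplus f -> measurable E -> E `<=` I01 R ->
  leb E <= s%:E -> \int[leb]_(x in I01 R) (f x * chi (x \in E)) <= kfun f s.
Proof.
move=> Mf mE E1 Es; apply: int_mul_le_kfun => //.
- exact: Mplus_chi_mem.
- by move=> x _; exact: chi_le1.
- by rewrite integral_chi_mem ?(setIidl E1)//; exact: mI01.
Qed.

(** A set that attains the left side competes in both terms on the right. *)
Lemma kfun_add f g s : Mplus f -> Mplus g -> (0 <= s <= 1)%R ->
  kfun (fun x => f x + g x) s <= kfun f s + kfun g s.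
Proof.
move=> Mf Mg s01.
have [E [mE E1 Es /le_trans]] := kfun_attained (Mplus_add Mf Mg) s01; apply.
have ME := Mplus_chi_mem mE.
rewrite (@eq_int01 _ (fun x => f x * chi (x \in E) + g x * chi (x \in E))); last first.
  by move=> x Ix; rewrite ge0_muleDl// Mplus_ge0.
rewrite (int_add (Mplus_mul Mf ME) (Mplus_mul Mg ME)).
by apply: leeD; apply: int_mem_le_kfun; rewrite ?Es.
Qed.

Lemma kfun_scale_le (a s : R) f : Mplus f -> (0 <= a)%R -> (0 <= s <= 1)%R ->
  kfun (fun x => a%:E * f x) s <= a%:E * kfun f s.
Proof.
move=> Mf a0 s01; have a0' : 0 <= a%:E by rewrite lee_fin.
have [E [mE E1 Es /le_trans]] := kfun_attained (Mplus_scale a0' Mf) s01; apply.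
have ME := Mplus_chi_mem mE.
under eq_integral do rewrite -muleA.
rewrite (int_scale a0' (Mplus_mul Mf ME)).
by rewrite lee_wpmul2l// int_mem_le_kfun// Es.
Qed.

Lemma kfun_scale (a s : R) f : Mplus f -> (0 <= a)%R -> (0 <= s <= 1)%R ->
  kfun (fun x => a%:E * f x) s = a%:E * kfun f s.
Proof.
move=> Mf a0 s01; apply/eqP; rewrite eq_le kfun_scale_le//=.
have [->|an0] := eqVneq a 0%R; first by rewrite mul0e kfun_ge0//; case/andP: s01.
have agt0 : (0 < a)%R by rewrite lt0r an0.
rewrite muleC -lee_pdivlMr// muleC.
apply: le_trans (kfun_scale_le _ _ _) => //; last by rewrite invr_ge0.
  rewrite (_ : (fun _ => _) = f)//; apply/funext => x.
  by rewrite muleA -EFinM mulVf// mul1e.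
by apply: Mplus_scale; rewrite ?lee_fin.
Qed.

Lemma kfun_le f s s' : Mplus f -> (0 <= s)%R -> (s <= s')%R -> kfun f s <= kfun f s'.
Proof.
move=> Mf s0 ss'; apply: ge0_le_integral.
- exact: mhalfline.
- by move=> l _; rewrite le_min distf_ge0 lee_fin.
- by apply: measurable_mine_distf => //; exact: mhalfline.
- by apply: measurable_mine_distf => //; exact: mhalfline.
move=> l _; rewrite le_min ge_min lexx/= ge_min.
by rewrite [X in _ || X]lee_fin ss' orbT.
Qed.

Lemma kfun_mul_le f (c s : R) : Mplus f -> (1 <= c)%R -> (0 <= s)%R ->
  kfun f (c * s) <= c%:E * kfun f s.
Proof.
move=> Mf c1 s0; have c0 : (0 <= c)%R by rewrite (le_trans ler01).
rewrite -ge0_integralZl//; first last.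
- by move=> l _; rewrite le_min distf_ge0 lee_fin.
- by apply: measurable_mine_distf => //; exact: mhalfline.
- exact: mhalfline.
apply: ge0_le_integral.
- exact: mhalfline.
- by move=> l _; rewrite le_min distf_ge0 lee_fin mulr_ge0.
- by apply: measurable_mine_distf => //; exact: mhalfline.
- apply: emeasurable_funM; first exact: measurable_cst.
  by apply: measurable_mine_distf => //; exact: mhalfline.
move=> l _; rewrite mine_pMr ?lee_fin// EFinM le_min !ge_min lexx orbT andbT.
by rewrite lee_pemull ?distf_ge0.
Qed.

Lemma kfun_mono f g s : Mplus f -> Mplus g -> (0 <= s)%R ->
  (forall l, (0 <= l)%R -> distf f l <= distf g l) -> kfun f s <= kfun g s.
Proof.
move=> Mf Mg s0 fg; apply: ge0_le_integral.
- exact: mhalfline.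
- by move=> l _; rewrite le_min distf_ge0 lee_fin.
- by apply: measurable_mine_distf => //; exact: mhalfline.
- by apply: measurable_mine_distf => //; exact: mhalfline.
move=> l /halflineP /ltW l0; rewrite le_min [X in _ && X]ge_min lexx orbT andbT.
by rewrite ge_min fg.
Qed.

Lemma kfun1 f : Mplus f -> kfun f 1 = \int[leb]_(x in I01 R) f x.
Proof.
move=> Mf; rewrite integral_distf//; apply: eq_integral => l _.
by apply/min_idPl; exact: distf_le1.
Qed.

End Kfun.

(** * Resonance: a competitor for the pairing with prescribed distribution bound *)

Section Resonance.
Context {R : realType}.
Implicit Types (f g h : R -> \bar R).

Local Notation leb := (lebm R).

Lemma nneseries_le (u : nat -> \bar R) (M : \bar R) : (forall n, 0 <= u n) ->
  (forall n, \sum_(0 <= i < n) u i <= M) -> \sum_(0 <= i <oo) u i <= M.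
Proof.
move=> u0 uM; apply: lime_le; first by apply: is_cvg_nneseries.
by apply: nearW => n; exact: uM.
Qed.

Local Notation half := ((2%:R : R)^-1)%R.

Lemma half_expr_lt (d : R) : (0 < d)%R -> exists j, (half ^+ j.+1 < d)%R.
Proof.
move=> d0; have [n dn] : exists n, (d^-1 < 2%:R ^+ n)%R.
  exists (Num.bound d^-1); apply: (lt_trans (archi_boundP _)).
    by rewrite invr_ge0 ltW.
  by rewrite -natrX ltr_nat ltn_expl.
exists n; rewrite exprVn invf_plt ?posrE ?exprn_gt0//.
by apply: (lt_le_trans dn); rewrite ler_eXn2l// ltr1n.
Qed.

Lemma dyadic_bracket (d : R) : (0 < d <= 1)%R ->
  exists j, (half ^+ j.+1 < d <= half ^+ j)%R.
Proof.
move=> /andP[d0 d1].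
have ex := half_expr_lt d0.
case: (ex_minnP ex) => j jd jmin; exists j; rewrite jd/=.
case: j jd jmin => [|j] jd jmin; first by rewrite expr0.
by rewrite leNgt; apply/negP => /jmin; rewrite ltnn.
Qed.

Lemma sum_half_le j n : (\sum_(0 <= i < n) half ^+ (j + i).+2 <= half ^+ j.+1)%R.
Proof.
suff -> : (\sum_(0 <= i < n) half ^+ (j + i).+2 = half ^+ j.+1 - half ^+ (j + n).+1)%R.
  by rewrite gerBl exprn_ge0// invr_ge0.
elim: n => [|n ih]; first by rewrite big_geq// addn0 subrr.
by rewrite big_nat_recr//= ih addnS !exprS; field.
Qed.

Definition dyadic_level f (j : nat) : set R :=
  halfline R `&` [set l | (half ^+ j.+1)%:E < distf f l] `&`
    [set l | distf f l <= (half ^+ j)%:E].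

Lemma measurable_dyadic_level f j : Mplus f -> measurable (dyadic_level f j).
Proof.
move=> Mf; rewrite /dyadic_level.
rewrite (_ : _ `&` _ = (halfline R `&` [set l | (half ^+ j.+1)%:E < distf f l]) `&`
   (halfline R `&` [set l | distf f l <= (half ^+ j)%:E])); last first.
  by rewrite setIACA setIid setIA.
apply: measurableI.
  by apply: emeasurable_fun_o_infty; [exact: mhalfline|apply: measurable_distf => //; exact: mhalfline].
by apply: emeasurable_fun_infty_c; [exact: mhalfline|apply: measurable_distf => //; exact: mhalfline].
Qed.

Lemma trivIset_dyadic_level f : trivIset setT (dyadic_level f).
Proof.
suff H i j x : (i < j)%N -> dyadic_level f i x -> dyadic_level f j x -> False.
  apply/trivIsetP => i j _ _; rewrite neq_ltn => /orP[] ij;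
    apply/seteqP; split=> // x [xi xj]; [exact: (H _ _ _ ij xi xj)|exact: (H _ _ _ ij xj xi)].
move=> ij [[_ /= iD] _] [_ /= Dj]; have := lt_le_trans iD Dj; rewrite lte_fin.
by apply/negP; rewrite -leNgt; apply: ler_wiXn2l => //; rewrite invf_le1// ler1n.
Qed.

(** If D(l) <= 2^-(j+1), then D exceeds 2^-(j+1) only at levels below l. The blocks are disjoint, so
    those with index below n have total length at most l. *)
Lemma sum_dyadic_level_le f l n : Mplus f -> (0 <= l)%R ->
  (forall j, (j < n)%N -> distf f l <= (half ^+ j.+1)%:E) ->
  \sum_(0 <= j < n) leb (dyadic_level f j) <= l%:E.
Proof.
move=> Mf l0 H.
have mL j := @measurable_dyadic_level f j Mf.
rewrite big_mkord -(measure_bigsetU leb mL (trivIset_dyadic_level (f := f)) n).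
have <- : leb (`]0%R, l[%classic : set R) = l%:E.
  apply: (etrans (lebesgue_measure_itv _)) => /=; rewrite lte_fin sube0.
  by case: ltP => // l0'; congr EFin; apply/le_anti; rewrite l0 l0'.
apply: le_leb; [exact: bigsetU_measurable|exact: measurable_itv|].
rewrite -bigcup_mkord => x [j /= jn [[x0 /= jD] _]].
rewrite in_itv/=; move/halflineP : x0 => ->/=; rewrite ltNge; apply/negP => lx.
have := lt_le_trans jD (le_trans (distf_anti Mf lx) (H _ jn)).
by rewrite ltxx.
Qed.

Lemma half_expr01 j : (0 <= half ^+ j <= 1)%R.
Proof. by rewrite exprn_ge0 ?invr_ge0//= exprn_ile1 ?invr_ge0// invf_le1// ler1n. Qed.

(** Take h to be the sum over j of |L_j| times the indicator of E_j, where L_j = [dyadic_level f j]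
    and E_j attains [kfun g] at 2^-(j+2). If D(l) lies in the block j0, the terms with j < j0 add up
    to at most l, so h > l forces x into some E_j with j >= j0; these sets have total measure at
    most 2^-(j0+1) < D(l). The factor 4 pays for replacing 2^-j by 2^-(j+2) inside [kfun]. The sets
    E_j need not be nested. *)
Lemma resonance f g : Mplus f -> Mplus g -> exists h, [/\ Mplus h,
  (forall l, (0 <= l)%R -> distf h l <= distf f l) &
  \int[leb]_(l in halfline R) kfun g (fine (distf f l)) <=
    4%:E * \int[leb]_(x in I01 R) (h x * g x)].
Proof.
move=> Mf Mg.
(* The exponent j.+2 makes the measures from index j0 on sum to 2^-(j0+1), strictly below D(l). *)
have /choice[E EP] : forall j, exists E, [/\ measurable E, E `<=` I01 R,
    leb E = (half ^+ j.+2)%:E &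
    kfun g (half ^+ j.+2) <= \int[leb]_(x in I01 R) (g x * chi (x \in E))].
  by move=> j; apply: kfun_attained => //; exact: half_expr01.
have mE j : measurable (E j) by case: (EP j).
have mL j := @measurable_dyadic_level f j Mf.
pose u j x : \bar R := leb (dyadic_level f j) * chi (x \in E j).
have Mu j : Mplus (u j) by apply: Mplus_scale; [exact: measure_ge0|exact: Mplus_chi_mem].
have u0 j x : 0 <= u j x by rewrite mule_ge0 ?measure_ge0 ?chi_ge0.
pose h x := \sum_(0 <= j <oo) u j x.
have Mh : Mplus h.
  split; last by move=> x _; apply: nneseries_ge0.
  have := @ge0_emeasurable_sum _ _ R (I01 R) u xpredT.
  by apply => [k x _ _|k _] //; case: (Mu k).
have hle l n : (0 <= l)%R -> (forall j, (j < n)%N -> distf f l <= (half ^+ j.+1)%:E) ->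
    forall x, \sum_(0 <= j < n) u j x <= l%:E.
  move=> l0 H x; apply: le_trans (sum_dyadic_level_le Mf l0 H).
  apply: lee_sum => j _; rewrite -[leRHS]mule1 lee_wpmul2l ?measure_ge0 ?chi_le1//.
exists h; split => //.
- move=> l l0; have [D0|D0] := eqVneq (distf f l) 0.
    rewrite (_ : distf h l = 0) ?distf_ge0// /distf (_ : _ `&` _ = set0) ?measure0//.
    apply/seteqP; split => // x [_ /=]; rewrite ltNge; apply/negP; rewrite negbK.
    apply: nneseries_le => // n; apply: hle => // j _.
    by rewrite D0 lee_fin; case/andP: (half_expr01 j.+1).
  have dE : (fine (distf f l))%:E = distf f l by rewrite fineK// distf_fin.
  have : (0 < fine (distf f l) <= 1)%R.
    by rewrite -lte_fin -lee_fin dE distf_le1// lt0e D0 distf_ge0.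
  move=> /dyadic_bracket[j0 /andP[j0D Dj0]].
  apply: (@le_trans _ _ (half ^+ j0.+1)%:E); last by rewrite -dE lee_fin ltW.
  have : leb (I01 R `&` [set x | l%:E < h x]) <= \sum_(0 <= i <oo) leb (E (j0 + i)%N).
    apply: (@measure_sigma_subadditive _ _ _ leb _ (fun i => E (j0 + i)%N) _ (measurable_superlevel l Mh)) => [i|]; first exact: mE.
    move=> x [Ix /= lh]; apply: contrapT => H; move: lh; apply/negP; rewrite -leNgt.
    rewrite /h (nneseries_split 0 j0)// add0n.
    rewrite [X in _ + X]eseries0 ?adde0; last first.
      move=> i ji _; rewrite /u; have [/set_mem Ei|_] := boolP (x \in E i).
        by exfalso; apply: H; exists (i - j0)%N => //; rewrite subnKC.
      by rewrite chi0 mule0.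
    apply: hle => // j jj0; rewrite -dE lee_fin (le_trans Dj0)//.
    by apply: ler_wiXn2l => //; rewrite invf_le1// ler1n.
  move=> /le_trans; apply; apply: nneseries_le => [i|n]; first exact: measure_ge0.
  rewrite (eq_bigr (fun i => (half ^+ (j0 + i).+2)%:E)) => [|i _]; last by case: (EP (j0 + i)%N).
  by rewrite sumEFin lee_fin sum_half_le.
have Mgu j : Mplus (fun x => u j x * g x) by exact: Mplus_mul.
have dfin l : (fine (distf f l))%:E = distf f l by rewrite fineK// distf_fin.
have d0 l : (0 <= fine (distf f l))%R by rewrite fine_ge0// distf_ge0.
pose v j l : \bar R := chi (l \in dyadic_level f j) * (4%:E * kfun g (half ^+ j.+2)).
have k0 j : 0 <= kfun g (half ^+ j.+2) by apply: kfun_ge0; case/andP: (half_expr01 j.+2).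
have v0 j l : 0 <= v j l by rewrite mule_ge0 ?chi_ge0// mule_ge0.
have mv j : measurable_fun (halfline R) (v j).
  by apply: emeasurable_funM; [exact: measurable_chi_mem|exact: measurable_cst].
(* Each level with D(l) > 0 belongs to a block, whose single term already dominates. *)
have kv l : halfline R l -> kfun g (fine (distf f l)) <= \sum_(0 <= j <oo) v j l.
  move=> l0; have [D0|D0] := eqVneq (distf f l) 0.
    rewrite D0/= (_ : kfun g 0 = 0) ?nneseries_ge0//.
    apply: integral0_eq => m _; exact/min_idPr/distf_ge0.
  have : (0 < fine (distf f l) <= 1)%R.
    by rewrite -lte_fin -lee_fin dfin distf_le1// lt0e D0 distf_ge0.
  move=> /dyadic_bracket[j /andP[jD Dj]].
  have lj : l \in dyadic_level f j.
    by apply/mem_set; split => /=; [split => //=|]; rewrite -dfin ?lte_fin ?lee_fin.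
  apply: (@le_trans _ _ (v j l)); last first.
    apply: le_trans (nneseries_lim_ge j.+1 _) => //.
    by rewrite big_nat_recr//= leeDr// sume_ge0.
  rewrite /v lj mul1e; apply: le_trans (kfun_mul_le Mg _ _); last 2 first.
  - by rewrite ler1n.
  - by case/andP: (half_expr01 j.+2).
  apply: kfun_le => //; apply: (le_trans Dj).
  suff <- : (half ^+ j = 4 * half ^+ j.+2)%R by [].
  by rewrite !exprS; field.
apply: (@le_trans _ _ (\int[leb]_(l in halfline R) \sum_(0 <= j <oo) v j l)).
  apply: ge0_le_integral => //.
  - exact: mhalfline.
  - by move=> l _; exact: kfun_ge0.
  - apply: antitone_measurable; first exact: is_interval_halfline.
    by move=> x y _ _ xy; apply: kfun_le => //; rewrite -lee_fin !dfin distf_anti.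
  - have := @ge0_emeasurable_sum _ _ R (halfline R) v xpredT.
    by apply => [j l _ _|j _].
rewrite (integral_nneseries leb mhalfline mv) => [|j l _]; last exact: v0.
apply: nneseries_le => [j|n]; first exact: integral_ge0.
apply: (@le_trans _ _ (\sum_(0 <= j < n) 4%:E * \int[leb]_(x in I01 R) (u j x * g x))).
  apply: lee_sum => j _.
  rewrite int_mulr; [|exact: mhalfline|exact: measurable_chi_mem|
    by move=> l _; exact: chi_ge0|by rewrite mule_ge0].
  rewrite (integral_chi_mem mhalfline (mL j)) (setIidl (_ : dyadic_level f j `<=` halfline R)); last first.
    by move=> l [[]].
  rewrite muleCA lee_pmul2l//.
  rewrite (@eq_int01 _ (fun x => leb (dyadic_level f j) * (g x * chi (x \in E j)))); last first.
    by move=> x _; rewrite /u -muleA (muleC (g x)).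
  rewrite int_scale ?measure_ge0//; last by apply: Mplus_mul => //; exact: Mplus_chi_mem.
  by rewrite lee_wpmul2l ?measure_ge0//; case: (EP j).
rewrite -ge0_sume_distrr; last first.
  by move=> j _; apply: int_ge0; exact: Mplus_mul.
rewrite lee_pmul2l//.
rewrite -ge0_integral_sum; first last.
- by move=> j x Ix; case: (Mgu j) => _; apply.
- by move=> j; case: (Mgu j).
- exact: mI01.
apply: ge0_le_integral.
- exact: mI01.
- by move=> x Ix; apply: sume_ge0 => j _; case: (Mgu j) => _; apply.
- by apply: emeasurable_sum => j; case: (Mgu j).
- by case: (Mplus_mul Mh Mg).
move=> x Ix; rewrite -ge0_sume_distrl//.
apply: lee_wpmul2r; first exact: (Mplus_ge0 Mg Ix).
by apply: nneseries_lim_ge => k _ _; exact: u0.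
Qed.

End Resonance.

(** * Lorentz-Luxemburg duality by L2 projection *)

Section LorentzLuxemburg.
Context {R : realType}.
Variable rho : (R -> \bar R) -> \bar R.
Hypothesis nr : ri_norm rho.

Local Notation leb := (lebm R).
Local Notation mfun := (measurable_fun (I01 R)).
Implicit Types (h k g : R -> R).

Lemma Mplus_EFin (h : R -> R) : mfun h -> (forall x, I01 R x -> (0 <= h x)%R) ->
  Mplus (EFin \o h).
Proof. by move=> mh h0; split=> [|x Ix]; [exact/measurable_EFinP|rewrite lee_fin h0]. Qed.

Lemma rho0 : rho (cst 0) = 0.
Proof.
apply/(rho_eq0 nr); first exact: Mplus_cst.
by apply: aeW.
Qed.

Lemma rho_cst_lty (c : R) : (0 <= c)%R -> rho (cst c%:E) < +oo.
Proof.
move=> c0; pose f (x : R) : \bar R := (\1_(I01 R) x)%:E.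
have flty : rho f < +oo := rho_indic nr mI01 (fun x Ix => Ix).
have Mf : Mplus f by exact: (Mplus_chi_mem (@mI01 R)).
apply: (@le_lt_trans _ _ (rho (fun x => c%:E * f x))).
  apply: (rho_le nr); [exact: Mplus_scale|exact: Mplus_cst|move=> x Ix].
  by rewrite /f indicE mem_set// mule1.
by rewrite (rho_scale nr)// lte_mul_pinfty ?lee_fin.
Qed.

Lemma rho_bounded_lty (F : R -> \bar R) (M : R) : Mplus F -> (0 <= M)%R ->
  (forall x, I01 R x -> F x <= M%:E) -> rho F < +oo.
Proof.
move=> MF M0 FM; apply: le_lt_trans (rho_cst_lty M0).
by apply: (rho_le nr) => //; exact: Mplus_cst.
Qed.

Section Bounded.
Variables (F : R -> R) (M : R).
Hypotheses (mF : mfun F) (F0 : forall x, I01 R x -> (0 <= F x)%R).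
Hypothesis FM : forall x, I01 R x -> (F x <= M)%R.

Let sqd (h k : R -> R) := \int[leb]_(x in I01 R) ((h x - k x) ^+ 2)%:E.

Let ball (h : R -> R) := [/\ mfun h, (forall x, I01 R x -> (0 <= h x)%R) &
  rho (EFin \o h) <= 1].

Let Mplus_sqd h k : mfun h -> mfun k -> Mplus (fun x => ((h x - k x) ^+ 2)%:E).
Proof.
move=> mh mk; apply: (Mplus_EFin (h := fun x => ((h x - k x) ^+ 2)%R)).
  by apply: measurable_funX; exact: measurable_funB.
by move=> x _; exact: sqr_ge0.
Qed.

Let M0 : (0 <= M)%R.
Proof.
have I2 : I01 R (2^-1)%R by apply/I01P; rewrite invr_gt0 invf_lt1// ltr1n.
exact: le_trans (F0 I2) (FM I2).
Qed.

Let ball_convex h k (t : R) : (0 <= t <= 1)%R -> ball h -> ball k ->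
  ball (fun x => (1 - t) * h x + t * k x)%R.
Proof.
move=> /andP[t0 t1] [mh h0 h1] [mk k0 k1].
have t1' : (0 <= 1 - t)%R by rewrite subr_ge0.
split.
- by apply: measurable_funD; apply: measurable_funM => //; exact: measurable_cst.
- by move=> x Ix; rewrite addr_ge0 ?mulr_ge0 ?h0 ?k0.
have Mh := Mplus_EFin mh h0; have Mk := Mplus_EFin mk k0.
have -> : EFin \o (fun x => (1 - t) * h x + t * k x)%R =
   (fun x => (1 - t)%:E * (EFin \o h) x) \+ (fun x => t%:E * (EFin \o k) x) by [].
apply: le_trans (rho_add nr _ _) _; [by apply: Mplus_scale|by apply: Mplus_scale|].
rewrite !(rho_scale nr)//.
apply: (@le_trans _ _ ((1 - t)%:E * 1 + t%:E * 1)).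
  by apply: leeD; apply: lee_wpmul2l.
by rewrite !mule1 -EFinD subrK.
Qed.

Let parallelogram h k : mfun h -> mfun k ->
  sqd F (fun x => (1 - 2^-1) * h x + 2^-1 * k x)%R +
  (4^-1)%:E * sqd h k = (2^-1)%:E * (sqd F h + sqd F k).
Proof.
move=> mh mk.
have Mhk := Mplus_sqd mh mk; have Fh := Mplus_sqd mF mh; have Fk := Mplus_sqd mF mk.
rewrite /sqd -int_add// -!int_scale//; last exact: Mplus_add.
rewrite -int_add; first last.
- by apply: Mplus_scale.
- by apply: Mplus_sqd => //; apply: measurable_funD; apply: measurable_funM => //; exact: measurable_cst.
apply: eq_int01 => x Ix; rewrite /= -?EFinM -?EFinD -?EFinM -?EFinD -?EFinM; congr EFin; by field.
Qed.

(** A minimizing sequence has square-summable gaps by the parallelogram identity, and its lower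
    limit g stays in the unit ball by the Fatou property. Restricting the candidates to functions
    below F yields g <= F, so that F - g is nonnegative. *)
Let projection : exists g, [/\ ball g, forall x, I01 R x -> (g x <= F x)%R &
  forall h, ball h -> sqd F g <= sqd F h].
Proof.
pose ballF h := ball h /\ forall x, I01 R x -> (h x <= F x)%R.
pose S := [set sqd F h | h in ballF].
have ball0 : ballF (cst 0%R).
  by split=> //; split; [exact: measurable_cst|by []|rewrite [rho _]rho0].
have S0 : S (sqd F (cst 0%R)) by exists (cst 0%R).
have sq_fin h : ballF h -> sqd F h <= (M ^+ 2)%:E.
  move=> [[mh h0 _] hF]; rewrite /sqd.
  apply: (@le_trans _ _ (\int[leb]_(x in I01 R) (cst (M ^+ 2)%:E x))).
    apply: integral_mono; [exact: (Mplus_sqd mF mh)|by apply: Mplus_cst; rewrite lee_fin sqr_ge0|].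
    move=> x Ix; rewrite lee_fin ler_pXn2r ?nnegrE ?M0 ?subr_ge0 ?hF//.
    by rewrite lerBlDr (le_trans (FM Ix))// lerDl h0.
  by rewrite int_cst.
have dfin : ereal_inf S \is a fin_num.
  rewrite ge0_fin_numE.
    by apply: (@le_lt_trans _ _ (sqd F (cst 0%R))); [exact: ereal_inf_lbound|
      exact: le_lt_trans (sq_fin _ ball0) (ltry _)].
  apply: le_ereal_inf_tmp => _ [h _ <-]; apply: integral_ge0 => x _.
  by rewrite lee_fin sqr_ge0.
(* The factor 1/4 cancels the one in front of the gap in the parallelogram identity, leaving squared
   gaps of at most 4^-n. *)
pose e n : R := (4^-1 * 4^-1 ^+ n)%R.
have e0 n : (0 < e n)%R by rewrite mulr_gt0 ?exprn_gt0 ?invr_gt0.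
have /choice[h hP] : forall n, exists h, ballF h /\ sqd F h < ereal_inf S + (e n)%:E.
  move=> n; have [_ [h bh <-] hlt] := lb_ereal_inf_adherent (e0 n) dfin.
  by exists h.
have mh n : mfun (h n) by case: (hP n) => -[[]].
have h0 n x : I01 R x -> (0 <= h n x)%R by case: (hP n) => -[[_ h0 _] _ _]; exact: h0.
have hF n x : I01 R x -> (h n x <= F x)%R by case: (hP n) => -[_ hF] _; exact: hF.
have step n : sqd (h n) (h n.+1) <= (4^-1 ^+ n)%:E.
  have [bn ltn] := hP n; have [bn1 ltn1] := hP n.+1.
  have inm : ballF (fun x => (1 - 2^-1) * h n x + 2^-1 * h n.+1 x)%R.
    split; first by apply: ball_convex; [rewrite invr_ge0 invf_le1// ler1n andbT|case: bn|case: bn1].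
    by move=> x Ix; have := hF n x Ix; have := hF n.+1 x Ix; lra.
  have ee : (e n.+1 <= e n)%R.
    have q0 : (0 <= (4^-1 : R) ^+ n)%R by rewrite exprn_ge0 ?invr_ge0.
    by rewrite /e exprS; lra.
  have : ereal_inf S + (4^-1)%:E * sqd (h n) (h n.+1) <= ereal_inf S + (e n)%:E.
    apply: (@le_trans _ _ (sqd F (fun x => (1 - 2^-1) * h n x + 2^-1 * h n.+1 x)%R +
        (4^-1)%:E * sqd (h n) (h n.+1))).
      by rewrite leeD2r//; apply: ereal_inf_lbound; exists (fun x => (1 - 2^-1) * h n x + 2^-1 * h n.+1 x)%R.
    rewrite parallelogram//.
    apply: (@le_trans _ _ ((2^-1)%:E * ((ereal_inf S + (e n)%:E) + (ereal_inf S + (e n)%:E)))).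
      rewrite lee_pmul2l//; apply: leeD; first exact: ltW.
      by apply/ltW; apply: (lt_le_trans ltn1); rewrite leeD2l// lee_fin.
    by rewrite -(fineK dfin) -!EFinD -EFinM lee_fin; lra.
  by rewrite leeD2lE// /e EFinM lee_pmul2l.
pose dh (k : nat) x : \bar R := (`|h k x - h k.+1 x|)%:E.
have Mdh (k : nat) : Mplus (dh k).
  apply: (Mplus_EFin (h := fun x => `|h k x - h k.+1 x|%R)) => [|x _]; last exact: normr_ge0.
  by apply: measurableT_comp => //; exact: measurable_funB.
have int_dh (k : nat) : \int[leb]_(x in I01 R) dh k x <= (2 * 2^-1 ^+ k)%:E.
  have p0 : (0 < (2 : R) ^+ k)%R by rewrite exprn_gt0.
  apply: (@le_trans _ _ (\int[leb]_(x in I01 R)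
      ((2 ^+ k)%:E * ((h k x - h k.+1 x) ^+ 2)%:E + (2^-1 ^+ k)%:E))).
    apply: integral_mono => //.
      apply: Mplus_add; [apply: Mplus_scale; rewrite ?lee_fin ?ltW//; exact: Mplus_sqd|].
      by apply: Mplus_cst; rewrite lee_fin exprn_ge0 ?invr_ge0.
    move=> x Ix; rewrite /dh -EFinM -EFinD lee_fin -real_normK ?num_real//.
    set a := `|_|%R; have a0 : (0 <= a)%R by exact: normr_ge0.
    rewrite exprVn; set c := (2 ^+ k)%R in p0 *.
    (* The inequality 2 a <= c a^2 + 1/c with c = 2^k plays the role of Cauchy-Schwarz: a squared L2
       gap of 4^-k becomes an L1 gap of order 2^-k. *)
    have : (0 <= c^-1 * (c * a - 1) ^+ 2)%R by rewrite mulr_ge0 ?sqr_ge0// invr_ge0 ltW.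
    have -> : (c^-1 * (c * a - 1) ^+ 2 = c * a ^+ 2 - 2 * a + c^-1)%R.
      by field; rewrite lt0r_neq0.
    lra.
  rewrite int_add; first last.
  - by apply: Mplus_cst; rewrite lee_fin exprn_ge0 ?invr_ge0.
  - by apply: Mplus_scale; [rewrite lee_fin ltW|exact: Mplus_sqd].
  rewrite int_cst int_scale; [|by rewrite lee_fin ltW|exact: Mplus_sqd].
  apply: (@le_trans _ _ ((2 ^+ k)%:E * (4^-1 ^+ k)%:E + (2^-1 ^+ k)%:E)).
    by rewrite leeD2r// lee_pmul2l ?lte_fin//; exact: step.
  rewrite -EFinM -EFinD lee_fin -exprMn.
  by rewrite (_ : 2 * 4^-1 = 2^-1 :> R)%R; [lra|field].
pose r n x := \sum_(0 <= i <oo) dh (n + i)%N x.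
have Mr n : Mplus (r n).
  split; last by move=> x _; apply: nneseries_ge0 => i _ _; rewrite lee_fin.
  have := @ge0_emeasurable_sum _ _ R (I01 R) (fun i => dh (n + i)%N) xpredT.
  by apply => [i x Ix _|i _]; [rewrite lee_fin|case: (Mdh (n + i)%N)].
have int_r n : \int[leb]_(x in I01 R) r n x <= (8 * 2^-1 ^+ n.+1)%:E.
  rewrite /r (integral_nneseries leb mI01) => [|i|i x Ix]; last 2 first.
  - by case: (Mdh (n + i)%N).
  - by rewrite lee_fin.
  apply: nneseries_le => [i|m]; first exact: int_ge0.
  apply: (@le_trans _ _ (\sum_(0 <= i < m) (8 * 2^-1 ^+ (n + i).+2)%:E)).
    apply: lee_sum => i _; apply: le_trans (int_dh _) _; rewrite lee_fin !exprS.
    have q0 : (0 <= (2^-1 : R) ^+ (n + i))%R by rewrite exprn_ge0 ?invr_ge0.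
    by lra.
  rewrite sumEFin lee_fin -mulr_sumr ler_pM2l//; exact: sum_half_le.
pose u x n : \bar R := einfs (fun m => (h m x)%:E) n.
pose G x := limn (u x).
have uG x : u x n @[n --> \oo] --> G x by exact: is_cvg_einfs.
have u0 x n : I01 R x -> 0 <= u x n.
  by move=> Ix; apply: le_ereal_inf_tmp => _ [k _ <-]; rewrite lee_fin h0.
have uh x n : u x n <= (h n x)%:E.
  by apply: ereal_inf_lbound; exists n => /=.
have mu n : Mplus (u ^~ n).
  split; last by move=> x; exact: u0.
  by apply: measurable_fun_einfs => k; exact/measurable_EFinP.
have G0 x : I01 R x -> 0 <= G x.
  by move=> Ix; apply: lime_ge; [exact: is_cvg_einfs|apply: nearW => n; exact: u0].
have GF x : I01 R x -> G x <= (F x)%:E.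
  move=> Ix; apply: lime_le; [exact: is_cvg_einfs|apply: nearW => n].
  by apply: (le_trans (uh _ _)); rewrite lee_fin hF.
have MG : Mplus G.
  split=> //; apply: (@emeasurable_fun_cvg _ _ _ (I01 R) (fun n => u ^~ n)) => [n|x _].
    by case: (mu n).
  exact: uG.
pose g x := fine (G x).
have gE x : I01 R x -> (g x)%:E = G x.
  move=> Ix; rewrite fineK// ge0_fin_numE ?G0//.
  by rewrite (le_lt_trans (GF _ Ix))// ltry.
have mg : mfun g.
  apply/measurable_EFinP; apply: (eq_measurable_fun G); last by case: MG.
  by move=> x; rewrite inE => Ix; rewrite /= gE.
have g0 x : I01 R x -> (0 <= g x)%R by move=> Ix; rewrite -lee_fin gE// G0.
have gF x : I01 R x -> (g x <= F x)%R by move=> Ix; rewrite -lee_fin gE// GF.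
have rho_g : rho (EFin \o g) <= 1.
  have Mg := Mplus_EFin mg g0.
  have : rho (u ^~ n) @[n --> \oo] --> rho (EFin \o g).
    apply: (rho_fatou nr) => //; apply: aeW => x Ix; split; last by rewrite /= gE//; exact: uG.
    by move=> n m; exact: nondecreasing_einfs.
  move/cvge_to_le; apply; apply: nearW => n.
  have [[[_ _ hn1] _] _] := hP n; apply: le_trans hn1.
  by apply: (rho_le nr) => //; apply: Mplus_EFin => //; exact: h0.
(* Telescoping gives h k >= h n - r n for k >= n. This one-sided bound suffices: where g exceeds h
   n, it is closer to F, because g <= F. *)
have ur x n (c : R) : I01 R x -> r n x <= c%:E -> (h n x <= g x + c)%R.
  move=> Ix rc; rewrite -lee_fin EFinD -lee_subel_addr// gE//.
  apply: (@le_trans _ _ (u x n)); last first.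
    apply: (@lime_ge); first exact: is_cvg_einfs.
    by near=> m; apply: nondecreasing_einfs; near: m; exact: nbhs_infty_ge.
  apply: le_ereal_inf_tmp => _ [k /= nk <-]; rewrite -EFinB lee_fin lerBlDr -lerBlDl.
  rewrite -lee_fin; apply: le_trans rc; rewrite -(subnKC nk); move: (k - n)%N => j.
  apply: (@le_trans _ _ (\sum_(0 <= i < j) dh (n + i)%N x)); last first.
    by apply: nneseries_lim_ge => i _ _; rewrite lee_fin.
  elim: j => [|j ih]; first by rewrite big_geq// addn0 subrr.
  rewrite big_nat_recr//= addnS; apply: le_trans (leeD ih (lexx _)).
  rewrite /dh -EFinD lee_fin; have := ler_norm (h (n + j)%N x - h (n + j).+1 x)%R; lra.
(* Where h n > g the squares differ by (h n - g)(2 F - g - h n) <= 2 M r n. The extra 1 keeps K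
   positive when M = 0, which matters at points where r n is infinite. *)
pose K := (2 * M + 1)%R.
have K0 : (0 < K)%R by have := M0; rewrite /K; lra.
have K0' : 0 <= K%:E by rewrite lee_fin ltW.
have sqd_g n : sqd F g <= ereal_inf S + (e n + K * (8 * 2^-1 ^+ n.+1))%:E.
  apply: (@le_trans _ _ (sqd F (h n) + K%:E * \int[leb]_(x in I01 R) r n x)).
    rewrite /sqd -int_scale// -int_add; [|exact: Mplus_sqd|exact: Mplus_scale].
    apply: integral_mono; first exact: Mplus_sqd.
      by apply: Mplus_add; [exact: Mplus_sqd|exact: Mplus_scale].
    move=> x Ix; have r0 := Mplus_ge0 (Mr n) Ix.
    have := @ur x n; case: (r n x) r0 => [p||]// p0; last first.
      by move=> _; rewrite gt0_muley ?lte_fin// addey// leey.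
    move=> /(_ p Ix (lexx _)) hp; rewrite -EFinM -EFinD lee_fin.
    have := g0 x Ix; have := gF x Ix; have := h0 n x Ix; have := hF n x Ix; have := FM Ix.
    move: p0; rewrite lee_fin /K.
    move: (g x) (h n x) (F x) hp => G' h' F' hp p0 FM' hF' h0' gF' g0'.
    have [hg|gh] := leP h' G'.
      have : ((F' - G') ^+ 2 <= (F' - h') ^+ 2)%R.
        by rewrite ler_pXn2r ?nnegrE ?subr_ge0// lerB.
      have : (0 <= (2 * M + 1) * p)%R by rewrite mulr_ge0// ltW.
      lra.
    have : ((h' - G') * (2 * F' - G' - h') <= p * (2 * M))%R.
      by apply: ler_pM; lra.
    have -> : ((F' - G') ^+ 2 = (F' - h') ^+ 2 + (h' - G') * (2 * F' - G' - h'))%R by ring.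
    lra.
  rewrite (EFinD (e n)) (EFinM K) addeA; apply: leeD; last first.
    by apply: lee_wpmul2l; rewrite // int_r.
  by apply: ltW; case: (hP n).
have gS : sqd F g <= ereal_inf S.
  apply/lee_addgt0Pr => ep ep0.
  have [n nep] : exists n, (2^-1 ^+ n.+1 < ep / (1 + 8 * K) :> R)%R.
    by apply: half_expr_lt; rewrite divr_gt0//; lra.
  apply: (le_trans (sqd_g n)); rewrite leeD2l// lee_fin.
  have en : (e n <= 2^-1 ^+ n.+1)%R.
    rewrite /e -exprS; apply: lerXn2r; rewrite ?nnegrE ?invr_ge0//.
    by rewrite lef_pV2 ?posrE// ler_nat.
  move: nep; rewrite ltr_pdivlMr; last by lra.
  lra.
exists g; split => // k [mk k0 k1].
(* An arbitrary k in the ball is replaced by min(k, F), which stays in the ball and is nowhere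
   farther from F. *)
apply: (le_trans gS); apply: (@le_trans _ _ (sqd F (fun x => Num.min (k x) (F x)))).
  have mkF : mfun (fun x => Num.min (k x) (F x)) by exact: measurable_minr.
  have mk0 x : I01 R x -> (0 <= Num.min (k x) (F x))%R.
    by move=> Ix; rewrite le_min k0// F0.
  apply: ereal_inf_lbound; exists (fun x => Num.min (k x) (F x)) => //; split; last first.
    by move=> x _; rewrite ge_min lexx orbT.
  split => //; apply: le_trans k1; apply: (rho_le nr); [exact: Mplus_EFin..|].
  by move=> x Ix; rewrite lee_fin ge_min lexx.
apply: integral_mono; [|exact: Mplus_sqd|].
  by apply: Mplus_sqd => //; exact: measurable_minr.
move=> x Ix; rewrite lee_fin; case: (leP (k x) (F x)) => // kF.
by rewrite subrr expr0n/= sqr_ge0.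
Unshelve. all: by end_near.
Qed.

(** Let g be the projection of F and phi = F - g. The first-order condition reads int phi h <= int
    phi g = al on the ball, so phi / al has associate norm at most 1, while its pairing with F is 1
    + (int phi^2) / al > 1. *)
Lemma separation_bounded : 1 < rho (EFin \o F) -> exists g : R -> \bar R,
  [/\ Mplus g, assoc_norm rho g <= 1 & 1 < \int[leb]_(x in I01 R) ((F x)%:E * g x)].
Proof.
move=> F1; have [g [[mg g0 g1] gF gmin]] := projection.
pose phi x := (F x - g x)%R.
have mphi : mfun phi by exact: measurable_funB.
have phi0 x : I01 R x -> (0 <= phi x)%R by move=> Ix; rewrite subr_ge0 gF.
have Mphi := Mplus_EFin mphi phi0.
have phiM x : I01 R x -> (phi x <= M)%R.
  by move=> Ix; have := FM Ix; have := g0 x Ix; rewrite /phi; lra.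
have MF := Mplus_EFin mF F0; have Mg := Mplus_EFin mg g0.
have sqE : sqd F g = \int[leb]_(x in I01 R) ((phi x)%:E * (phi x)%:E).
  by apply: eq_int01 => x _; rewrite -EFinM -expr2.
have int_fin (h k : R -> R) N : mfun h -> mfun k -> (forall x, I01 R x -> (0 <= h x)%R) ->
    (forall x, I01 R x -> (0 <= k x)%R) -> (forall x, I01 R x -> (h x * k x <= N)%R) ->
    \int[leb]_(x in I01 R) ((h x)%:E * (k x)%:E) \is a fin_num.
  move=> mh mk h0 k0 hN; have Mhk := Mplus_mul (Mplus_EFin mh h0) (Mplus_EFin mk k0).
  rewrite ge0_fin_numE ?int_ge0//; apply: (@le_lt_trans _ _ (`|N|%R%:E)); last exact: ltry.
  rewrite -[leRHS]int_cst; apply: integral_mono; [exact: Mhk|by apply: Mplus_cst; rewrite lee_fin|].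
  by move=> x Ix; rewrite -EFinM lee_fin (le_trans (hN x Ix))// ler_norm.
have sq_gt0 : 0 < sqd F g.
  rewrite lt0e; apply/andP; split; last by rewrite sqE int_ge0//; exact: Mplus_mul.
  apply/eqP => sq0; move: F1; apply/negP; rewrite -leNgt; apply: le_trans g1.
  apply: (rho_mono nr) => //.
  have [mq q0] := Mplus_sqd mF mg.
  have : \int[leb]_(x in I01 R) `|((F x - g x) ^+ 2)%:E| = 0.
    rewrite -[RHS]sq0; apply: eq_int01 => x Ix; rewrite gee0_abs//.
    by rewrite lee_fin sqr_ge0.
  move/(ae_eq_integral_abs leb mI01 mq).1; apply: filterS => x /= H Ix.
  by have := H Ix; move=> [] /eqP; rewrite sqrf_eq0 subr_eq0 => /eqP ->.
have sq_fin : sqd F g \is a fin_num.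
  rewrite sqE; apply: (@int_fin _ _ (M * M)%R) => // x Ix.
  by apply: ler_pM; rewrite ?phi0 ?phiM.
have pg_fin : \int[leb]_(x in I01 R) ((phi x)%:E * (g x)%:E) \is a fin_num.
  apply: (@int_fin _ _ (M * M)%R) => // x Ix.
  by apply: ler_pM; rewrite ?phi0 ?phiM ?g0// (le_trans (gF x Ix))// FM.
have [al alE] : exists al, al = \int[leb]_(x in I01 R) ((phi x)%:E * (g x)%:E).
  by eexists.
rewrite -alE in pg_fin.
have al0 : 0 <= al by rewrite alE; apply: int_ge0; exact: Mplus_mul.
have var_bounded (h : R -> R) N : ball h -> (forall x, I01 R x -> (h x <= N)%R) ->
    \int[leb]_(x in I01 R) ((phi x)%:E * (h x)%:E) <= al.
  move=> bh hN; have [mh h0 _] := bh; have Mh := Mplus_EFin mh h0.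
  have Mph := Mplus_mul Mphi Mh; have Mpg := Mplus_mul Mphi Mg.
  pose K := ((M + `|N|) ^+ 2)%R.
  have K0 : (0 <= K)%R by exact: sqr_ge0.
  have hgK : sqd h g <= K%:E.
    rewrite -[leRHS]int_cst; apply: integral_mono; [exact: Mplus_sqd|by apply: Mplus_cst; rewrite lee_fin|].
    move=> x Ix; rewrite lee_fin -ler_sqrt ?sqr_ge0//.
    rewrite !sqrtr_sqr [leRHS]ger0_norm; last by rewrite addr_ge0.
    have := hN x Ix; have := ler_norm N; have := normr_ge0 N; have := h0 x Ix; have := g0 x Ix.
    have := le_trans (gF x Ix) (FM Ix); rewrite ler_norml; lra.
  have [X XE] : exists X, X = \int[leb]_(x in I01 R) ((phi x)%:E * (h x)%:E).
    by eexists.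
  rewrite -XE.
  (* The projection is compared with (1 - t) g + t h. The cross term is moved to the left so that
     nothing is subtracted; dividing by 2 t leaves an error of at most t K. *)
  have key t : (0 < t < 1)%R -> X <= al + (t * K)%:E.
    move=> /andP[t0 t1]; have t0' := ltW t0.
    have tc0 : 0 <= (2 * t)%:E by rewrite lee_fin mulr_ge0.
    have tt0 : 0 <= (t ^+ 2)%:E by rewrite lee_fin sqr_ge0.
    have bt : ball (fun x => (1 - t) * g x + t * h x)%R.
      by apply: ball_convex => //; rewrite t0' ltW.
    have mt : mfun (fun x => (1 - t) * g x + t * h x)%R by case: bt.
    have Mt := Mplus_sqd mF mt; have Mq := Mplus_sqd mF mg; have Mhg := Mplus_sqd mh mg.
    have e : sqd F (fun x => (1 - t) * g x + t * h x)%R + (2 * t)%:E * X =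
        sqd F g + ((2 * t)%:E * al + (t ^+ 2)%:E * sqd h g).
      have S1 := Mplus_scale tc0 Mph; have S2 := Mplus_scale tc0 Mpg.
      have S3 := Mplus_scale tt0 Mhg.
      rewrite /sqd XE alE -(int_scale tc0 Mph) -(int_scale tc0 Mpg) -(int_scale tt0 Mhg).
      rewrite -(int_add Mt S1) -(int_add S2 S3) -(int_add Mq (Mplus_add S2 S3)).
      apply: eq_int01 => x Ix; rewrite /= -?EFinM -?EFinM -?EFinD -?EFinD /phi; congr EFin; ring.
    have le1 : (2 * t)%:E * X <= (2 * t)%:E * al + (t ^+ 2)%:E * sqd h g.
      by rewrite -(leeD2lE _ _ sq_fin) -e leeD2r// gmin.
    rewrite -(@lee_pmul2l _ (2 * t)%:E)// ?lte_fin ?mulr_gt0//.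
    apply: (le_trans le1).
    have -> : (2 * t)%:E * (al + (t * K)%:E) = (2 * t)%:E * al + (2 * t)%:E * (t * K)%:E.
      by apply: ge0_muleDr => //; rewrite lee_fin mulr_ge0.
    rewrite leeD2l//; apply: (@le_trans _ _ ((t ^+ 2)%:E * K%:E)).
      exact: lee_wpmul2l.
    rewrite -!EFinM lee_fin; have := mulr_ge0 (mulr_ge0 t0' t0') K0.
    rewrite expr2; lra.
  apply/lee_addgt0Pr => ep ep0.
  have K1 : (0 < K + 1)%R by rewrite ltr_wpDl.
  pose t := Num.min (2^-1)%R (ep / (K + 1))%R.
  have t0 : (0 < t)%R by rewrite lt_min invr_gt0 ltr0n/= divr_gt0.
  have t1 : (t < 1)%R by rewrite gt_min invf_lt1// ltr1n.
  apply: (le_trans (key t _)); first by rewrite t0.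
  rewrite leeD2l// lee_fin; apply: (@le_trans _ _ (ep / (K + 1) * K)%R).
    by rewrite ler_wpM2r// ge_min lexx orbT.
  by rewrite mulrAC ler_pdivrMr//; have := ltW ep0; lra.
(* Unbounded h are reached through the truncations min(h, n), which stay in the ball. *)
have var (h : R -> \bar R) : Mplus h -> rho h <= 1 ->
    \int[leb]_(x in I01 R) ((phi x)%:E * h x) <= al.
  move=> Mh h1.
  pose hn n x := mine (h x) n%:R%:E.
  have Mhn n : Mplus (hn n) by apply: Mplus_mine => //; apply: Mplus_cst; rewrite lee_fin.
  have hnE n x : I01 R x -> (fine (hn n x))%:E = hn n x.
    move=> Ix; rewrite fineK// ge0_fin_numE ?(Mplus_ge0 (Mhn n) Ix)//.
    by rewrite gt_min ltry orbT.
  have : \int[leb]_(x in I01 R) ((phi x)%:E * hn n x) @[n --> \oo] -->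
      \int[leb]_(x in I01 R) ((phi x)%:E * h x).
    apply: int_cvg => [n|x Ix n m nm|x Ix]; first exact: Mplus_mul.
      by apply: lee_wpmul2l; [rewrite lee_fin phi0|exact: mine_nat_homo].
    by apply: cvgeZl => //; apply: mine_nat_cvg; exact: Mplus_ge0 Ix.
  move/cvge_to_le; apply; apply: nearW => n.
  rewrite (@eq_int01 _ (fun x => (phi x)%:E * (fine (hn n x))%:E)); last first.
    by move=> x Ix; rewrite hnE.
  have mhn : mfun (fun x => fine (hn n x)).
    by apply: measurableT_comp => //; case: (Mhn n).
  have hn0 x : I01 R x -> (0 <= fine (hn n x))%R.
    by move=> Ix; rewrite fine_ge0// (Mplus_ge0 (Mhn n) Ix).
  apply: (@var_bounded _ n%:R) => [|x Ix]; last by rewrite -lee_fin hnE// ge_min lexx orbT.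
  split => //; apply: le_trans h1; apply: (rho_le nr) => //; first exact: Mplus_EFin.
  by move=> x Ix; rewrite /= hnE// ge_min lexx.
(* If al were 0, testing with phi scaled into the ball would force int phi^2 <= 0. Dividing by b + 1
   avoids a zero divisor. *)
have al_gt0 : 0 < al.
  rewrite lt0e al0 andbT; apply/eqP => ale0.
  have rphi : rho (EFin \o phi) < +oo.
    by apply: (@rho_bounded_lty _ M) => // x Ix; rewrite lee_fin phiM.
  have rphi0 := rho_ge0 nr Mphi.
  have rE : (fine (rho (EFin \o phi)))%:E = rho (EFin \o phi) by rewrite fineK// ge0_fin_numE.
  set b := fine _ in rE; have b0 : (0 <= b)%R by rewrite -lee_fin rE.
  have b1 : (0 < b + 1)%R by rewrite ltr_wpDl.
  have ib0 : (0 <= (b + 1)^-1)%R by rewrite invr_ge0 ltW.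
  have := var (fun x => ((b + 1)^-1)%:E * (phi x)%:E).
  rewrite (rho_scale nr)// -[rho _]rE -EFinM lee_fin ler_pdivrMl// mulr1 lerDl ler01.
  have -> : \int[leb]_(x in I01 R) ((phi x)%:E * (((b + 1)^-1)%:E * (phi x)%:E)) =
      ((b + 1)^-1)%:E * sqd F g.
    rewrite sqE -int_scale ?lee_fin//; last exact: Mplus_mul.
    by apply: eq_int01 => x _; rewrite muleCA.
  rewrite ale0 => /(_ (Mplus_scale _ Mphi) isT); rewrite lee_fin => /(_ ib0).
  by apply/negP; rewrite -ltNge mule_gt0// lte_fin invr_gt0.
have aE := fineK pg_fin; set a := fine al in aE.
have a0 : (0 < a)%R by rewrite -lte_fin aE.
have ia0 : 0 <= (a^-1)%:E by rewrite lee_fin invr_ge0 ltW.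
exists (fun x => (a^-1)%:E * (phi x)%:E); split; first exact: Mplus_scale.
  apply: ge_ereal_sup => _ [h [Mh h1] <-].
  rewrite (@eq_int01 _ (fun x => (a^-1)%:E * ((phi x)%:E * h x))); last first.
    by move=> x _; rewrite muleC muleA.
  rewrite int_scale//; last exact: Mplus_mul.
  by rewrite lee_pdivrMl// mule1 aE; exact: var.
rewrite (@eq_int01 _ (fun x => (a^-1)%:E * ((phi x)%:E * (phi x)%:E + (phi x)%:E * (g x)%:E))).
  have Mpp := Mplus_mul Mphi Mphi; have Mpg := Mplus_mul Mphi Mg.
  rewrite int_scale//; last exact: Mplus_add.
  rewrite int_add// -sqE lte_pdivlMl// mule1 aE -alE.
  by rewrite -aE lteDr.
by move=> x _; rewrite /= -?EFinM -?EFinD -?EFinM /phi; congr EFin; ring.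
Qed.

End Bounded.

(* The Lorentz--Luxemburg theorem; the separating functional comes from the L2
   projection of a bounded function onto the unit ball. *)
Lemma rho_le_assoc_assoc (F : R -> \bar R) (A : \bar R) : Mplus F -> 0 <= A ->
  (forall g : R -> \bar R, Mplus g -> assoc_norm rho g <= 1 ->
    \int[leb]_(x in I01 R) (F x * g x) <= A) -> rho F <= A.
Proof.
move=> MF A0 H; rewrite leNgt; apply/negP => AF.
pose Fn n x := mine (F x) n%:R%:E.
have MFn n : Mplus (Fn n) by apply: Mplus_mine => //; apply: Mplus_cst; rewrite lee_fin.
have cF : rho (Fn n) @[n --> \oo] --> rho F.
  apply: (rho_fatou nr) => //; apply: aeW => x Ix; split; first exact: mine_nat_homo.
  by apply: mine_nat_cvg; exact: Mplus_ge0 Ix.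
have [n An] := cvg_gt_ex cF AF.
have rn : rho (Fn n) < +oo.
  by apply: (@rho_bounded_lty _ n%:R) => // x Ix; rewrite ge_min lexx orbT.
have rE : (fine (rho (Fn n)))%:E = rho (Fn n) by rewrite fineK// ge0_fin_numE// (rho_ge0 nr).
have AE : (fine A)%:E = A by rewrite fineK// ge0_fin_numE// (lt_trans An).
set b := fine _ in rE; set a := fine A in AE.
have a0 : (0 <= a)%R by rewrite -lee_fin AE.
have ab : (a < b)%R by rewrite -lte_fin AE rE.
(* The midpoint is positive even when A = 0. Divided by c, the truncation has norm above 1 while its
   pairings stay at most A / c <= 1. *)
pose c := ((a + b) / 2)%R.
have ac : (a < c)%R by rewrite /c; lra.
have cb : (c < b)%R by rewrite /c; lra.
have c0 : (0 < c)%R by exact: le_lt_trans ac.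
have FnE x : I01 R x -> (fine (Fn n x))%:E = Fn n x.
  move=> Ix; rewrite fineK// ge0_fin_numE ?(Mplus_ge0 (MFn n) Ix)//.
  by rewrite gt_min ltry orbT.
have Fn0 x : I01 R x -> (0 <= fine (Fn n x))%R.
  by move=> Ix; rewrite fine_ge0// (Mplus_ge0 (MFn n) Ix).
have ic0 : (0 <= c^-1)%R by rewrite invr_ge0 ltW.
have [] := @separation_bounded (fun x => c^-1 * fine (Fn n x))%R (c^-1 * n%:R)%R.
- apply: measurable_funM; first exact: measurable_cst.
  by apply: measurableT_comp => //; case: (MFn n).
- by move=> x Ix; rewrite mulr_ge0 ?Fn0.
- by move=> x Ix; rewrite ler_wpM2l// -lee_fin FnE// ge_min lexx orbT.
- apply: (@lt_le_trans _ _ (c^-1%:E * rho (Fn n))).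
    by rewrite -rE -EFinM lte_fin ltr_pdivlMl// mulr1.
  rewrite -(rho_scale nr)//; apply: (rho_le nr).
  + apply: Mplus_EFin => [|x Ix]; last by rewrite mulr_ge0 ?Fn0.
    apply: measurable_funM; first exact: measurable_cst.
    by apply: measurableT_comp => //; case: (MFn n).
  + by apply: Mplus_scale; rewrite ?lee_fin.
  + by move=> x Ix; rewrite /= EFinM FnE.
move=> g [Mg g1]; apply/negP; rewrite -leNgt.
rewrite (@eq_int01 _ (fun x => c^-1%:E * (Fn n x * g x))); last first.
  by move=> x Ix; rewrite EFinM FnE// muleA.
rewrite int_scale ?lee_fin//; last exact: Mplus_mul.
rewrite lee_pdivrMl// mule1; apply: (@le_trans _ _ A); last first.
  by rewrite -AE lee_fin ltW.
apply: le_trans (H g Mg g1); apply: integral_mono; [exact: Mplus_mul..|].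
move=> x Ix; apply: lee_wpmul2r; first exact: Mplus_ge0 Ix.
by rewrite ge_min lexx.
Qed.

End LorentzLuxemburg.

(** * Nonnegative kernels on product sets, integrals over subintervals *)

Section ProductTools.
Context {R : realType}.
Implicit Types (A B : set R) (f g : R -> \bar R) (k : R -> R -> \bar R).

Local Notation leb := (lebm R).

Definition nonneg_mfun A f := measurable_fun A f /\ forall x, A x -> 0 <= f x.

Definition nonneg_mfun2 A B k := measurable_fun (A `*` B) (fun z : R * R => k z.1 z.2) /\
  forall x y, A x -> B y -> 0 <= k x y.

Lemma nonneg_mfun2_fst A B f : measurable A -> measurable B ->
  nonneg_mfun A f -> nonneg_mfun2 A B (fun x _ => f x).
Proof.
move=> mA mB [mf f0]; split=> [|x y Ax _]; last exact: f0.
exact: (@measurable_fst_on _ _ _ f).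
Qed.

Lemma nonneg_mfun2_snd A B f : measurable A -> measurable B ->
  nonneg_mfun B f -> nonneg_mfun2 A B (fun _ y => f y).
Proof.
move=> mA mB [mf f0]; split=> [|x y _ By]; last exact: f0.
exact: (@measurable_snd_on _ _ _ f).
Qed.

Lemma nonneg_mfun2_mul A B k k' : nonneg_mfun2 A B k -> nonneg_mfun2 A B k' ->
  nonneg_mfun2 A B (fun x y => k x y * k' x y).
Proof.
move=> [mk k0] [mk' k'0]; split; first exact: emeasurable_funM.
by move=> x y Ax By; rewrite mule_ge0 ?k0 ?k'0.
Qed.

Lemma nonneg_mfun2_mine A B k k' : nonneg_mfun2 A B k -> nonneg_mfun2 A B k' ->
  nonneg_mfun2 A B (fun x y => mine (k x y) (k' x y)).
Proof.
move=> [mk k0] [mk' k'0]; split; first exact: measurable_mine.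
by move=> x y Ax By; rewrite le_min k0 ?k'0.
Qed.

Lemma nonneg_mfun2_chi_lt A B f g : measurable A -> measurable B ->
  measurable_fun A f -> measurable_fun B g ->
  nonneg_mfun2 A B (fun x y => chi (f x < g y)).
Proof.
move=> mA mB mf mg; split=> [|x y _ _]; last exact: chi_ge0.
apply: measurable_chi_lt.
  exact: (@measurable_fst_on _ _ _ f).
exact: (@measurable_snd_on _ _ _ g).
Qed.

Lemma nonneg_mfun2_chi_gt A B f g : measurable A -> measurable B ->
  measurable_fun A f -> measurable_fun B g ->
  nonneg_mfun2 A B (fun x y => chi (g y < f x)).
Proof.
move=> mA mB mf mg; split=> [|x y _ _]; last exact: chi_ge0.
apply: measurable_chi_lt.
  exact: (@measurable_snd_on _ _ _ g).
exact: (@measurable_fst_on _ _ _ f).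
Qed.

Lemma nonneg_mfun2_intl A B k : measurable A -> measurable B -> nonneg_mfun2 A B k ->
  nonneg_mfun A (fun x => \int[leb]_(y in B) k x y).
Proof.
move=> mA mB [mk k0]; split; first exact: tonelli_measurablel.
by move=> x Ax; apply: integral_ge0 => y By; exact: k0.
Qed.

Lemma nonneg_mfun2_intr A B k : measurable A -> measurable B -> nonneg_mfun2 A B k ->
  nonneg_mfun B (fun y => \int[leb]_(x in A) k x y).
Proof.
move=> mA mB [mk k0]; split; first exact: tonelli_measurabler.
by move=> y By; apply: integral_ge0 => x Ax; exact: k0.
Qed.

Lemma nonneg_mfun2_tonelli A B k : measurable A -> measurable B -> nonneg_mfun2 A B k ->
  \int[leb]_(x in A) \int[leb]_(y in B) k x y =
  \int[leb]_(y in B) \int[leb]_(x in A) k x y.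
Proof. by move=> mA mB [mk k0]; exact: tonelli. Qed.

Lemma eq_int D g f : (forall x : R, D x -> f x = g x) ->
  \int[leb]_(x in D) f x = \int[leb]_(x in D) g x.
Proof. by move=> fg; apply: eq_integral => x; rewrite inE; exact: fg. Qed.

Lemma nonneg_mfun_add A f g : nonneg_mfun A f -> nonneg_mfun A g ->
  nonneg_mfun A (fun x => f x + g x).
Proof.
move=> [mf f0] [mg g0]; split; first exact: emeasurable_funD.
by move=> x Ax; rewrite adde_ge0 ?f0 ?g0.
Qed.

Lemma int_add_nonneg A f g : measurable A -> nonneg_mfun A f -> nonneg_mfun A g ->
  \int[leb]_(x in A) (f x + g x) = \int[leb]_(x in A) f x + \int[leb]_(x in A) g x.
Proof. by move=> mA [mf f0] [mg g0]; exact: ge0_integralD. Qed.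

Lemma int_chi_lt (s : R) : (0 <= s <= 1)%R ->
  \int[leb]_(t in I01 R) chi (t%:E < s%:E) = s%:E.
Proof.
move=> /andP[s0 s1].
rewrite (@eq_int01 _ (fun t => chi (t \in (`]0%R, s[%classic : set R)))); last first.
  move=> t /I01P[t0 t1]; congr chi; rewrite lte_fin; apply/idP/idP => [ts|/set_mem].
    by apply/mem_set; rewrite /= in_itv/= t0.
  by rewrite /= in_itv/= => /andP[].
rewrite integral_chi_mem; [|exact: mI01|exact: measurable_itv].
rewrite setIidl; last first.
  by move=> t /=; rewrite in_itv/= => /andP[t0 ts]; apply/I01P; rewrite t0 (lt_le_trans ts).
apply: (etrans (lebesgue_measure_itv _)) => /=; rewrite lte_fin sube0.
by case: ltP => // s0'; congr EFin; apply/le_anti; rewrite s0 s0'.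
Qed.

Lemma int_tail f (t : R) : (0 <= t)%R ->
  \int[leb]_(s in `]t, 1%R[) f s = \int[leb]_(s in I01 R) (chi (t%:E < s%:E) * f s).
Proof.
move=> t0; rewrite (@eq_int01 _ (fun s => f s * chi (s \in (`]t, 1%R[%classic : set R)))); last first.
  move=> s /I01P[s0 s1]; rewrite muleC; congr (_ * chi _); rewrite lte_fin.
  apply/idP/idP => [ts|/set_mem]; last by rewrite /= in_itv/= => /andP[].
  by apply/mem_set; rewrite /= in_itv/= ts.
rewrite integral_mul_chi_mem; [|exact: mI01|exact: measurable_itv].
rewrite setIidr// => s /=; rewrite in_itv/= => /andP[ts s1].
by apply/I01P; rewrite s1 (le_lt_trans t0).
Qed.

Lemma int_init f (t : R) : (t <= 1)%R ->
  \int[leb]_(s in `]0%R, t[) f s = \int[leb]_(s in I01 R) (chi (s%:E < t%:E) * f s).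
Proof.
move=> t1; rewrite (@eq_int01 _ (fun s => f s * chi (s \in (`]0%R, t[%classic : set R)))); last first.
  move=> s /I01P[s0 s1]; rewrite muleC; congr (_ * chi _); rewrite lte_fin.
  apply/idP/idP => [ts|/set_mem]; last by rewrite /= in_itv/= => /andP[].
  by apply/mem_set; rewrite /= in_itv/= s0.
rewrite integral_mul_chi_mem; [|exact: mI01|exact: measurable_itv].
rewrite setIidr// => s /=; rewrite in_itv/= => /andP[s0 st].
by apply/I01P; rewrite s0 (lt_le_trans st).
Qed.

End ProductTools.

(** * The operator G and its boundedness on the associate space *)

Section Weight.
Context {R : realType}.
Variable I : R -> R.
Hypothesis I_01 : forall t, I01 R t -> I01 R (I t).
Hypothesis I_mono : forall s t, I01 R s -> I01 R t -> (s <= t)%R -> (I s <= I t)%R.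
Hypothesis I_quasi : forall s t, I01 R s -> I01 R t -> (s <= t)%R -> (I t / t <= I s / s)%R.
Implicit Types (f g : R -> \bar R).

Local Notation leb := (lebm R).

Lemma I_gt0 t : I01 R t -> (0 < I t)%R.
Proof. by move=> /I_01/I01P[]. Qed.

Lemma I_ge0 t : I01 R t -> (0 <= I t)%R.
Proof. by move=> /I_gt0/ltW. Qed.

Lemma I01_gt0 (t : R) : I01 R t -> (0 < t)%R. Proof. by move=> /I01P[]. Qed.

Lemma I01_ge0 (t : R) : I01 R t -> (0 <= t)%R. Proof. by move=> /I01_gt0/ltW. Qed.

Lemma ratio_le s t : I01 R s -> I01 R t -> (s <= t)%R -> (s / I s <= t / I t)%R.
Proof.
move=> Is It st; rewrite -[X in (X <= _)%R]invf_div -[X in (_ <= X)%R]invf_div.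
by rewrite lef_pV2 ?posrE ?divr_gt0 ?I_gt0 ?I01_gt0// I_quasi.
Qed.

Lemma Mplus_ratio : Mplus (fun t => (t / I t)%:E).
Proof.
split=> [|t It]; last by rewrite lee_fin divr_ge0 ?I_ge0 ?I01_ge0.
apply: monotone_measurable; first exact: is_interval_I01.
by move=> x y Ix Iy xy; rewrite lee_fin ratio_le.
Qed.

Lemma kernel_le s t : I01 R s -> I01 R t -> (s <= t)%R ->
  (I t / t ^+ 2 <= I s / s ^+ 2)%R.
Proof.
move=> Is It st; rewrite !expr2 !invfM !mulrA.
apply: ler_pM; rewrite ?divr_ge0 ?invr_ge0 ?I_ge0 ?I01_ge0//.
  exact: I_quasi.
by rewrite lef_pV2 ?posrE ?I01_gt0.
Qed.

Lemma Mplus_kernel : Mplus (fun t => (I t / t ^+ 2)%:E).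
Proof.
split=> [|t It]; last by rewrite lee_fin divr_ge0 ?sqr_ge0// ltW// I_gt0.
apply: antitone_measurable; first exact: is_interval_I01.
by move=> x y Ix Iy xy; rewrite lee_fin kernel_le.
Qed.

Lemma Mplus_Iinv : Mplus (fun t => ((I t)^-1)%:E).
Proof.
split=> [|t It]; last by rewrite lee_fin invr_ge0 ltW// I_gt0.
apply: antitone_measurable; first exact: is_interval_I01.
by move=> x y Ix Iy xy; rewrite lee_fin lef_pV2 ?posrE ?I_gt0// I_mono.
Qed.

(** The tail integral is taken over the whole interval with a [chi] factor, so that the kernel lives
    on a product set and Tonelli applies directly. *)
Definition Pop g (t : R) : \bar R :=
  \int[leb]_(s in I01 R) (chi (t%:E < s%:E) * ((I s / s ^+ 2)%:E * g s)).

Definition Gop g (t : R) : \bar R := (t / I t)%:E * Pop g t.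

Lemma nonneg_mfun2_lt (A B : set R) : measurable A -> measurable B ->
  nonneg_mfun2 A B (fun t s => chi (t%:E < s%:E)).
Proof.
by move=> mA mB; apply: nonneg_mfun2_chi_lt => //; exact: measurable_EFin_id.
Qed.

Lemma Pop_ge0 g t : Mplus g -> 0 <= Pop g t.
Proof.
move=> Mg; apply: integral_ge0 => s Is; rewrite mule_ge0 ?chi_ge0//.
exact: (Mplus_ge0 (Mplus_mul Mplus_kernel Mg)).
Qed.

Lemma Mplus_Pop g : Mplus g -> Mplus (Pop g).
Proof.
move=> Mg; apply: (nonneg_mfun2_intl mI01 mI01).
apply: nonneg_mfun2_mul; first exact: nonneg_mfun2_lt mI01 mI01.
exact: nonneg_mfun2_snd mI01 mI01 (Mplus_mul Mplus_kernel Mg).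
Qed.

Lemma Pop_anti g s t : Mplus g -> (s <= t)%R -> Pop g t <= Pop g s.
Proof.
move=> Mg st; have MK := Mplus_mul Mplus_kernel Mg.
have M1 u : Mplus (fun s => chi (u%:E < s%:E) * ((I s / s ^+ 2)%:E * g s)).
  apply: Mplus_mul => //; split=> [|x _]; last exact: chi_ge0.
  by apply: measurable_chi_lt; [exact: measurable_cst|exact: measurable_EFin_id].
apply: integral_mono => // x Ix; apply: lee_wpmul2r; first exact: (Mplus_ge0 MK Ix).
by apply: le_chi; rewrite !lte_fin; exact: le_lt_trans.
Qed.

Lemma Mplus_Gop g : Mplus g -> Mplus (Gop g).
Proof. by move=> Mg; apply: Mplus_mul; [exact: Mplus_ratio|exact: Mplus_Pop]. Qed.

Variable d : R.
Hypothesis d_ge1 : (1 <= d)%R.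
Hypothesis I_tail : forall t, I01 R t ->
  \int[leb]_(s in `]t, 1%R[) (I s / s ^+ 2)%:E <= (d * (I t / t))%:E.

(** By Tonelli the left side is int g k with k(s) = I(s)/s^2 int_0^s (t / I(t)) 1_E(t) dt, the
    adjoint of G applied to the indicator of E. Since t / I(t) is nondecreasing, k <= 1; the tail
    bound on I(s)/s^2 gives int k <= d |E|. Hence [int_mul_le_kfun] applies with s = d |E|, and d >=
    1 comes out of [kfun]. *)
Lemma int_mem_Gop_le g (E : set R) : Mplus g -> measurable E -> E `<=` I01 R ->
  \int[leb]_(t in I01 R) (Gop g t * chi (t \in E)) <= d%:E * kfun g (fine (leb E)).
Proof.
move=> Mg mE E1; have MK := Mplus_mul Mplus_kernel Mg.
have ME : Mplus (fun t => (t / I t)%:E * chi (t \in E)).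
  by apply: Mplus_mul; [exact: Mplus_ratio|exact: Mplus_chi_mem].
have lt2 := nonneg_mfun2_lt (@mI01 R) (@mI01 R).
have M2 := nonneg_mfun2_mul (nonneg_mfun2_fst mI01 mI01 ME)
  (nonneg_mfun2_mul lt2 (nonneg_mfun2_snd mI01 mI01 MK)).
have M2' := nonneg_mfun2_mul lt2 (nonneg_mfun2_fst mI01 mI01 ME).
have Min := nonneg_mfun2_intr mI01 mI01 M2'.
pose k s := (I s / s ^+ 2)%:E *
  \int[leb]_(t in I01 R) (chi (t%:E < s%:E) * ((t / I t)%:E * chi (t \in E))).
have Mk : Mplus k by apply: Mplus_mul => //; exact: Mplus_kernel.
have M1 t : Mplus (fun s => chi (t%:E < s%:E) * ((I s / s ^+ 2)%:E * g s)).
  apply: Mplus_mul => //; split=> [|x _]; last exact: chi_ge0.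
  by apply: measurable_chi_lt; [exact: measurable_cst|exact: measurable_EFin_id].
have M3 s : Mplus (fun t => chi (t%:E < s%:E) * ((t / I t)%:E * chi (t \in E))).
  apply: Mplus_mul => //; split=> [|x _]; last exact: chi_ge0.
  by apply: measurable_chi_lt; [exact: measurable_EFin_id|exact: measurable_cst].
rewrite (@eq_int01 _ (fun t => \int[leb]_(s in I01 R) ((t / I t)%:E * chi (t \in E) *
    (chi (t%:E < s%:E) * ((I s / s ^+ 2)%:E * g s))))); last first.
  move=> t It; rewrite int_scale//; last exact: (Mplus_ge0 ME It).
  by rewrite /Gop muleAC.
rewrite (nonneg_mfun2_tonelli mI01 mI01 M2).
rewrite (@eq_int01 _ (fun s => g s * k s)); last first.
  move=> s Is; rewrite /k muleA -int_scale//; last first.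
    by rewrite mule_ge0 ?(Mplus_ge0 Mg Is) ?(Mplus_ge0 Mplus_kernel Is).
  apply: eq_int01 => t It; rewrite (muleC (I s / s ^+ 2)%:E) [LHS]muleA [RHS]muleC.
  by rewrite (muleC (chi (t%:E < s%:E))).
apply: le_trans (kfun_mul_le Mg d_ge1 _); last by rewrite fine_ge0.
have Efin : (fine (leb E))%:E = leb E by rewrite fineK// leb_sub1_fin.
apply: int_mul_le_kfun => //.
- move=> s Is; rewrite /k.
  have c0 : 0 <= (I s / s ^+ 2)%:E by exact: (Mplus_ge0 Mplus_kernel Is).
  apply: (@le_trans _ _ ((I s / s ^+ 2)%:E * ((s / I s)%:E * s%:E))).
    apply: lee_wpmul2l => //.
    rewrite -[X in _ <= _ * X](int_chi_lt (s := s)); last by move/I01P: Is => [/ltW-> /ltW].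
    rewrite -int_scale; [|by rewrite (Mplus_ge0 Mplus_ratio Is)|]; last first.
      split=> [|x _]; last exact: chi_ge0.
      by apply: measurable_chi_lt; [exact: measurable_EFin_id|exact: measurable_cst].
    apply: integral_mono => //.
      apply: Mplus_mul; first by apply: Mplus_cst; rewrite (Mplus_ge0 Mplus_ratio Is).
      split=> [|x _]; last exact: chi_ge0.
      by apply: measurable_chi_lt; [exact: measurable_EFin_id|exact: measurable_cst].
    move=> t It; case: (ltP t%:E) => ts; last by rewrite !chi0 mul0e mule0.
    rewrite mul1e mule1; apply: (@le_trans _ _ ((t / I t)%:E * 1)).
      by apply: lee_wpmul2l; rewrite ?chi_le1// (Mplus_ge0 Mplus_ratio It).
    by rewrite mule1 lee_fin ratio_le// ltW// -lte_fin.
  rewrite -!EFinM lee_fin le_eqVlt; apply/orP; left; apply/eqP.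
  by field; rewrite !gt_eqF ?I_gt0 ?I01_gt0.
have -> : \int[leb]_(s in I01 R) k s = \int[leb]_(t in I01 R)
    \int[leb]_(s in I01 R) (((t / I t)%:E * chi (t \in E)) *
      (chi (t%:E < s%:E) * (I s / s ^+ 2)%:E)).
  rewrite (nonneg_mfun2_tonelli mI01 mI01 (nonneg_mfun2_mul (nonneg_mfun2_fst mI01 mI01 ME)
    (nonneg_mfun2_mul lt2 (nonneg_mfun2_snd mI01 mI01 Mplus_kernel)))).
  apply: eq_int01 => s Is; rewrite /k -int_scale//; last by rewrite (Mplus_ge0 Mplus_kernel Is).
  by apply: eq_int01 => t It; rewrite [LHS]muleC [RHS]muleA; congr (_ * _); exact: muleC.
have M4 (t : R) : Mplus (fun s => chi (t%:E < s%:E) * (I s / s ^+ 2)%:E).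
  apply: Mplus_mul; last exact: Mplus_kernel; split=> [|x _]; last exact: chi_ge0.
  by apply: measurable_chi_lt; [exact: measurable_cst|exact: measurable_EFin_id].
apply: (@le_trans _ _ (\int[leb]_(t in I01 R) (d%:E * chi (t \in E)))); last first.
  rewrite int_scale; [|by rewrite lee_fin (le_trans ler01)|exact: Mplus_chi_mem].
  by rewrite (integral_chi_mem mI01 mE) (setIidl E1) EFinM Efin.
apply: integral_mono => [||t It].
- apply: (nonneg_mfun2_intl mI01 mI01); apply: nonneg_mfun2_mul.
    exact: (nonneg_mfun2_fst mI01 mI01 ME).
  by apply: nonneg_mfun2_mul => //; exact: (nonneg_mfun2_snd mI01 mI01 Mplus_kernel).
- by apply: Mplus_scale; [rewrite lee_fin (le_trans ler01)|exact: Mplus_chi_mem].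
rewrite int_scale//; last exact: (Mplus_ge0 ME It).
rewrite -int_tail; last exact: I01_ge0.
rewrite muleAC; apply: lee_wpmul2r; first exact: chi_ge0.
apply: (@le_trans _ _ ((t / I t)%:E * (d * (I t / t))%:E)).
  by apply: lee_wpmul2l; [rewrite (Mplus_ge0 Mplus_ratio It)|exact: I_tail].
rewrite -EFinM lee_fin le_eqVlt; apply/orP; left; apply/eqP.
by field; rewrite !gt_eqF ?I_gt0 ?I01_gt0.
Qed.

Lemma assoc_ge_int (rho : (R -> \bar R) -> \bar R) f g : Mplus f -> rho f <= 1 ->
  \int[leb]_(x in I01 R) (f x * g x) <= assoc_norm rho g.
Proof. by move=> Mf f1; apply: ereal_sup_ubound; exists f. Qed.

(** The pairing of f with G g is integrated over the superlevel sets of f, where [int_mem_Gop_le]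
    applies. The resulting integral of [kfun g] along D(l) is at most 4 times a pairing of g with
    some h, and h stays in the unit ball because its distribution function is below that of f. *)
Lemma assoc_Gop_le (rho : (R -> \bar R) -> \bar R) g : ri_norm rho -> Mplus g ->
  assoc_norm rho (Gop g) <= (4 * d)%:E * assoc_norm rho g.
Proof.
move=> nr Mg; apply: ge_ereal_sup => _ [f [Mf f1] <-].
have [h [Mh hf hint]] := resonance Mf Mg.
have h1 : rho h <= 1 by apply: le_trans f1; exact: (rho_distf_le nr).
have d0 : (0 <= d)%R by exact: le_trans ler01 d_ge1.
have MG := Mplus_Gop Mg.
apply: (@le_trans _ _ (d%:E * (4%:E * \int[leb]_(x in I01 R) (h x * g x)))); last first.
  rewrite mulrC EFinM muleA; apply: lee_wpmul2l; first by rewrite mule_ge0// lee_fin.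
  exact: assoc_ge_int.
apply: le_trans (lee_wpmul2l _ hint); last by rewrite lee_fin.
have dfin l : (fine (distf f l))%:E = distf f l by rewrite fineK// distf_fin.
have d0' l : (0 <= fine (distf f l))%R by rewrite fine_ge0// distf_ge0.
have mk : measurable_fun (halfline R) (fun l => kfun g (fine (distf f l))).
  apply: antitone_measurable; first exact: is_interval_halfline.
  by move=> x y _ _ xy; apply: kfun_le => //; rewrite -lee_fin !dfin distf_anti.
rewrite -int_mull//; [|exact: mhalfline|by move=> l _; exact: kfun_ge0].
rewrite layer_cake//; apply: le_int.
- exact: mhalfline.
- by move=> l _; apply: int_ge0; apply: Mplus_mul => //; exact: Mplus_chi_gt.
- exact: layer_cake_measurable.
- by apply: emeasurable_funM => //; exact: measurable_cst.
move=> l _; have mE := measurable_superlevel l Mf.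
rewrite (@eq_int01 _ (fun x => Gop g x * chi (x \in I01 R `&` [set x | l%:E < f x]))); last first.
  move=> x Ix; congr (_ * chi _); apply/idP/idP => [?|/set_mem[]//].
  by apply/mem_set.
by apply: int_mem_Gop_le => //; exact: subIsetl.
Qed.

End Weight.

(** * The K-functional of a nonincreasing function *)

Section Antitone.
Context {R : realType}.
Local Notation leb := (lebm R).

(** For each level l, either u > l on all of ]0, s[, or {u > l} lies inside ]0,
    s[. In both cases ]0, s[ meets {u > l} in measure at least min(D(l), s). *)
Lemma kfun_antitone (u : R -> \bar R) (s : R) : Mplus u ->
  (forall x y, I01 R x -> I01 R y -> (x <= y)%R -> u y <= u x) -> (0 <= s <= 1)%R ->
  kfun u s <= \int[leb]_(t in I01 R) (u t * chi (t%:E < s%:E)).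
Proof.
move=> Mu anti s01; have [s0 s1] := andP s01.
have Ms : Mplus (fun t : R => chi (t%:E < s%:E) : \bar R).
  split=> [|x _]; last exact: chi_ge0.
  by apply: measurable_chi_lt; [exact: measurable_EFin_id|exact: measurable_cst].
rewrite layer_cake//; apply: le_int.
- exact: mhalfline.
- by move=> l _; rewrite le_min distf_ge0 lee_fin.
- by apply: measurable_mine_distf => //; exact: mhalfline.
- exact: layer_cake_measurable.
move=> l _.
have [[t [/I01P[t0 t1] st lt]]|H] :=
    pselect (exists t, [/\ I01 R t, (s <= t)%R & l%:E < u t]).
  rewrite (@eq_int01 _ (fun t : R => chi (t%:E < s%:E))); last first.
    move=> x Ix; case: (ltP x%:E) => xs; last by rewrite chi0 mul0e.
    rewrite mul1e (_ : (l%:E < u x) = true)//; apply: (lt_le_trans lt).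
    apply: anti => //; first exact/I01P.
    by apply: le_trans st; apply: ltW; rewrite -lte_fin.
  by rewrite int_chi_lt// ge_min lexx orbT.
rewrite ge_min; apply/orP; left; rewrite distf_int//.
apply: integral_mono; [exact: Mplus_chi_gt|apply: Mplus_mul => //; exact: Mplus_chi_gt|].
move=> x Ix; case: (ltP l%:E) => lx; last by rewrite !chi0 mule0.
rewrite mule1; case: (ltP x%:E) => // sx.
by exfalso; apply: H; exists x; split => //; rewrite -lee_fin.
Qed.

End Antitone.

(** * The competing norm W and the bound for H from X to W *)

Section DualNorm.
Context {R : realType}.
Variable I : R -> R.
Hypothesis I_01 : forall t, I01 R t -> I01 R (I t).
Hypothesis I_mono : forall s t, I01 R s -> I01 R t -> (s <= t)%R -> (I s <= I t)%R.
Hypothesis I_quasi : forall s t, I01 R s -> I01 R t -> (s <= t)%R -> (I t / t <= I s / s)%R.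
Variable rho : (R -> \bar R) -> \bar R.
Hypothesis nr : ri_norm rho.
Implicit Types (f g h w : R -> \bar R) (sg : R -> R).

Local Notation leb := (lebm R).

Definition kap w sg (t : R) : \bar R :=
  \int[leb]_(y in halfline R) (w y * mine t%:E (sg y)%:E).

(* Positive combinations of the functions min(., s): these are the concave
   functions k such that k / I lies in the unit ball of the associate space. *)
Definition admissible w sg := [/\ nonneg_mfun (halfline R) w,
  measurable_fun (halfline R) sg,
  (forall y, halfline R y -> (0 <= sg y <= 1)%R),
  (forall y, halfline R y -> w y \is a fin_num) &
  forall h, Mplus h -> \int[leb]_(t in I01 R) (((I t)^-1)%:E * h t * kap w sg t) <= rho h].

(** Tonelli identifies this with int_l k(D(l)), k = [kap w sg]. In the present form it is linear in
    [kfun f], so properties of [kfun] pass to W. *)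
Definition wfun w sg f : \bar R := \int[leb]_(y in halfline R) (w y * kfun f (sg y)).

Definition Wnorm f : \bar R :=
  ereal_sup [set wfun p.1 p.2 f | p in [set p | admissible p.1 p.2]].

Lemma wfun_le_Wnorm w sg f : admissible w sg -> wfun w sg f <= Wnorm f.
Proof. by move=> a; apply: ereal_sup_ubound; exists (w, sg). Qed.

Lemma nonneg_mfun_kfun sg f : Mplus f -> measurable_fun (halfline R) sg ->
  (forall y, halfline R y -> (0 <= sg y <= 1)%R) ->
  nonneg_mfun (halfline R) (fun y => kfun f (sg y)).
Proof.
move=> Mf msg sg01.
apply: (nonneg_mfun2_intl (k := fun y l => mine (distf f l) (sg y)%:E) mhalfline mhalfline).
apply: nonneg_mfun2_mine.
  apply: (@nonneg_mfun2_snd _ _ _ (distf f)); [exact: mhalfline..|split].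
    by apply: measurable_distf => //; exact: mhalfline.
  by move=> x _; exact: distf_ge0.
apply: (@nonneg_mfun2_fst _ _ _ (fun y => (sg y)%:E)); [exact: mhalfline..|split].
  exact/measurable_EFinP.
by move=> y /sg01/andP[? _]; rewrite lee_fin.
Qed.

Lemma nonneg_mfun_mul (A : set R) f g : nonneg_mfun A f -> nonneg_mfun A g ->
  nonneg_mfun A (fun x => f x * g x).
Proof.
move=> [mf f0] [mg g0]; split; first exact: emeasurable_funM.
by move=> x Ax; rewrite mule_ge0 ?f0 ?g0.
Qed.

Lemma le_int_nonneg (A : set R) f g : measurable A -> nonneg_mfun A f -> nonneg_mfun A g ->
  (forall x, A x -> f x <= g x) -> \int[leb]_(x in A) f x <= \int[leb]_(x in A) g x.
Proof. by move=> mA [mf f0] [mg g0]; exact: le_int. Qed.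

Lemma nonneg_mfun_wfun w sg f : admissible w sg -> Mplus f ->
  nonneg_mfun (halfline R) (fun y => w y * kfun f (sg y)).
Proof. by move=> [mw msg sg01 _ _] Mf; apply: nonneg_mfun_mul => //; exact: nonneg_mfun_kfun. Qed.

Lemma wfun_le w sg f g : admissible w sg -> Mplus f -> Mplus g ->
  (forall l, (0 <= l)%R -> distf f l <= distf g l) -> wfun w sg f <= wfun w sg g.
Proof.
move=> a Mf Mg fg; apply: le_int_nonneg; [exact: mhalfline|exact: nonneg_mfun_wfun..|].
have [[_ w0] _ sg01 wfin _] := a.
move=> y Ly; apply: lee_wpmul2l; first exact: w0.
by apply: kfun_mono => //; case/andP: (sg01 y Ly).
Qed.

Lemma Wnorm_distf_le f g : Mplus f -> Mplus g ->
  (forall l, (0 <= l)%R -> distf f l <= distf g l) -> Wnorm f <= Wnorm g.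
Proof.
move=> Mf Mg fg; apply: ge_ereal_sup => _ [[w sg] a <-].
exact: le_trans (wfun_le a Mf Mg fg) (wfun_le_Wnorm _ a).
Qed.

Let b := (I 2^-1)^-1%R.

Let I_half : I01 R (2^-1)%R.
Proof. by apply/I01P; rewrite invr_gt0 invf_lt1// ltr1n. Qed.

Let b_gt0 : (0 < b)%R.
Proof. by rewrite invr_gt0; exact: I_gt0. Qed.

(** Up to 1/2 the ratio is nondecreasing; beyond 1/2 one has t < 1 and I(t) >= I(1/2). *)
Lemma ratio_le_b t : I01 R t -> (t / I t <= b)%R.
Proof.
move=> It; have [t2|t2] := leP t 2^-1%R.
  apply: (le_trans (ratio_le I_01 I_quasi It I_half t2)).
  by rewrite ler_piMl ?(ltW b_gt0)// invf_le1// ler1n.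
have [t0 t1] := (I01P t).1 It.
apply: (@le_trans _ _ (1 * (I t)^-1)%R).
  by rewrite ler_wpM2r ?invr_ge0 ?(ltW t1)// ltW// (I_gt0 I_01).
by rewrite mul1r lef_pV2 ?posrE ?(I_gt0 I_01)// I_mono// ltW.
Qed.

(** This is the linear function k(t) = c t: k / I is bounded because t / I(t) is, and [rho_local]
    controls int h. It makes W dominate the L1 norm, whence its definiteness and its local
    integrability axiom. *)
Lemma base_admissible : exists c : R, (0 < c)%R /\
  admissible (fun y => c%:E * chi (y%:E < 1%:E)) (cst 1%R).
Proof.
have [C [C0 HC]] := rho_local nr (@mI01 R) (@subset_refl _ _).
have C1 : (0 < C + 1)%R by rewrite ltr_wpDl.
have ib0 : (0 < b^-1)%R by rewrite invr_gt0 b_gt0.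
exists (b^-1 * (C + 1)^-1)%R; split; first by rewrite mulr_gt0// invr_gt0.
set c := (b^-1 * (C + 1)^-1)%R; have c0 : (0 <= c)%R by rewrite mulr_ge0 ?(ltW ib0) ?invr_ge0 ?(ltW C1).
have c0' : 0 <= c%:E by rewrite lee_fin.
have mc : measurable_fun (halfline R) (fun y : R => chi (y%:E < 1%:E) : \bar R).
  by apply: measurable_chi_lt; [exact: measurable_EFin_id|exact: measurable_cst].
split.
- split; first by apply: emeasurable_funM => //; exact: measurable_cst.
  by move=> y _; rewrite mule_ge0 ?chi_ge0.
- exact: measurable_cst.
- by move=> y _; rewrite /= ler01 lexx.
- by move=> y _; rewrite /chi -EFinM.
move=> h Mh.
apply: (@le_trans _ _ ((C + 1)^-1%:E * \int[leb]_(t in I01 R) h t)); last first.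
  rewrite lee_pdivrMl//; apply: (le_trans (HC h Mh)).
  by apply: lee_wpmul2r; [exact: (rho_ge0 nr)|rewrite lee_fin lerDl].
have iC0 : 0 <= (C + 1)^-1%:E :> \bar R by rewrite lee_fin invr_ge0 ltW.
rewrite -int_scale//.
have kE t : I01 R t -> kap (fun y => c%:E * chi (y%:E < 1%:E)) (cst 1%R) t = (c * t)%:E.
  move=> /I01P[t0 t1]; rewrite /kap.
  rewrite (@eq_int _ _ (fun y => c%:E * chi (y%:E < 1%:E) * t%:E)); last first.
    by move=> y _; congr (_ * _); apply/min_idPl; rewrite lee_fin ltW.
  have t0' : 0 <= t%:E by rewrite lee_fin ltW.
  rewrite int_mulr//; [|exact: mhalfline|by apply: emeasurable_funM => //; exact: measurable_cst|
    by move=> y _; rewrite mule_ge0 ?chi_ge0].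
  rewrite int_mull//; [|exact: mhalfline|by move=> y _; exact: chi_ge0].
  by rewrite layer ?lee_fin// mule1.
rewrite (@eq_int01 _ (fun t => (c * (t / I t))%:E * h t)); last first.
  by move=> t It; rewrite kE// muleAC -EFinM; congr (_%:E * _); ring.
have Mc : Mplus (fun t => (c * (t / I t))%:E).
  by apply: (Mplus_scale c0' (Mplus_ratio I_01 I_quasi)).
apply: integral_mono; [exact: Mplus_mul|exact: Mplus_scale|].
move=> t It; apply: lee_wpmul2r; first exact: (Mplus_ge0 Mh).
rewrite lee_fin /c mulrAC ler_piMl ?invr_ge0 ?(ltW C1)//.
by rewrite ler_pdivrMl// mulr1 ratio_le_b.
Qed.

Lemma int_le_Wnorm : exists c : R, (0 < c)%R /\ forall f, Mplus f ->
  c%:E * \int[leb]_(x in I01 R) f x <= Wnorm f.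
Proof.
have [c [c0 a]] := base_admissible; exists c; split=> // f Mf.
apply: le_trans (wfun_le_Wnorm f a); rewrite /wfun /= kfun1//.
have mc : measurable_fun (halfline R) (fun y : R => chi (y%:E < 1%:E) : \bar R).
  by apply: measurable_chi_lt; [exact: measurable_EFin_id|exact: measurable_cst].
have c0' : 0 <= c%:E by rewrite lee_fin ltW.
rewrite int_mulr; [|exact: mhalfline|by apply: emeasurable_funM => //; exact: measurable_cst|
  by move=> y _; rewrite mule_ge0 ?chi_ge0|exact: int_ge0].
rewrite int_mull//; [|exact: mhalfline|by move=> y _; exact: chi_ge0].
by rewrite layer ?lee_fin// mule1.
Qed.

Lemma Wnorm_ge0 f : Mplus f -> 0 <= Wnorm f.
Proof.
move=> Mf; have [c [c0 /(_ f Mf)]] := int_le_Wnorm; apply: le_trans.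
by rewrite mule_ge0 ?int_ge0// lee_fin ltW.
Qed.

Lemma Wnorm_eq0 f : Mplus f -> (Wnorm f = 0 <-> ae_zero f).
Proof.
move=> Mf; have [mf f0] := Mf.
have absE : \int[leb]_(x in I01 R) `|f x| = \int[leb]_(x in I01 R) f x.
  by apply: eq_int01 => x Ix; rewrite gee0_abs// f0.
have eq0 : \int[leb]_(x in I01 R) f x = 0 <-> ae_zero f.
  by rewrite -absE; exact: (ae_eq_integral_abs leb mI01 mf).
split=> [W0|/eq0 if0].
  apply/eq0/eqP; rewrite eq_le int_ge0// andbT.
  have [c [c0 /(_ f Mf)]] := int_le_Wnorm; rewrite W0.
  by rewrite pmule_rle0// lte_fin.
apply/eqP; rewrite eq_le Wnorm_ge0// andbT; apply: ge_ereal_sup => _ [[w sg] a <-].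
have [[_ w0] _ sg01 wfin _] := a.
rewrite /wfun integral0_eq// => y Ly; have /andP[s0 s1] := sg01 y Ly.
rewrite (_ : kfun f _ = 0) ?mule0//; apply/eqP; rewrite eq_le kfun_ge0// andbT.
by rewrite -if0 -kfun1// kfun_le.
Qed.

Lemma wfun_scale w sg (a : R) f : admissible w sg -> (0 <= a)%R -> Mplus f ->
  wfun w sg (fun x => a%:E * f x) = a%:E * wfun w sg f.
Proof.
move=> adm a0 Mf; have [mM M0] := nonneg_mfun_wfun adm Mf; have [_ _ sg01 _ _] := adm.
rewrite /wfun -int_mull//; last exact: mhalfline.
by apply: eq_int => y Ly; rewrite kfun_scale ?sg01// muleCA.
Qed.

Lemma Wnorm_scale (a : R) f : (0 <= a)%R -> Mplus f ->
  Wnorm (fun x => a%:E * f x) = a%:E * Wnorm f.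
Proof.
have le a' f' : (0 <= a')%R -> Mplus f' -> Wnorm (fun x => a'%:E * f' x) <= a'%:E * Wnorm f'.
  move=> a0 Mf; apply: ge_ereal_sup => _ [[w sg] adm <-].
  by rewrite wfun_scale//; apply: lee_wpmul2l; rewrite ?lee_fin//; exact: wfun_le_Wnorm.
move=> a0 Mf; apply/eqP; rewrite eq_le le//=.
have Maf : Mplus (fun x => a%:E * f x) by apply: Mplus_scale; rewrite ?lee_fin.
have [->|an0] := eqVneq a 0%R; first by rewrite mul0e Wnorm_ge0//; apply: Mplus_scale.
have agt0 : (0 < a)%R by rewrite lt0r an0.
rewrite muleC -lee_pdivlMr// muleC.
apply: le_trans (le _ _ _ Maf); last by rewrite invr_ge0.
rewrite (_ : (fun _ => _) = f)//; apply/funext => x.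
by rewrite muleA -EFinM mulVf// mul1e.
Qed.

Lemma Wnorm_add f g : Mplus f -> Mplus g -> Wnorm (f \+ g) <= Wnorm f + Wnorm g.
Proof.
move=> Mf Mg; apply: ge_ereal_sup => _ [[w sg] a <-].
apply: le_trans (leeD (wfun_le_Wnorm f a) (wfun_le_Wnorm g a)).
have [[mw w0] msg sg01 _ _] := a.
have NF := nonneg_mfun_wfun a Mf; have NG := nonneg_mfun_wfun a Mg.
rewrite /wfun -(int_add_nonneg mhalfline NF NG); apply: le_int_nonneg.
- exact: mhalfline.
- exact: (nonneg_mfun_wfun a (Mplus_add Mf Mg)).
- exact: (nonneg_mfun_add NF NG).
move=> y Ly; have /andP[s0 s1] := sg01 y Ly.
rewrite -ge0_muleDr ?kfun_ge0//; apply: lee_wpmul2l; first exact: w0.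
by apply: kfun_add => //; rewrite s0.
Qed.

(** A set that attains [kfun] of the limit is kept fixed; monotone convergence on it bounds the
    supremum from below. *)
Lemma kfun_fatou (fn : nat -> R -> \bar R) f s : (forall n, Mplus (fn n)) -> Mplus f ->
  {ae leb, forall x, I01 R x ->
    {homo fn ^~ x : n m / (n <= m)%N >-> n <= m} /\ fn n x @[n --> \oo] --> f x} ->
  (0 <= s <= 1)%R -> kfun (fn n) s @[n --> \oo] --> kfun f s.
Proof.
move=> Mfn Mf H s01; have [s0 s1] := andP s01.
have nd : {homo (fun n => kfun (fn n) s) : n m / (n <= m)%N >-> n <= m}.
  move=> n m nm; apply: kfun_mono => // l _; apply: distf_ae_le => //.
  by move: H; apply: ae_imp => x H Ix; case: (H Ix) => + _; apply.
have := ereal_nondecreasing_cvgn nd; set S := ereal_sup _.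
suff -> : S = kfun f s by [].
apply/eqP; rewrite eq_le; apply/andP; split.
  apply: ge_ereal_sup => _ [n _ <-]; apply: kfun_mono => // l _; apply: distf_ae_le => //.
  move: H; apply: ae_imp => x H Ix; have [nd' cv] := H Ix.
  apply: (cvge_to_ge cv); near=> m; apply: nd'.
  by near: m; exact: nbhs_infty_ge.
have [E [mE E1 Es /le_trans]] := kfun_attained Mf s01; apply.
have ME := Mplus_chi_mem mE.
have : \int[leb]_(x in I01 R) (fn n x * chi (x \in E)) @[n --> \oo] -->
    \int[leb]_(x in I01 R) (f x * chi (x \in E)).
  apply: int_cvg_ae; [by move=> n; exact: Mplus_mul|exact: Mplus_mul|].
  move: H; apply: ae_imp => x H Ix; have [nd' cv] := H Ix; split.
    by move=> n m nm; apply: lee_wpmul2r; [exact: chi_ge0|exact: nd'].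
  by apply: cvgeZr.
move/cvge_to_le; apply; apply: nearW => n.
apply: (@le_trans _ _ (kfun (fn n) s)); last by apply: ereal_sup_ubound; exists n.
by apply: int_mem_le_kfun => //; rewrite Es.
Unshelve. all: by end_near.
Qed.

Lemma Wnorm_fatou (fn : nat -> R -> \bar R) f : (forall n, Mplus (fn n)) -> Mplus f ->
  {ae leb, forall x, I01 R x ->
    {homo fn ^~ x : n m / (n <= m)%N >-> n <= m} /\ fn n x @[n --> \oo] --> f x} ->
  Wnorm (fn n) @[n --> \oo] --> Wnorm f.
Proof.
move=> Mfn Mf H.
have dle n m l : (n <= m)%N -> distf (fn n) l <= distf (fn m) l.
  move=> nm; apply: distf_ae_le => //.
  by move: H; apply: ae_imp => x H Ix; case: (H Ix) => + _; apply.
have dlef n l : distf (fn n) l <= distf f l.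
  apply: distf_ae_le => //; move: H; apply: ae_imp => x H Ix; have [nd' cv] := H Ix.
  apply: (cvge_to_ge cv); near=> m; apply: nd'.
  by near: m; exact: nbhs_infty_ge.
have nd : {homo (fun n => Wnorm (fn n)) : n m / (n <= m)%N >-> n <= m}.
  by move=> n m nm; apply: Wnorm_distf_le => // l _; exact: dle.
have := ereal_nondecreasing_cvgn nd; set S := ereal_sup _.
suff -> : S = Wnorm f by [].
apply/eqP; rewrite eq_le; apply/andP; split.
  by apply: ge_ereal_sup => _ [n _ <-]; apply: Wnorm_distf_le => // l _; exact: dlef.
apply: ge_ereal_sup => _ [[w sg] a <-]; have [[_ w0] _ sg01 wfin _] := a.
have : wfun w sg (fn n) @[n --> \oo] --> wfun w sg f.
  have -> : wfun w sg f = \int[leb]_(y in halfline R) limn (fun n => w y * kfun (fn n) (sg y)).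
    apply: eq_int => y Ly; apply/esym/cvg_lim => //.
    by apply: cvgeZl; [exact: wfin|exact: (kfun_fatou Mfn Mf H (sg01 y Ly))].
  apply: (@cvg_monotone_convergence _ _ _ leb _ mhalfline (fun n y => w y * kfun (fn n) (sg y))).
  - by move=> n; case: (nonneg_mfun_wfun a (Mfn n)).
  - by move=> n y Ly; case: (nonneg_mfun_wfun a (Mfn n)) => _; apply.
  - move=> y Ly n m nm; apply: lee_wpmul2l; first exact: w0.
    by apply: kfun_mono => // [|l _]; [case/andP: (sg01 y Ly)|exact: dle].
move/cvge_to_le; apply; apply: nearW => n.
apply: (le_trans (wfun_le_Wnorm _ a)).
by apply: ereal_sup_ubound; exists n.
Unshelve. all: by end_near.
Qed.
Lemma kfun_le_id f s : Mplus f -> (forall x, I01 R x -> f x <= 1) -> (0 <= s <= 1)%R ->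
  kfun f s <= s%:E.
Proof.
move=> Mf f1 s01; have [E [mE E1 <- /le_trans]] := kfun_attained Mf s01; apply.
have ME := Mplus_chi_mem mE.
have <- : \int[leb]_(x in I01 R) chi (x \in E) = leb E.
  by rewrite (integral_chi_mem mI01 mE) (setIidl E1).
apply: integral_mono => //; first exact: Mplus_mul.
by move=> x Ix; rewrite -[leRHS]mul1e; apply: lee_wpmul2r; [exact: chi_ge0|exact: f1].
Qed.

(** For f <= 1 the value is at most int w sg. As min(t, s) >= t s on the unit interval, [kap w sg t]
    is at least t times that integral; testing admissibility with h = 1 and keeping only t > 1/2,
    where 1/I >= 1, bounds it by 4 rho(1). *)
Lemma wfun_bounded : exists M : R, forall w sg f, admissible w sg -> Mplus f ->
  (forall x, I01 R x -> f x <= 1) -> wfun w sg f <= M%:E.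
Proof.
pose one : R -> \bar R := cst 1.
have r1 : rho one < +oo by exact: (rho_cst_lty nr ler01).
have M1 : Mplus one by exact: Mplus_cst.
have rE : (fine (rho one))%:E = rho one.
  by rewrite fineK// ge0_fin_numE// (rho_ge0 nr).
exists (4 * fine (rho one))%R => w sg f a Mf f1.
have [[mw w0] msg sg01 wfin Ha] := a.
have ws : nonneg_mfun (halfline R) (fun y => w y * (sg y)%:E).
  apply: nonneg_mfun_mul => //; split; first exact/measurable_EFinP.
  by move=> y /sg01/andP[? _]; rewrite lee_fin.
apply: (@le_trans _ _ (\int[leb]_(y in halfline R) (w y * (sg y)%:E))).
  apply: le_int_nonneg => //; [exact: mhalfline|exact: nonneg_mfun_wfun|].
  by move=> y Ly; apply: lee_wpmul2l; [exact: w0|apply: kfun_le_id => //; exact: sg01].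
have [X XE] : exists X, X = \int[leb]_(y in halfline R) (w y * (sg y)%:E) by eexists.
rewrite -XE.
have X0 : 0 <= X by rewrite XE; apply: integral_ge0 => y; case: ws => _; apply.
rewrite EFinM rE -lee_pdivrMl//.
have kX t : I01 R t -> t%:E * X <= kap w sg t.
  move=> /I01P[t0 t1]; have t0' : 0 <= t%:E by rewrite lee_fin ltW.
  rewrite XE; case: (ws) => mws ws0; rewrite -int_mull//; last exact: mhalfline.
  apply: le_int_nonneg; first exact: mhalfline.
  - split; first by apply: emeasurable_funM => //; exact: measurable_cst.
    by move=> y Ly; rewrite mule_ge0 ?ws0.
  - apply: nonneg_mfun_mul => //; split.
      by apply: measurable_mine; [exact: measurable_cst|exact/measurable_EFinP].
    by move=> y /sg01/andP[? _]; rewrite le_min t0' lee_fin.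
  move=> y Ly; have /andP[s0 s1] := sg01 y Ly; rewrite muleCA; apply: lee_wpmul2l; first exact: w0.
  by rewrite le_min -EFinM !lee_fin ler_piMr ?(ltW t0)// ler_piMl// ltW.
have M2 : Mplus (fun t : R => chi ((2^-1)%:E < t%:E) : \bar R).
  split=> [|x _]; last exact: chi_ge0.
  by apply: measurable_chi_lt; [exact: measurable_cst|exact: measurable_EFin_id].
apply: le_trans (Ha _ M1).
have -> : (4^-1)%:E * X = \int[leb]_(t in I01 R) ((2^-1)%:E * X * chi ((2^-1)%:E < t%:E)).
  rewrite int_scale//; last by rewrite mule_ge0 ?lee_fin ?invr_ge0.
  have -> : \int[leb]_(t in I01 R) chi ((2^-1)%:E < t%:E) = (2^-1)%:E.
    rewrite (@eq_int01 _ (fun t => chi ((2^-1)%:E < t%:E) * 1)); last by move=> t _; rewrite mule1.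
    rewrite -(@int_tail _ (cst 1)) ?invr_ge0// integral_cst; last exact: measurable_itv.
    rewrite mul1e; apply: (etrans (lebesgue_measure_itv _)) => /=.
    rewrite lte_fin invf_lt1 ?ltr1n//= -EFinB; congr EFin; by field.
  by rewrite muleAC -EFinM; congr (_%:E * _); field.
have mkap : nonneg_mfun (I01 R) (kap w sg).
  apply: (nonneg_mfun2_intl (k := fun t y => w y * mine t%:E (sg y)%:E) mI01 mhalfline).
  apply: nonneg_mfun2_mul; first by apply: (@nonneg_mfun2_snd _ _ _ w); [exact: mI01|exact: mhalfline|].
  apply: nonneg_mfun2_mine.
    apply: (@nonneg_mfun2_fst _ _ _ EFin); [exact: mI01|exact: mhalfline|split].
      exact: measurable_EFin_id.
    by move=> x /I01P[? _]; rewrite lee_fin ltW.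
  apply: (@nonneg_mfun2_snd _ _ _ (fun y => (sg y)%:E)); [exact: mI01|exact: mhalfline|split].
    exact/measurable_EFinP.
  by move=> y /sg01/andP[? _]; rewrite lee_fin.
apply: integral_mono.
- by apply: Mplus_scale => //; rewrite mule_ge0 ?lee_fin ?invr_ge0.
- by apply: Mplus_mul => //; apply: Mplus_mul => //; exact: (Mplus_Iinv I_01 I_mono).
move=> t It; rewrite mule1; apply: (@le_trans _ _ (kap w sg t)); last first.
  have [I0 I1] := (I01P _).1 (I_01 It).
  rewrite -[leLHS]mul1e; apply: lee_wpmul2r; first by case: mkap => _; apply.
  by rewrite lee_fin invf_ge1// ltW.
apply: le_trans (kX t It).
case: (ltP (2^-1)%:E) => t2; last by rewrite chi0 mule0 mule_ge0// lee_fin ltW// (I01_gt0 It).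
by rewrite mule1; apply: lee_wpmul2r => //; exact: ltW.
Qed.

Lemma Mplus_indic (E : set R) : measurable E -> Mplus (fun x => (\1_E x)%:E : \bar R).
Proof. by move=> mE; exact: (Mplus_chi_mem mE). Qed.

Lemma Wnorm_ri : ri_norm Wnorm.
Proof.
split.
- exact: Wnorm_ge0.
- exact: Wnorm_eq0.
- by move=> a f a0 Mf; exact: Wnorm_scale.
- by move=> f g Mf Mg; exact: Wnorm_add.
- move=> f g Mf Mg gf; apply: Wnorm_distf_le => // l _; exact: distf_ae_le.
- by move=> fn f Mfn Mf H; exact: Wnorm_fatou.
- move=> E mE E1; have [M HM] := wfun_bounded.
  apply: (@le_lt_trans _ _ M%:E); last exact: ltry.
  apply: ge_ereal_sup => _ [[w sg] a <-]; apply: HM => //; first exact: Mplus_indic.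
  by move=> x _; rewrite lee_fin indicE; case: (_ \in _).
- move=> E mE E1; have [c [c0 Hc]] := int_le_Wnorm.
  exists c^-1%R; split; first by rewrite invr_ge0 ltW.
  move=> f Mf; rewrite -lee_pdivrMl ?invr_gt0// invrK.
  apply: le_trans (Hc f Mf); apply: lee_wpmul2l; first by rewrite lee_fin ltW.
  have [mf f0] := Mf; apply: ge0_subset_integral => //; exact: mI01.
- move=> f g Mf Mg fg; apply/eqP; rewrite eq_le.
  by apply/andP; split; apply: Wnorm_distf_le => // l l0; rewrite fg.
Qed.

Lemma Mplus_ext f g : (forall x, I01 R x -> f x = g x) -> Mplus f -> Mplus g.
Proof.
move=> fg [mf f0]; split=> [|x Ix]; last by rewrite -fg// f0.
by apply: eq_measurable_fun mf => x; rewrite inE; exact: fg.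
Qed.

Lemma H_op_int h t : I01 R t -> H_op I h t =
  \int[leb]_(s in I01 R) (chi (t%:E < s%:E) * (((I s)^-1)%:E * h s)).
Proof. by move=> It; rewrite /H_op int_tail// ltW// (I01_gt0 It). Qed.

Let Mplus_Ih h : Mplus h -> Mplus (fun s => ((I s)^-1)%:E * h s).
Proof. by move=> Mh; apply: Mplus_mul => //; exact: (Mplus_Iinv I_01 I_mono). Qed.

Lemma Mplus_H_op h : Mplus h -> Mplus (H_op I h).
Proof.
move=> Mh; apply: (@Mplus_ext (fun t => \int[leb]_(s in I01 R)
    (chi (t%:E < s%:E) * (((I s)^-1)%:E * h s)))) => [t It|].
  by rewrite H_op_int.
apply: (nonneg_mfun2_intl mI01 mI01); apply: nonneg_mfun2_mul.
  exact: nonneg_mfun2_lt mI01 mI01.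
exact: nonneg_mfun2_snd mI01 mI01 (Mplus_Ih Mh).
Qed.

Lemma H_op_anti h s t : Mplus h -> I01 R s -> I01 R t -> (s <= t)%R ->
  H_op I h t <= H_op I h s.
Proof.
move=> Mh Is It st; rewrite !H_op_int//; have MK := Mplus_Ih Mh.
have M1 u : Mplus (fun s => chi (u%:E < s%:E) * (((I s)^-1)%:E * h s)).
  apply: Mplus_mul => //; split=> [|x _]; last exact: chi_ge0.
  by apply: measurable_chi_lt; [exact: measurable_cst|exact: measurable_EFin_id].
apply: integral_mono => // x Ix; apply: lee_wpmul2r; first exact: (Mplus_ge0 MK Ix).
by apply: le_chi; rewrite !lte_fin; exact: le_lt_trans.
Qed.

(** H h is nonincreasing, so its [kfun] is controlled by its integral over ]0, s[. After exchanging
    integrals, h(r)/I(r) is weighted by the length min(r, s) of the admissible t. *)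
Lemma kfun_H_op_le h s : Mplus h -> (0 <= s <= 1)%R -> kfun (H_op I h) s <=
  \int[leb]_(r in I01 R) (((I r)^-1)%:E * h r * mine r%:E s%:E).
Proof.
move=> Mh s01; have [s0 s1] := andP s01; have MK := Mplus_Ih Mh.
apply: (le_trans (kfun_antitone (Mplus_H_op Mh) _ s01)).
  by move=> x y Ix Iy xy; exact: H_op_anti.
have Ms : Mplus (fun t : R => chi (t%:E < s%:E) : \bar R).
  split=> [|x _]; last exact: chi_ge0.
  by apply: measurable_chi_lt; [exact: measurable_EFin_id|exact: measurable_cst].
have M2 : nonneg_mfun2 (I01 R) (I01 R) (fun t r => chi (t%:E < s%:E) *
    (chi (t%:E < r%:E) * (((I r)^-1)%:E * h r))).
  apply: nonneg_mfun2_mul; first exact: (nonneg_mfun2_fst mI01 mI01 Ms).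
  apply: nonneg_mfun2_mul; first exact: nonneg_mfun2_lt mI01 mI01.
  exact: nonneg_mfun2_snd mI01 mI01 MK.
have M1 t : Mplus (fun r => chi (t%:E < r%:E) * (((I r)^-1)%:E * h r)).
  apply: Mplus_mul => //; split=> [|x _]; last exact: chi_ge0.
  by apply: measurable_chi_lt; [exact: measurable_cst|exact: measurable_EFin_id].
rewrite (@eq_int01 _ (fun t => \int[leb]_(r in I01 R) (chi (t%:E < s%:E) *
    (chi (t%:E < r%:E) * (((I r)^-1)%:E * h r))))); last first.
  by move=> t It; rewrite H_op_int// muleC int_scale// chi_ge0.
rewrite (nonneg_mfun2_tonelli mI01 mI01 M2).
rewrite le_eqVlt; apply/orP; left; apply/eqP; apply: eq_int01 => r Ir.
have [r0 r1] := (I01P r).1 Ir.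
have mrE : mine r%:E s%:E = (Num.min r s)%:E by rewrite EFin_min.
rewrite mrE -(int_chi_lt (s := Num.min r s)); last first.
  by rewrite le_min (ltW r0) s0 ge_min (ltW r1).
rewrite -int_scale; [|exact: (Mplus_ge0 MK Ir)|]; last first.
  split=> [|x _]; last exact: chi_ge0.
  by apply: measurable_chi_lt; [exact: measurable_EFin_id|exact: measurable_cst].
apply: eq_int01 => t It; rewrite !lte_fin lt_min.
case: (t < s)%R; last by rewrite andbF !chi0 mul0e mule0.
by rewrite andbT mul1e muleC.
Qed.

(** Summing [kfun_H_op_le] with the weights w reproduces exactly the integral bounded in
    [admissible], so H maps X into W with constant 1. *)
Lemma Wnorm_H_op h : Mplus h -> Wnorm (H_op I h) <= rho h.
Proof.
move=> Mh; apply: ge_ereal_sup => _ [[w sg] a <-] /=.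
have [[mw w0] msg sg01 wfin Ha] := a; apply: le_trans (Ha h Mh).
have MK := Mplus_Ih Mh.
have M1 : nonneg_mfun2 (halfline R) (I01 R) (fun y r => w y * mine r%:E (sg y)%:E).
  apply: nonneg_mfun2_mul; first by apply: (@nonneg_mfun2_fst _ _ _ w); [exact: mhalfline|exact: mI01|].
  apply: nonneg_mfun2_mine.
    apply: (@nonneg_mfun2_snd _ _ _ EFin); [exact: mhalfline|exact: mI01|split].
      exact: measurable_EFin_id.
    by move=> x /I01P[? _]; rewrite lee_fin ltW.
  apply: (@nonneg_mfun2_fst _ _ _ (fun y => (sg y)%:E)); [exact: mhalfline|exact: mI01|split].
    exact/measurable_EFinP.
  by move=> y /sg01/andP[? _]; rewrite lee_fin.
have M2 : nonneg_mfun2 (halfline R) (I01 R)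
    (fun y r => ((I r)^-1)%:E * h r * (w y * mine r%:E (sg y)%:E)).
  apply: nonneg_mfun2_mul => //.
  exact: (nonneg_mfun2_snd mhalfline mI01 MK).
rewrite [leRHS](@eq_int01 _ (fun r => \int[leb]_(y in halfline R)
    (((I r)^-1)%:E * h r * (w y * mine r%:E (sg y)%:E)))); last first.
  move=> r Ir; rewrite int_mull//; [exact: mhalfline| | |exact: (Mplus_ge0 MK Ir)].
    apply: emeasurable_funM => //; apply: measurable_mine; first exact: measurable_cst.
    exact/measurable_EFinP.
  move=> y Ly; rewrite mule_ge0 ?w0// le_min !lee_fin ltW ?(I01_gt0 Ir)//=.
  by case/andP: (sg01 y Ly).
rewrite -(nonneg_mfun2_tonelli mhalfline mI01 M2).
apply: le_int_nonneg; first exact: mhalfline.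
- by apply: nonneg_mfun_wfun => //; exact: Mplus_H_op.
- exact: (nonneg_mfun2_intl mhalfline mI01 M2).
move=> y Ly; have s01 := sg01 y Ly.
apply: (le_trans (lee_wpmul2l (w0 y Ly) (kfun_H_op_le Mh s01))).
have Mm : Mplus (fun r => mine r%:E (sg y)%:E).
  case/andP: s01 => s0 _; apply: (@Mplus_mine _ EFin (cst (sg y)%:E)).
    split; first exact: measurable_EFin_id.
    by move=> x /I01P[? _]; rewrite lee_fin ltW.
  by apply: Mplus_cst; rewrite lee_fin.
rewrite -int_scale ?w0//; last exact: (Mplus_mul MK Mm).
rewrite le_eqVlt; apply/orP; left; apply/eqP; apply: eq_int01 => r Ir.
by rewrite muleCA.
Qed.

End DualNorm.

(** * The integral of the inverse square *)

Section InverseSquare.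
Context {R : realType}.
Local Notation leb := (lebm R).

Lemma is_derive_opp_inv (x : R) : (0 < x)%R ->
  is_derive x 1%R (fun s : R => - s^-1)%R ((x ^+ 2)^-1)%R.
Proof.
move=> x0; have xn0 : (x != 0)%R by rewrite gt_eqF.
have h1 : is_derive x 1%R (fun s : R => s^-1)%R (- x ^- 2 *: (1 : R))%R.
  by apply: (@is_deriveV R id x 1%R 1%R xn0); exact: is_derive_id.
have h2 := is_deriveN h1.
by move: h2; rewrite /GRing.scale/= mulr1 opprK; apply.
Qed.

Lemma int_inv_sq (a : R) : (0 < a < 1)%R ->
  \int[leb]_(s in I01 R) (chi (a%:E < s%:E) * ((s ^+ 2)^-1)%:E) = (a^-1 - 1)%:E.
Proof.
move=> /andP[a0 a1]; rewrite -int_tail ?ltW//.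
have cont (x : R) : (0 < x)%R -> {for x, continuous (fun s : R => (s ^+ 2)^-1)%R}.
  move=> x0; apply: cvgV; first by rewrite gt_eqF// exprn_gt0.
  exact: exprn_continuous.
have contF (x : R) : (0 < x)%R -> {for x, continuous (fun s : R => - s^-1)%R}.
  by move=> x0; apply: cvgN; apply: cvgV; [rewrite gt_eqF|exact: cvg_id].
transitivity (\int[leb]_(s in `[a, 1%R]) ((s ^+ 2)^-1)%:E).
  symmetry; apply: integral_itv_bndoo; apply/measurable_EFinP.
  apply: subspace_continuous_measurable_fun; first exact: measurable_itv.
  by apply: continuous_in_subspaceT => x /[!inE] /=; rewrite in_itv/= => /andP[/(lt_trans a0) x0 _]; exact: cont.
rewrite (@continuous_FTC2 R (fun s => (s ^+ 2)^-1)%R (fun s => - s^-1)%R a 1%R a1).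
- by rewrite -EFinB invr1 opprK addrC.
- by apply: continuous_in_subspaceT => x /[!inE] /=; rewrite in_itv/= => /andP[/(lt_le_trans a0) x0 _]; exact: cont.
- split.
  + move=> x; rewrite in_itv/= => /andP[/(lt_trans a0) x0 _].
    by have [] := is_derive_opp_inv x0.
  + by apply: cvg_at_right_filter; exact: contF.
  + by apply: cvg_at_left_filter; exact: contF.
move=> x; rewrite in_itv/= => /andP[/(lt_trans a0) x0 _].
rewrite derive1E; have h := is_derive_opp_inv x0.
exact: (@derive_val _ _ _ _ _ _ _ h).
Qed.

Lemma Mplus_inv_sq : Mplus (fun s : R => ((s ^+ 2)^-1)%:E).
Proof.
split=> [|s _]; last by rewrite lee_fin invr_ge0 sqr_ge0.
apply: antitone_measurable; first exact: is_interval_I01.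
move=> x y /I01P[x0 _] /I01P[y0 _] xy.
by rewrite lee_fin lef_pV2 ?posrE ?exprn_gt0// ler_pXn2r ?nnegrE ?(ltW x0) ?(ltW y0).
Qed.

End InverseSquare.

(** * The oscillation through the distribution function *)

Section Oscillation.
Context {R : realType}.
Variable I : R -> R.
Hypothesis I_01 : forall t, I01 R t -> I01 R (I t).
Hypothesis I_mono : forall s t, I01 R s -> I01 R t -> (s <= t)%R -> (I s <= I t)%R.
Hypothesis I_quasi : forall s t, I01 R s -> I01 R t -> (s <= t)%R -> (I t / t <= I s / s)%R.
Variable f : R -> R.
Hypothesis Mf : Mplus (EFin \o f).

Local Notation leb := (lebm R).
Local Notation D := (distf (EFin \o f)).

(** f is real-valued on a set of finite measure, so D(n) tends to 0. Finiteness is what keeps the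
    difference in [osc] from being oo - oo. *)
Lemma fstar_fin t : (0 < t)%R -> fstar (EFin \o f) t \is a fin_num.
Proof.
move=> t0; rewrite ge0_fin_numE ?fstar_ge0//.
suff [n nt] : exists n : nat, D n%:R <= t%:E.
  apply: (@le_lt_trans _ _ (n%:R)%:E); last exact: ltry.
  by apply: ereal_inf_lbound; exists n%:R.
pose G n := I01 R `&` [set x | n%:R%:E < (EFin \o f) x].
have mG n : measurable (G n) by exact: measurable_superlevel.
have G0 : \bigcap_n G n = set0.
  apply/seteqP; split => // x Gx.
  have := Gx (Num.bound `|f x|%R) Logic.I; move=> [_ /=]; rewrite lte_fin => h.
  have := le_lt_trans (ler_norm (f x)) (archi_boundP (normr_ge0 (f x))).
  by move=> /(lt_trans h); rewrite ltxx.
have cG : (leb \o G) n @[n --> \oo] --> 0.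
  rewrite -(measure0 leb) -G0; apply: nonincreasing_cvg_mu => //.
  - by rewrite (le_lt_trans (distf_le1 _ Mf))// ltry.
  - by rewrite G0.
  - move=> n m nm; apply/subsetPset => x [Ix /= lf]; split => //=.
    by apply: le_lt_trans lf; rewrite lee_fin ler_nat.
apply: contrapT => /forallNP H.
have : t%:E <= 0.
  by apply: (cvge_to_ge cG); apply: nearW => n; apply/ltW; rewrite ltNge; apply/negP; exact: H.
by rewrite lee_fin leNgt t0.
Qed.

(** The condition D(l) <= t means that l is at least the rearrangement at t, so this is t times the
    difference of [fstarstar] and [fstar]. *)
Definition low_level (t : R) : \bar R :=
  \int[leb]_(l in halfline R) (D l * chi (D l <= t%:E)).

Lemma nonneg_mfun_distf : nonneg_mfun (halfline R) D.
Proof.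
split; first by apply: measurable_distf => //; exact: mhalfline.
by move=> l _; exact: distf_ge0.
Qed.

Lemma nonneg_mfun2_chi_le (A B : set R) (g h : R -> \bar R) : measurable A -> measurable B ->
  measurable_fun A g -> measurable_fun B h ->
  nonneg_mfun2 A B (fun x y => chi (h y <= g x)).
Proof.
move=> mA mB mg mh; split=> [|x y _ _]; last exact: chi_ge0.
apply: measurable_chi_le.
  exact: (@measurable_snd_on _ _ _ h).
exact: (@measurable_fst_on _ _ _ g).
Qed.

Lemma nonneg_mfun2_low_level : nonneg_mfun2 (I01 R) (halfline R)
  (fun t l => D l * chi (D l <= t%:E)).
Proof.
have [mD _] := nonneg_mfun_distf.
apply: nonneg_mfun2_mul.
  exact: (@nonneg_mfun2_snd _ _ _ D mI01 mhalfline nonneg_mfun_distf).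
exact: (@nonneg_mfun2_chi_le _ _ EFin D mI01 mhalfline (@measurable_EFin_id _ _)).
Qed.

Lemma Mplus_low_level : Mplus low_level.
Proof. exact: (nonneg_mfun2_intl mI01 mhalfline nonneg_mfun2_low_level). Qed.

Lemma fstar_layer t : (0 <= t)%R ->
  fstar (EFin \o f) t = \int[leb]_(l in halfline R) chi (t%:E < D l).
Proof.
move=> t0; rewrite -[LHS]layer ?fstar_ge0//; apply: eq_int => l /halflineP l0.
by rewrite fstar_gt// ltW.
Qed.

Lemma int_fstar t : (0 <= t <= 1)%R ->
  \int[leb]_(s in `]0%R, t[) fstar (EFin \o f) s = kfun (EFin \o f) t.
Proof.
move=> /andP[t0 t1].
have Mt : Mplus (fun s : R => chi (s%:E < t%:E) : \bar R).
  split=> [|x _]; last exact: chi_ge0.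
  by apply: measurable_chi_lt; [exact: measurable_EFin_id|exact: measurable_cst].
rewrite int_init//.
rewrite (@eq_int01 _ (fun s => fstar (EFin \o f) s * chi (s%:E < t%:E))) => [|s _]; last by rewrite muleC.
rewrite (layer_cake (Mplus_fstar _) Mt); apply: eq_int => l /halflineP l0.
have /fineK dE := distf_fin l Mf; set d := fine (D l) in dE.
rewrite -dE -EFin_min -(int_chi_lt (s := Num.min d t)); last first.
  by rewrite le_min ge_min t1 orbT -lee_fin dE distf_ge0 t0.
apply: eq_int01 => s Is; rewrite fstar_gt ?ltW// -dE !lte_fin lt_min.
by case: (s < t)%R; rewrite ?andbT ?andbF ?chi0 ?mul0e// mul1e.
Qed.

(** Split min(D(l), t) according to whether D(l) exceeds t. *)
Lemma kfun_low_level t : I01 R t ->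
  kfun (EFin \o f) t = t%:E * fstar (EFin \o f) t + low_level t.
Proof.
move=> /I01P[t0 t1]; have [mD D0] := nonneg_mfun_distf.
have mc : measurable_fun (halfline R) (fun l => chi (t%:E < D l) : \bar R).
  by apply: measurable_chi_lt => //; exact: measurable_cst.
have mc' : measurable_fun (halfline R) (fun l => D l * chi (D l <= t%:E) : \bar R).
  by apply: emeasurable_funM => //; apply: measurable_chi_le => //; exact: measurable_cst.
have t0' : 0 <= t%:E by rewrite lee_fin ltW.
rewrite fstar_layer ?ltW// -int_mull//; [|exact: mhalfline|by move=> l _; exact: chi_ge0].
rewrite /low_level -ge0_integralD//; first last.
- by move=> l _; rewrite mule_ge0 ?chi_ge0 ?distf_ge0.
- by apply: emeasurable_funM => //; exact: measurable_cst.
- by move=> l _; rewrite mule_ge0 ?chi_ge0.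
- exact: mhalfline.
apply: eq_int => l _; case: (leP (D l) t%:E) => Dt.
  by rewrite chi0 mule0 add0e mule1.
by rewrite chi0 mule0 adde0 mule1.
Qed.

Lemma osc_low_level t : I01 R t ->
  osc I (EFin \o f) t = (I t / t ^+ 2)%:E * low_level t.
Proof.
move=> It; have [t0 t1] := (I01P t).1 It.
have ffin := fstar_fin t0; rewrite /osc.
have -> : fstarstar (EFin \o f) t - fstar (EFin \o f) t = (t^-1)%:E * low_level t.
  rewrite /fstarstar int_fstar ?(ltW t0) ?(ltW t1)// kfun_low_level//.
  have -> : (t^-1)%:E * (t%:E * fstar (EFin \o f) t + low_level t) =
      fstar (EFin \o f) t + (t^-1)%:E * low_level t.
    rewrite ge0_muleDr; [|by rewrite mule_ge0 ?fstar_ge0// lee_fin ltW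
      |exact: (Mplus_ge0 Mplus_low_level)].
    by rewrite muleA -EFinM mulVf ?gt_eqF// mul1e.
  by rewrite addeC addeA (addeC (- _)) subee// add0e.
by rewrite muleA -EFinM expr2 invfM mulrA.
Qed.

Lemma Mplus_osc : Mplus (osc I (EFin \o f)).
Proof.
apply: (@Mplus_ext _ (fun t => (I t / t ^+ 2)%:E * low_level t)) => [t It|].
  by rewrite osc_low_level.
apply: Mplus_mul; [exact: Mplus_kernel I_01 I_quasi|exact: Mplus_low_level].
Qed.

(** It suffices that each level with t < D(l) contributes at least 1: the part s > D(l) of the
    integral gives D(l) (1/D(l) - 1), and the L1 norm supplies the missing D(l). *)
Lemma fstar_le_H_osc t : I01 R t -> fstar (EFin \o f) t <=
  H_op I (osc I (EFin \o f)) t + \int[leb]_(x in I01 R) (EFin \o f) x.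
Proof.
move=> It; have [t0 t1] := (I01P t).1 It; have [mD D0] := nonneg_mfun_distf.
have Mt : Mplus (fun s : R => chi (t%:E < s%:E) : \bar R).
  split=> [|x _]; last exact: chi_ge0.
  by apply: measurable_chi_lt; [exact: measurable_cst|exact: measurable_EFin_id].
have Mts := Mplus_mul Mt (@Mplus_inv_sq R).
have M2 := nonneg_mfun2_mul (nonneg_mfun2_fst mI01 mhalfline Mts) nonneg_mfun2_low_level.
have -> : H_op I (osc I (EFin \o f)) t = \int[leb]_(s in I01 R) \int[leb]_(l in halfline R)
    (chi (t%:E < s%:E) * ((s ^+ 2)^-1)%:E * (D l * chi (D l <= s%:E))).
  rewrite (H_op_int _ _ It); apply: eq_int01 => s Is.
  rewrite osc_low_level// int_mull; first last.
  - exact: (Mplus_ge0 Mts).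
  - by move=> l _; rewrite mule_ge0 ?chi_ge0 ?distf_ge0.
  - by apply: emeasurable_funM => //; apply: measurable_chi_le => //; exact: measurable_cst.
  - exact: mhalfline.
  rewrite -!muleA; congr (_ * _); rewrite muleA -EFinM; congr (_%:E * _).
  by rewrite mulrA mulVf ?mul1r// gt_eqF// (I_gt0 I_01).
rewrite (nonneg_mfun2_tonelli mI01 mhalfline M2) integral_distf//.
have MI := nonneg_mfun2_intr mI01 mhalfline M2; have [mI I0] := MI.
rewrite -(int_add_nonneg mhalfline MI nonneg_mfun_distf).
rewrite fstar_layer ?(ltW t0)//; apply: le_int.
- exact: mhalfline.
- by move=> l _; exact: chi_ge0.
- by apply: measurable_chi_lt => //; exact: measurable_cst.
- exact: emeasurable_funD.
move=> l Ll; case: (ltP t%:E) => tD; last by rewrite chi0 adde_ge0 ?D0 ?I0.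
have /fineK dE := distf_fin l Mf; set d := fine (D l) in dE.
have td : (t < d)%R by rewrite -lte_fin dE.
have d0 : (0 < d)%R := lt_trans t0 td.
(* When D(l) = 1 the range s > D(l) is empty and the L1 term alone suffices. *)
rewrite chi1; have [d1|d1] := ltP d 1%R; last first.
  by rewrite -[leLHS]add0e; apply: leeD; [exact: I0|rewrite -dE lee_fin].
apply: (@le_trans _ _ (d%:E * \int[leb]_(s in I01 R) (chi (d%:E < s%:E) * ((s ^+ 2)^-1)%:E) + d%:E)).
  rewrite int_inv_sq ?d0// -EFinM -EFinD lee_fin mulrBr mulr1 mulfV ?gt_eqF//.
  by rewrite subrK.
rewrite -dE leeD2r//.
have Md : Mplus (fun s : R => chi (d%:E < s%:E) : \bar R).
  split=> [|x _]; last exact: chi_ge0.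
  by apply: measurable_chi_lt; [exact: measurable_cst|exact: measurable_EFin_id].
have Mds := Mplus_mul Md (@Mplus_inv_sq R).
rewrite -int_scale ?lee_fin ?(ltW d0)//; apply: integral_mono.
- by apply: Mplus_scale; rewrite ?lee_fin ?(ltW d0).
- apply: Mplus_mul => //; apply: Mplus_scale; rewrite ?lee_fin ?(ltW d0)//.
  split=> [|x _]; last exact: chi_ge0.
  by apply: measurable_chi_le; [exact: measurable_cst|exact: measurable_EFin_id].
move=> s Is; rewrite !lee_fin !lte_fin.
have s2 : (0 <= (s ^+ 2)^-1)%R by rewrite invr_ge0 sqr_ge0.
have [ds|sd] := ltP d s; last first.
  by rewrite mul0r mulr0 mulr_ge0 ?mulr_ge0 ?ler0n// ltW.
by rewrite (lt_trans td ds) (ltW ds) !mul1r mulr1 mulrC.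
Qed.

End Oscillation.

(** * Elementary properties of the associate norm *)

Section AssociateNorm.
Context {R : realType}.
Variable rho : (R -> \bar R) -> \bar R.
Hypothesis nr : ri_norm rho.
Implicit Types (f g h v : R -> \bar R).
Local Notation leb := (lebm R).

Lemma assoc_le g v : Mplus g -> Mplus v -> (forall x, I01 R x -> g x <= v x) ->
  assoc_norm rho g <= assoc_norm rho v.
Proof.
move=> Mg Mv gv; apply: ge_ereal_sup => _ [f [Mf f1] <-].
apply: le_trans (assoc_ge_int v Mf f1).
apply: integral_mono; [exact: Mplus_mul..|move=> x Ix].
by apply: lee_wpmul2l; [exact: (Mplus_ge0 Mf)|exact: gv].
Qed.

Lemma assoc_scale_le (c : R) g : (0 <= c)%R -> Mplus g ->
  assoc_norm rho (fun x => c%:E * g x) <= c%:E * assoc_norm rho g.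
Proof.
move=> c0 Mg; apply: ge_ereal_sup => _ [f [Mf f1] <-].
rewrite (@eq_int01 _ (fun x => c%:E * (f x * g x))) => [|x _]; last by rewrite muleCA.
rewrite int_scale ?lee_fin//; last exact: Mplus_mul.
by apply: lee_wpmul2l; [rewrite lee_fin|exact: assoc_ge_int].
Qed.

Lemma assoc_add_le g v : Mplus g -> Mplus v ->
  assoc_norm rho (fun x => g x + v x) <= assoc_norm rho g + assoc_norm rho v.
Proof.
move=> Mg Mv; apply: ge_ereal_sup => _ [f [Mf f1] <-].
rewrite (@eq_int01 _ (fun x => f x * g x + f x * v x)); last first.
  by move=> x Ix; rewrite ge0_muleDr// ?(Mplus_ge0 Mg Ix) ?(Mplus_ge0 Mv Ix).
rewrite int_add; [|exact: Mplus_mul..].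
by apply: leeD; exact: assoc_ge_int.
Qed.

Lemma holder_assoc (M : R) h v : (0 < M)%R -> Mplus h -> Mplus v ->
  assoc_norm rho v <= M%:E -> \int[leb]_(x in I01 R) (h x * v x) <= M%:E * rho h.
Proof.
move=> M0 Mh Mv vM; have r0 := rho_ge0 nr Mh.
have [->|ry] := eqVneq (rho h) +oo; first by rewrite gt0_muley ?lte_fin// leey.
have rE : (fine (rho h))%:E = rho h by rewrite fineK// ge0_fin_numE// lt_neqAle ry leey.
rewrite -rE; set r := fine _ in rE *; have r0' : (0 <= r)%R by rewrite -lee_fin rE.
apply/lee_addgt0Pr => ep ep0.
(* The excess ep / M keeps the divisor positive when rho h = 0 and costs exactly ep in the end. *)
pose q := (r + ep / M)%R; have q0 : (0 < q)%R by rewrite ltr_wpDl// divr_gt0.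
have iq0 : (0 <= q^-1)%R by rewrite invr_ge0 ltW.
have -> : M%:E * r%:E + ep%:E = q%:E * M%:E.
  by rewrite -!EFinM -EFinD; congr EFin; rewrite /q; field; rewrite gt_eqF.
rewrite -lee_pdivrMl//; apply: le_trans vM.
have Mqh : Mplus (fun x => q^-1%:E * h x) by apply: Mplus_scale; rewrite ?lee_fin.
rewrite -int_scale ?lee_fin//; last exact: Mplus_mul.
rewrite (@eq_int01 _ (fun x => (q^-1%:E * h x) * v x)) => [|x _]; last by rewrite muleA.
apply: assoc_ge_int => //; rewrite (rho_scale nr)// -rE -EFinM lee_fin ler_pdivrMl// mulr1.
by rewrite /q lerDl divr_ge0 ?ltW.
Qed.

Lemma int_le_assoc : exists A : R, (0 < A)%R /\ forall g, Mplus g ->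
  \int[leb]_(x in I01 R) g x <= A%:E * assoc_norm rho g.
Proof.
pose one : R -> \bar R := cst 1.
have r1 : rho one < +oo by exact: (rho_cst_lty nr ler01).
have M1 : Mplus one by exact: Mplus_cst.
have rE : (fine (rho one))%:E = rho one by rewrite fineK// ge0_fin_numE// (rho_ge0 nr).
set r := fine (rho one) in rE.
have r0 : (0 <= r)%R by rewrite -lee_fin rE (rho_ge0 nr).
have A0 : (0 < r + 1)%R by rewrite ltr_wpDl.
have iA0 : (0 <= (r + 1)^-1)%R by rewrite invr_ge0 ltW.
exists (r + 1)%R; split => // g Mg.
rewrite -lee_pdivrMl// -int_scale ?lee_fin//.
rewrite (@eq_int01 _ (fun x => ((r + 1)^-1%:E * one x) * g x)) => [|x _]; last by rewrite mule1.
apply: assoc_ge_int; first by apply: Mplus_scale; rewrite ?lee_fin.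
by rewrite (rho_scale nr)// -rE -EFinM lee_fin ler_pdivrMl// mulr1 lerDl.
Qed.

Lemma assoc_one : exists C : R, (0 < C)%R /\ assoc_norm rho (cst 1) <= C%:E.
Proof.
have [C [C0 HC]] := rho_local nr (@mI01 R) (@subset_refl _ _).
exists (C + 1)%R; split; first by rewrite ltr_wpDl.
apply: ge_ereal_sup => _ [f [Mf f1] <-].
rewrite (@eq_int01 _ f) => [|x _]; last by rewrite mule1.
apply: (le_trans (HC f Mf)); apply: (@le_trans _ _ (C%:E * 1)).
  by apply: lee_wpmul2l; rewrite ?lee_fin.
by rewrite mule1 lee_fin lerDl.
Qed.

End AssociateNorm.

(** * Integrals of indicators of half-lines *)

Section MoreIntegrals.
Context {R : realType}.
Local Notation leb := (lebm R).

Lemma Mplus_chi_ltl (a : \bar R) : Mplus (fun s : R => chi (a < s%:E) : \bar R).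
Proof.
split=> [|x _]; last exact: chi_ge0.
by apply: measurable_chi_lt; [exact: measurable_cst|exact: measurable_EFin_id].
Qed.

Lemma Mplus_chi_lel (a : \bar R) : Mplus (fun s : R => chi (a <= s%:E) : \bar R).
Proof.
split=> [|x _]; last exact: chi_ge0.
by apply: measurable_chi_le; [exact: measurable_cst|exact: measurable_EFin_id].
Qed.

Lemma int_chi_gt (a : R) : (0 <= a <= 1)%R ->
  \int[leb]_(t in I01 R) chi (a%:E < t%:E) = (1 - a)%:E.
Proof.
move=> /andP[a0 a1].
rewrite (@eq_int01 _ (fun t => chi (a%:E < t%:E) * 1)); last by move=> t _; rewrite mule1.
rewrite -(@int_tail _ (cst 1))// integral_cst; last exact: measurable_itv.
rewrite mul1e; apply: (etrans (lebesgue_measure_itv _)) => /=.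
rewrite lte_fin; case: ltP => [_|a1']; first by rewrite -EFinB.
by congr EFin; apply/esym/eqP; rewrite subr_eq0 eq_le a1 a1'.
Qed.

Lemma int_chi_le_lt (k : R -> \bar R) (s : R) : Mplus k ->
  \int[leb]_(t in I01 R) (chi (s%:E <= t%:E) * k t) =
  \int[leb]_(t in I01 R) (chi (s%:E < t%:E) * k t).
Proof.
move=> Mk; have [m1 p1] := Mplus_mul (Mplus_chi_lel s%:E) Mk.
have [m2 p2] := Mplus_mul (Mplus_chi_ltl s%:E) Mk.
apply: ge0_ae_eq_integral => //; first exact: mI01.
exists [set s]; split; [exact: measurable_set1|exact: lebesgue_measure_set1|].
move=> t; apply: contra_notP => /= ts _; congr (chi _ * _).
by rewrite lee_fin lte_fin lt_neqAle; case: eqVneq => // st; exfalso; apply: ts.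
Qed.

End MoreIntegrals.

(** * The concave majorant of K and its admissibility *)

Section Key.
Context {R : realType}.
Variable I : R -> R.
Hypothesis I_01 : forall t, I01 R t -> I01 R (I t).
Hypothesis I_mono : forall s t, I01 R s -> I01 R t -> (s <= t)%R -> (I s <= I t)%R.
Hypothesis I_quasi : forall s t, I01 R s -> I01 R t -> (s <= t)%R -> (I t / t <= I s / s)%R.
Local Notation leb := (lebm R).

Variable g : R -> \bar R.
Hypothesis Mg : Mplus g.
Variable p0 : R.
Hypothesis Pop_le : forall s, Pop I g s <= p0%:E.

Let P s := fine (Pop I g s).
Let K s := (s * P s)%R.

Let PE s : (P s)%:E = Pop I g s.
Proof.
rewrite fineK// ge0_fin_numE; first by rewrite (le_lt_trans (Pop_le s))// ltry.
exact: (Pop_ge0 I_01 I_quasi).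
Qed.

Let P_ge0 s : (0 <= P s)%R.
Proof. by rewrite -lee_fin PE; exact: (Pop_ge0 I_01 I_quasi). Qed.

Let P_le s : (P s <= p0)%R. Proof. by rewrite -lee_fin PE. Qed.

Let P_anti s t : (s <= t)%R -> (P t <= P s)%R.
Proof. by move=> st; rewrite -lee_fin !PE; exact: (Pop_anti I_01 I_quasi). Qed.

Let level (y : R) : set R := [set s | I01 R s /\ (y < K s)%R].
(** When K never exceeds y, the default 1 keeps [sg] monotone and inside [0, 1], and [w] vanishes,
    so that such y contribute nothing. *)
Let sg (y : R) : R := if pselect (level y !=set0) then inf (level y) else 1%R.
Let w (y : R) : \bar R := if pselect (level y !=set0) then ((sg y)^-1)%:E else 0.

Let level_lb y : lbound (level y) 0%R.
Proof. by move=> s [/I01P[/ltW]]. Qed.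

Let has_inf_level y : level y !=set0 -> has_inf (level y).
Proof. by move=> ne; split => //; exists 0%R; exact: level_lb. Qed.

Let sg_le y s : level y s -> (sg y <= s)%R.
Proof.
move=> ys; rewrite /sg; case: pselect => [ne|[]]; last by exists s.
by apply: ge_inf => //; have [] := has_inf_level ne.
Qed.

(** K(s) <= p0 s, so K(s) > y forces s >= y / p0. Positivity is needed for the weight 1 / sg. *)
Let sg_pos y : halfline R y -> (0 < sg y)%R.
Proof.
move=> /halflineP y0; rewrite /sg; case: pselect => // ne.
have [s [/I01P[s0 s1] ys]] := ne.
have p00 : (0 < p0)%R.
  apply: lt_le_trans (P_le s); move: (lt_trans y0 ys); rewrite /K pmulr_rgt0//.
apply: (@lt_le_trans _ _ (y / p0)%R); first by rewrite divr_gt0.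
apply: lb_le_inf => // r [/I01P[r0 r1] yr]; rewrite ler_pdivrMr//.
by apply: (le_trans (ltW yr)); rewrite /K ler_pM2l.
Qed.

Let sg_le1 y : (sg y <= 1)%R.
Proof.
rewrite /sg; case: pselect => // ne; have [s sy] := ne.
apply: (@le_trans _ _ s); last by case: sy => /I01P[_ /ltW].
by apply: ge_inf => //; have [] := has_inf_level ne.
Qed.

Let sg01 y : halfline R y -> (0 <= sg y <= 1)%R.
Proof. by move=> Ly; rewrite (ltW (sg_pos Ly)) sg_le1. Qed.

Let level_anti x y : (x <= y)%R -> level y `<=` level x.
Proof. by move=> xy s [Is ys]; split => //; exact: le_lt_trans ys. Qed.

Let sg_mono x y : (x <= y)%R -> (sg x <= sg y)%R.
Proof.
move=> xy; have [ne|ne] := pselect (level y !=set0); last first.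
  by rewrite [X in (_ <= X)%R]/sg; case: pselect => // ?; exact: sg_le1.
rewrite [X in (_ <= X)%R]/sg; case: pselect => // ?.
apply: lb_le_inf => // s sy; apply: sg_le; exact: level_anti sy.
Qed.

Let measurable_sg : measurable_fun (halfline R) sg.
Proof.
apply/measurable_EFinP; apply: monotone_measurable; first exact: is_interval_halfline.
by move=> x y _ _ xy; rewrite lee_fin sg_mono.
Qed.

Let w_fin y : w y \is a fin_num.
Proof. by rewrite /w; case: pselect. Qed.

Let nonneg_w : nonneg_mfun (halfline R) w.
Proof.
have w0 y : halfline R y -> 0 <= w y.
  by move=> Ly; rewrite /w; case: pselect => // ?; rewrite lee_fin invr_ge0 ltW// sg_pos.
split=> //; apply: antitone_measurable; first exact: is_interval_halfline.
move=> x y Lx Ly xy; have [ne|ne] := pselect (level y !=set0); last first.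
  by rewrite [X in X <= _]/w; case: pselect => // ?; exact: w0.
rewrite [X in X <= _]/w; case: pselect => // ?.
rewrite /w; case: pselect => [?|[]].
  by rewrite lee_fin lef_pV2 ?posrE ?sg_pos// sg_mono.
by have [s sy] := ne; exists s; exact: level_anti sy.
Qed.

Let nonneg_sg : nonneg_mfun (halfline R) (fun y => (sg y)%:E).
Proof. by split; [exact/measurable_EFinP|move=> y /sg01/andP[? _]; rewrite lee_fin]. Qed.

Let nonneg_mfun_kap_integrand t : (0 <= t)%R ->
  nonneg_mfun (halfline R) (fun y => w y * mine t%:E (sg y)%:E).
Proof.
move=> t0; apply: nonneg_mfun_mul => //; case: nonneg_sg => m s0; split.
  by apply: measurable_mine => //; exact: measurable_cst.
by move=> y Ly; rewrite le_min lee_fin t0 s0.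
Qed.

(** Every y < K(t) has sg(y) <= t, and there the integrand of [kap] equals 1. *)
Let K_le_kap t : I01 R t -> (K t)%:E <= kap w sg t.
Proof.
move=> It; have [t0 t1] := (I01P t).1 It.
have K0 : 0 <= (K t)%:E by rewrite lee_fin mulr_ge0// ltW.
rewrite -[leLHS]layer//; apply: le_int_nonneg; first exact: mhalfline.
- split; last by move=> l _; exact: chi_ge0.
  by apply: measurable_chi_lt; [exact: measurable_EFin_id|exact: measurable_cst].
- exact/nonneg_mfun_kap_integrand/ltW.
move=> y Ly; have [_ /(_ y Ly)] := nonneg_mfun_kap_integrand (ltW t0).
rewrite lte_fin; case: ltP => [yK _|//].
have ty : level y t by split.
have -> : mine t%:E (sg y)%:E = (sg y)%:E by apply/min_idPr; rewrite lee_fin sg_le.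
rewrite /w; case: pselect => [?|[]]; last by exists t.
by rewrite -EFinM mulVf// gt_eqF// sg_pos.
Qed.

Lemma int_osc_mul_le (f : R -> R) : Mplus (EFin \o f) ->
  \int[leb]_(t in I01 R) (osc I (EFin \o f) t * g t) <= wfun w sg (EFin \o f).
Proof.
move=> Mf; have MK := Mplus_mul (Mplus_kernel I_01 I_quasi) Mg.
have [mD D0] := nonneg_mfun_distf Mf.
have M2 := nonneg_mfun2_mul (nonneg_mfun2_fst mI01 mhalfline MK) (nonneg_mfun2_low_level Mf).
rewrite (@eq_int01 _ (fun t => \int[leb]_(l in halfline R) ((I t / t ^+ 2)%:E * g t *
    (distf (EFin \o f) l * chi (distf (EFin \o f) l <= t%:E))))); last first.
  move=> t It; rewrite osc_low_level// int_mull; first by rewrite muleAC.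
  - exact: mhalfline.
  - by apply: emeasurable_funM => //; apply: measurable_chi_le => //; exact: measurable_cst.
  - by move=> l Ll; rewrite mule_ge0 ?chi_ge0 ?D0.
  - exact: (Mplus_ge0 MK).
rewrite (nonneg_mfun2_tonelli mI01 mhalfline M2).
have M3 : nonneg_mfun2 (halfline R) (halfline R)
    (fun l y => w y * mine (distf (EFin \o f) l) (sg y)%:E).
  apply: nonneg_mfun2_mul; first exact: (@nonneg_mfun2_snd _ _ _ w mhalfline mhalfline).
  apply: nonneg_mfun2_mine; first exact: (@nonneg_mfun2_fst _ _ _ (distf (EFin \o f)) mhalfline mhalfline).
  exact: (@nonneg_mfun2_snd _ _ _ (fun y => (sg y)%:E) mhalfline mhalfline).
have -> : wfun w sg (EFin \o f) = \int[leb]_(l in halfline R) \int[leb]_(y in halfline R)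
    (w y * mine (distf (EFin \o f) l) (sg y)%:E).
  rewrite (nonneg_mfun2_tonelli mhalfline mhalfline M3); apply: eq_int => y Ly.
  rewrite int_mull//; first exact: mhalfline.
  - by apply: measurable_mine => //; exact: measurable_cst.
  - by move=> l Ll; rewrite le_min D0//=; case: nonneg_sg => _; apply.
  - by case: nonneg_w => _; apply.
apply: le_int_nonneg; first exact: mhalfline.
- exact: (nonneg_mfun2_intr mI01 mhalfline M2).
- exact: (nonneg_mfun2_intl mhalfline mhalfline M3).
move=> l Ll; have /fineK dE := distf_fin l Mf; set d := fine _ in dE; rewrite -dE.
have d0 : (0 <= d)%R by rewrite -lee_fin dE distf_ge0.
have -> : \int[leb]_(t in I01 R) ((I t / t ^+ 2)%:E * g t * (d%:E * chi (d%:E <= t%:E))) =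
    (K d)%:E.
  rewrite (@eq_int01 _ (fun t => d%:E * (chi (d%:E <= t%:E) * ((I t / t ^+ 2)%:E * g t)))); last first.
    by move=> t It; rewrite muleCA; congr (_ * _); rewrite muleC.
  rewrite int_scale ?lee_fin//; last exact: (Mplus_mul (Mplus_chi_lel _) MK).
  by rewrite int_chi_le_lt// -/(Pop I g d) -PE.
have [_ /(_ l Ll)] := nonneg_mfun2_intl mhalfline mhalfline M3; rewrite -dE => r0.
(* The value D(l) may be an endpoint of the unit interval. K vanishes at 0, and also at 1, where the
   tail integral is empty. *)
have [d00|dn0] := eqVneq d 0%R; first by rewrite {1}d00 /K mul0r.
have dgt0 : (0 < d)%R by rewrite lt0r dn0.
have [d1|d1] := ltP d 1%R; first by apply: K_le_kap; apply/I01P.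
apply: le_trans r0; rewrite lee_fin /K (_ : P d = 0%R) ?mulr0//.
apply: EFin_inj; rewrite PE /Pop integral0_eq// => s /I01P[s0 s1].
by rewrite lte_fin ltNge (le_trans (ltW s1) d1) chi0 mul0e.
Qed.
(** K need not be monotone; its running supremum is, and sg(y) < s implies y < Q(s) when the level
    set of y is nonempty. [top_level] bounds all y with a nonempty level set. *)
Let Q (s : R) : \bar R := ereal_sup [set (K r)%:E | r in [set r | I01 R r /\ (r <= s)%R]].
Let top_level : \bar R := ereal_sup [set (K r)%:E | r in I01 R].
Let V (s : R) : \bar R := ((I s)^-1)%:E * Q s.

Let K_ge0 s : (0 <= s)%R -> (0 <= K s)%R.
Proof. by move=> s0; rewrite mulr_ge0. Qed.

Let Q_ge r s : I01 R r -> (r <= s)%R -> (K r)%:E <= Q s.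
Proof. by move=> Ir rs; apply: ereal_sup_ubound; exists r. Qed.

Let top_ge r : I01 R r -> (K r)%:E <= top_level.
Proof. by move=> Ir; apply: ereal_sup_ubound; exists r. Qed.

Let Mplus_Q : Mplus Q.
Proof.
split=> [|s Is]; last first.
  by apply: le_trans (Q_ge Is (lexx _)); rewrite lee_fin K_ge0// ltW// (I01_gt0 Is).
apply: monotone_measurable; first exact: is_interval_I01.
move=> x y _ _ xy; apply: ereal_sup_le => _ [r [Ir rx] <-]; exists r => //; split => //.
exact: le_trans rx xy.
Qed.

Let Mplus_V : Mplus V.
Proof. by apply: Mplus_mul => //; exact: (Mplus_Iinv I_01 I_mono). Qed.

Let I_half : I01 R (2^-1)%R.
Proof. by apply/I01P; rewrite invr_gt0 invf_lt1// ltr1n. Qed.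

Let top_ge0 : 0 <= top_level.
Proof.
by apply: le_trans (top_ge I_half); rewrite lee_fin K_ge0// invr_ge0.
Qed.

(** For sg(y) < 1, min(t / sg(y), 1) = t / max(t, sg(y)) = t (1 + int 1/s^2) over s > max(t, sg(y)).
    Such s satisfy y < Q(s), so integrating in y gives t [top_level] plus t int_t^1 Q(s)/s^2 ds, and
    Q = I V turns the latter, divided by I(t), into G V. *)
Let kap_le t : I01 R t -> ((I t)^-1)%:E * kap w sg t <= (t / I t)%:E * top_level + Gop I V t.
Proof.
move=> It; have [t0 t1] := (I01P t).1 It; have It0 := I_gt0 I_01 It.
have t0' : 0 <= t%:E by rewrite lee_fin ltW.
have Mts := Mplus_mul (Mplus_chi_ltl t%:E) (@Mplus_inv_sq R).
have [mQ Q0] := Mplus_Q.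
have M2 : nonneg_mfun2 (I01 R) (halfline R)
    (fun s y => chi (t%:E < s%:E) * ((s ^+ 2)^-1)%:E * chi (y%:E < Q s)).
  apply: nonneg_mfun2_mul; first exact: (nonneg_mfun2_fst mI01 mhalfline Mts).
  exact: (@nonneg_mfun2_chi_gt _ _ _ Q EFin mI01 mhalfline mQ (@measurable_EFin_id _ _)).
have MI := nonneg_mfun2_intr mI01 mhalfline M2; have [mI I0] := MI.
have mtop : nonneg_mfun (halfline R) (fun y => chi (y%:E < top_level) : \bar R).
  split; last by move=> y _; exact: chi_ge0.
  by apply: measurable_chi_lt; [exact: measurable_EFin_id|exact: measurable_cst].
have [mtop1 mtop2] := mtop.
have kt : kap w sg t <= t%:E * (top_level +
    \int[leb]_(s in I01 R) (chi (t%:E < s%:E) * ((s ^+ 2)^-1)%:E * Q s)).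
  have -> : \int[leb]_(s in I01 R) (chi (t%:E < s%:E) * ((s ^+ 2)^-1)%:E * Q s) =
      \int[leb]_(y in halfline R) \int[leb]_(s in I01 R)
        (chi (t%:E < s%:E) * ((s ^+ 2)^-1)%:E * chi (y%:E < Q s)).
    rewrite -(nonneg_mfun2_tonelli mI01 mhalfline M2); apply: eq_int01 => s Is.
    rewrite int_mull; first by rewrite layer// Q0.
    - exact: mhalfline.
    - by apply: measurable_chi_lt; [exact: measurable_EFin_id|exact: measurable_cst].
    - by move=> y _; exact: chi_ge0.
    - exact: (Mplus_ge0 Mts).
  rewrite -[top_level]layer//.
  rewrite -(int_add_nonneg mhalfline mtop MI) -int_mull//; first last.
  - by move=> y Ly; rewrite adde_ge0 ?I0 ?chi_ge0.
  - exact: emeasurable_funD.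
  - exact: mhalfline.
  apply: le_int_nonneg; first exact: mhalfline.
  - exact/nonneg_mfun_kap_integrand/ltW.
  - split; first by apply: emeasurable_funM; [exact: measurable_cst|exact: emeasurable_funD].
    by move=> y Ly; rewrite mule_ge0// adde_ge0 ?I0 ?chi_ge0.
  move=> y Ly; have rhs0 : 0 <= t%:E * (chi (y%:E < top_level) + \int[leb]_(s in I01 R)
      (chi (t%:E < s%:E) * ((s ^+ 2)^-1)%:E * chi (y%:E < Q s))).
    by rewrite mule_ge0// adde_ge0 ?I0 ?chi_ge0.
  have [ne|ne] := pselect (level y !=set0); last first.
    by rewrite {1}/w; case: pselect => // ?; rewrite mul0e.
  have sp := sg_pos Ly.
  have s1 : (sg y < 1)%R.
    have [s sy] := ne; apply: (le_lt_trans (sg_le sy)).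
    by case: sy => /I01P[].
  have -> : y%:E < top_level = true.
    by have [s [Is ys]] := ne; apply: lt_le_trans (top_ge Is); rewrite lte_fin.
  pose m := Num.max t (sg y).
  have m1 : (m < 1)%R by rewrite gt_max t1.
  have m0 : (0 < m)%R by rewrite lt_max t0.
  apply: (@le_trans _ _ (t%:E * (1 + \int[leb]_(s in I01 R) (chi (m%:E < s%:E) * ((s ^+ 2)^-1)%:E)))).
    rewrite int_inv_sq ?m0// -EFinD addrCA subrr addr0 -EFinM -EFin_min.
    rewrite /w; case: pselect => [?|[]]//; rewrite -EFinM lee_fin mulrC /m.
    have [ts|st] := leP t (sg y); first by [].
    by rewrite !mulfV// gt_eqF.
  apply: lee_wpmul2l => //; apply: leeD => //.
  apply: integral_mono.
  - exact: (Mplus_mul (Mplus_chi_ltl m%:E) (@Mplus_inv_sq R)).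
  - apply: Mplus_mul => //; split; last by move=> x _; exact: chi_ge0.
    by apply: measurable_chi_lt => //; exact: measurable_cst.
  move=> s Is; rewrite muleAC; apply: lee_wpmul2r; first exact: (Mplus_ge0 (@Mplus_inv_sq R)).
  case: (ltP m%:E) => [|_]; last by rewrite chi0 mule_ge0 ?chi_ge0.
  rewrite lte_fin gt_max => /andP[ts ss].
  have -> : t%:E < s%:E = true by rewrite lte_fin.
  have -> : y%:E < Q s = true; last by rewrite !chi1 mule1.
  have hi := has_inf_level ne.
  have [r ry rs] : exists2 r, level y r & (r < s)%R.
    move: ss; rewrite /sg; case: pselect => // ? ss.
    have sp' : (0 < s - inf (level y))%R by rewrite subr_gt0.
    have [r ry rlt] := inf_adherent sp' hi.
    by exists r => //; rewrite (lt_le_trans rlt)// addrC subrK.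
  case: ry => Ir yr; apply: lt_le_trans (Q_ge Ir (ltW rs)); by rewrite lte_fin.
have iI0 : 0 <= ((I t)^-1)%:E by rewrite lee_fin invr_ge0 ltW.
apply: (le_trans (lee_wpmul2l iI0 kt)).
rewrite muleA -EFinM (mulrC _ t) ge0_muleDr//; last first.
  by apply: int_ge0; exact: (Mplus_mul Mts Mplus_Q).
rewrite leeD2l// /Gop; apply: lee_wpmul2l; first by rewrite lee_fin divr_ge0// ltW.
rewrite le_eqVlt; apply/orP; left; apply/eqP; apply: eq_int01 => s Is.
rewrite -muleA; congr (_ * _); rewrite /V muleA -EFinM; congr (_%:E * _).
by rewrite mulrAC mulfV ?mul1r// gt_eqF// (I_gt0 I_01).
Qed.

(** For x in [r/2, r[ monotonicity of I and P gives G g(x) >= c = K(r) / (2 I(r)), so the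
    rearrangement of G g is at least c at r/3. Quasiconcavity gives I(r) <= 3 I(r/3), hence K(r) = 2
    c I(r) <= 6 c I(r/3). *)
Let V_le s : I01 R s -> V s <= 6%:E * S_op I (Gop I g) s.
Proof.
move=> Is; have [s0 s1] := (I01P s).1 Is.
rewrite /V /S_op muleCA; apply: lee_wpmul2l; first by rewrite lee_fin invr_ge0 ltW// (I_gt0 I_01).
have MG := Mplus_Gop I_01 I_quasi Mg.
apply: ge_ereal_sup => _ [r [Ir rs] <-]; have [r0 r1] := (I01P r).1 Ir.
have Ir0 := I_gt0 I_01 Ir.
(* The point r / 3 is strictly below the length r / 2 of the interval, as the strict comparison with
   the distribution function demands. *)
pose q := (r / 3)%R; have q0 : (0 < q)%R by rewrite divr_gt0.
have qr : (q <= r)%R by rewrite /q; lra.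
have Iq : I01 R q by apply/I01P; rewrite q0 (le_lt_trans qr).
rewrite -lee_pdivrMl//; apply: le_trans (_ : (I q)%:E * fstar (Gop I g) q <= _); last first.
  apply: ereal_sup_ubound; exists q => //.
  by rewrite /= in_itv/= q0 (le_trans qr).
pose c := (2^-1 * (r / I r * P r))%R.
have c0 : (0 <= c)%R by rewrite !mulr_ge0 ?invr_ge0// ltW.
have cf : c%:E <= fstar (Gop I g) q.
  apply: le_ereal_inf_tmp => _ [l [l0 Dl] <-]; rewrite lee_fin leNgt; apply/negP => lc.
  move: Dl; apply/negP; rewrite -ltNge.
  apply: (@lt_le_trans _ _ (leb (`[(r / 2)%R, r[%classic : set R))).
    have r2 : (r / 2 < r)%R by lra.
    rewrite (_ : leb _ = (r - r / 2)%:E).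
      by rewrite lte_fin /q; lra.
    by apply: (etrans (lebesgue_measure_itv _)) => /=; rewrite lte_fin r2 -EFinD.
  apply: le_leb; [exact: measurable_itv|exact: measurable_superlevel|].
  move=> x /=; rewrite in_itv/= => /andP[rx xr].
  have x0 : (0 < x)%R by lra.
  have Ix : I01 R x by apply/I01P; rewrite x0 (lt_trans xr).
  split => //=; apply: (@lt_le_trans _ _ c%:E); first by rewrite lte_fin.
  rewrite /Gop -PE -EFinM lee_fin /c mulrA; apply: ler_pM => //.
  - by rewrite mulr_ge0 ?invr_ge0// divr_ge0// ltW.
  - rewrite mulrA; apply: ler_pM; rewrite ?invr_ge0 ?(ltW Ir0)//.
    + by rewrite mulr_ge0 ?invr_ge0 ?(ltW r0).
    + by lra.
    + by rewrite lef_pV2 ?posrE ?(I_gt0 I_01)// I_mono// ltW.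
  - exact: P_anti (ltW xr).
apply: (@le_trans _ _ ((I q)%:E * c%:E)); last first.
  by apply: lee_wpmul2l => //; rewrite lee_fin ltW// (I_gt0 I_01).
rewrite -!EFinM lee_fin /c.
have Iqr : (I r <= 3 * I q)%R.
  have := I_quasi Iq Ir qr; rewrite ler_pdivrMr// /q.
  by rewrite (_ : I (r / 3) / (r / 3) * r = 3 * I (r / 3))%R//; field; rewrite gt_eqF.
apply: (@le_trans _ _ ((I r / 3) * (2^-1 * (r / I r * P r)))%R).
  rewrite /K le_eqVlt; apply/orP; left; apply/eqP; by field; rewrite gt_eqF.
by apply: ler_wpM2r => //; lra.
Qed.

(** P is nonincreasing, so K(r) <= 2 K(r/2), and r/2 < s for every s > 1/2. Hence [top_level] <= 2
    Q(s) <= 2 V(s) on an interval of length 1/2. *)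
Let top_le : top_level <= 4%:E * \int[leb]_(s in I01 R) V s.
Proof.
rewrite -lee_pdivrMl//.
have -> : (4^-1)%:E * top_level =
    \int[leb]_(s in I01 R) ((2^-1)%:E * top_level * chi ((2^-1)%:E < s%:E)).
  rewrite int_scale; [|by rewrite mule_ge0// lee_fin invr_ge0|exact: Mplus_chi_ltl].
  rewrite int_chi_gt; last by rewrite invr_ge0 invf_le1 ?ler1n//= ler0n.
  by rewrite muleAC -EFinM; congr (_%:E * _); field.
apply: integral_mono => //.
  by apply: Mplus_scale; [rewrite mule_ge0// lee_fin invr_ge0|exact: Mplus_chi_ltl].
move=> s Is; case: (ltP (2^-1)%:E) => [s2|_]; last by rewrite chi0 mule0 (Mplus_ge0 Mplus_V).
rewrite chi1 mule1; apply: (@le_trans _ _ (Q s)); last first.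
  have [Is0 Is1] := (I01P _).1 (I_01 Is).
  rewrite /V -[leLHS]mul1e; apply: lee_wpmul2r; first exact: (Mplus_ge0 Mplus_Q).
  by rewrite lee_fin invf_ge1// ltW.
rewrite lee_pdivrMl//; apply: ge_ereal_sup => _ [r Ir <-].
have [r0 r1] := (I01P r).1 Ir; rewrite -lee_pdivrMl// -EFinM.
have Ir2 : I01 R (r / 2)%R by apply/I01P; split; lra.
apply: le_trans (Q_ge Ir2 _); last by move: s2; rewrite lte_fin; lra.
rewrite lee_fin /K mulrA (mulrC 2^-1%R); apply: ler_wpM2l; first by rewrite divr_ge0// ltW.
by apply: P_anti; lra.
Qed.

Variable d : R.
Hypothesis d_ge1 : (1 <= d)%R.
Hypothesis I_tail : forall t, I01 R t ->
  \int[leb]_(s in `]t, 1%R[) (I s / s ^+ 2)%:E <= (d * (I t / t))%:E.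
Variable rho : (R -> \bar R) -> \bar R.
Hypothesis nr : ri_norm rho.
Variable CS : R.
Hypothesis CS_gt0 : (0 < CS)%R.
Hypothesis S_bound : forall h, Mplus h ->
  assoc_norm rho (S_op I h) <= CS%:E * assoc_norm rho h.
Hypothesis g_le1 : assoc_norm rho g <= 1.
Variables A B : R.
Hypotheses (A_gt0 : (0 < A)%R) (B_gt0 : (0 < B)%R).
Hypothesis int_le_A : forall h, Mplus h ->
  \int[leb]_(x in I01 R) h x <= A%:E * assoc_norm rho h.
Hypothesis one_le_B : assoc_norm rho (cst 1) <= B%:E.

Let Mplus_S_op h : Mplus h -> Mplus (S_op I h).
Proof.
move=> Mh; apply: Mplus_mul; first exact: (Mplus_Iinv I_01 I_mono).
split=> [|t It]; last first.
  apply: (@le_trans _ _ ((I t)%:E * fstar h t)).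
    by rewrite mule_ge0 ?fstar_ge0// lee_fin ltW// (I_gt0 I_01).
  apply: ereal_sup_ubound; exists t => //=; rewrite in_itv/= lexx andbT.
  exact: I01_gt0.
apply: monotone_measurable; first exact: is_interval_I01.
move=> x y _ _ xy; apply: ereal_sup_le => _ [r /= + <-]; rewrite in_itv/= => /andP[r0 rx].
by exists r => //=; rewrite in_itv/= r0 (le_trans rx).
Qed.

(** Here 24 CS d = 6 CS (4 d) bounds V in the associate norm. The first summand comes from
    [top_level] <= 4 int V, the bound 1/I(1/2) of t / I(t) and the associate norm of 1; the second
    from applying G to V. The bound [p0] does not enter. *)
Definition key_const := (4 * A * (24 * CS * d) * (I 2^-1)^-1 * B + 4 * d * (24 * CS * d))%R.

Let assoc_V_le : assoc_norm rho V <= (24 * CS * d)%:E.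
Proof.
have MG := Mplus_Gop I_01 I_quasi Mg.
have d0 : (0 <= d)%R by exact: le_trans ler01 d_ge1.
have MS := Mplus_S_op MG.
apply: (@le_trans _ _ (assoc_norm rho (fun s => 6%:E * S_op I (Gop I g) s))).
  by apply: assoc_le => //; apply: Mplus_scale => //.
apply: (le_trans (assoc_scale_le _ _ MS)) => //.
apply: (@le_trans _ _ (6%:E * (CS%:E * ((4 * d)%:E * 1)))).
  apply: lee_wpmul2l => //; apply: (le_trans (S_bound MG)).
  apply: lee_wpmul2l; first by rewrite lee_fin ltW.
  apply: (le_trans (assoc_Gop_le I_01 I_quasi d_ge1 I_tail nr Mg)).
  by apply: lee_wpmul2l => //; rewrite lee_fin mulr_ge0.
by rewrite mule1 -!EFinM lee_fin; lra.
Qed.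

Lemma exists_admissible : exists w' sg', admissible I rho w' sg' /\
  forall f : R -> R, Mplus (EFin \o f) ->
    \int[leb]_(t in I01 R) (osc I (EFin \o f) t * g t) <=
      key_const%:E * wfun w' sg' (EFin \o f).
Proof.
have d0 : (0 < d)%R by exact: lt_le_trans ltr01 d_ge1.
have Ih0 := I_gt0 I_01 I_half.
have T0 : (0 < 24 * CS * d)%R by rewrite !mulr_gt0.
set T := (24 * CS * d)%R in T0.
have C0 : (0 < key_const)%R.
  by rewrite /key_const -/T ltr_pwDl ?mulr_gt0 ?invr_gt0// ltW// !mulr_gt0.
set C := key_const in C0 *.
have iC0 : 0 <= C^-1%:E :> \bar R by rewrite lee_fin invr_ge0 ltW.
have top_fin : top_level <= (4 * A * T)%:E.
  apply: (le_trans top_le); rewrite -mulrA EFinM; apply: lee_wpmul2l => //.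
  apply: (le_trans (int_le_A Mplus_V)); rewrite EFinM; apply: lee_wpmul2l => //.
  by rewrite lee_fin ltW.
have a0 : (0 <= 4 * A * T * (I 2^-1)^-1)%R by rewrite !mulr_ge0 ?invr_ge0// ltW.
have MGV := Mplus_Gop I_01 I_quasi Mplus_V.
pose v t := (4 * A * T * (I 2^-1)^-1)%:E * cst 1 t + Gop I V t.
have M1 : Mplus (fun t : R => (4 * A * T * (I 2^-1)^-1)%:E * cst 1 t).
  by apply: Mplus_scale; [rewrite lee_fin|exact: Mplus_cst].
have Mv : Mplus v by exact: Mplus_add.
have v_le : assoc_norm rho v <= C%:E.
  apply: (le_trans (assoc_add_le _ M1 MGV)); rewrite /C /key_const -/T EFinD.
  apply: leeD.
    apply: (le_trans (assoc_scale_le _ a0 _)); first exact: Mplus_cst.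
    by rewrite [X in _ <= X]EFinM; apply: lee_wpmul2l; rewrite ?lee_fin.
  apply: (le_trans (assoc_Gop_le I_01 I_quasi d_ge1 I_tail nr Mplus_V)).
  by rewrite [X in _ <= X]EFinM; apply: lee_wpmul2l; [rewrite lee_fin mulr_ge0// ltW|exact: assoc_V_le].
have kv t : I01 R t -> ((I t)^-1)%:E * kap w sg t <= v t.
  move=> It; apply: (le_trans (kap_le It)); rewrite /v leeD2r//= mule1.
  rewrite (mulrC (4 * A * T)%R) [X in _ <= X]EFinM; apply: lee_pmul => //.
    by rewrite lee_fin divr_ge0// ltW ?(I01_gt0 It) ?(I_gt0 I_01).
  by rewrite lee_fin; exact: (ratio_le_b I_01 I_mono I_quasi).
have [mw w0] := nonneg_w.
have Mkap : Mplus (kap w sg).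
  apply: (nonneg_mfun2_intl (k := fun t y => w y * mine t%:E (sg y)%:E) mI01 mhalfline).
  apply: nonneg_mfun2_mul; first exact: (@nonneg_mfun2_snd _ _ _ w mI01 mhalfline).
  apply: nonneg_mfun2_mine; last exact: (@nonneg_mfun2_snd _ _ _ (fun y => (sg y)%:E) mI01 mhalfline).
  apply: (@nonneg_mfun2_fst _ _ _ EFin mI01 mhalfline); split; first exact: measurable_EFin_id.
  by move=> x /I01P[? _]; rewrite lee_fin ltW.
(* Only the weight is divided by the constant; the levels [sg] are kept. *)
exists (fun y => C^-1%:E * w y), sg; split.
  split => //.
  - split; first by apply: emeasurable_funM => //; exact: measurable_cst.
    by move=> y Ly; rewrite mule_ge0 ?w0.
  - by move=> y _; rewrite fin_numM// w_fin.
  move=> h Mh.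
  have kE t : I01 R t -> kap (fun y => C^-1%:E * w y) sg t = C^-1%:E * kap w sg t.
    move=> /I01P[t0 _]; have [m p] := nonneg_mfun_kap_integrand (ltW t0).
    rewrite /kap -int_mull//; last exact: mhalfline.
    by apply: eq_int => y _; rewrite muleA.
  have Mhk := Mplus_mul Mh (Mplus_mul (Mplus_Iinv I_01 I_mono) Mkap).
  rewrite (@eq_int01 _ (fun t => C^-1%:E * (h t * (((I t)^-1)%:E * kap w sg t)))); last first.
    by move=> t It; rewrite kE// muleCA; congr (_ * _); rewrite (muleC _ (h t)) muleA.
  rewrite int_scale// lee_pdivrMl//.
  apply: le_trans (holder_assoc nr C0 Mh Mv v_le).
  apply: integral_mono => //; first exact: Mplus_mul.
  by move=> t It; apply: lee_wpmul2l; [exact: (Mplus_ge0 Mh)|exact: kv].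
move=> f Mf; apply: (le_trans (int_osc_mul_le Mf)).
have [mwk wk0] := nonneg_mfun_mul nonneg_w (nonneg_mfun_kfun Mf measurable_sg sg01).
rewrite le_eqVlt; apply/orP; left; apply/eqP; rewrite /wfun -[RHS]int_mull.
- by apply: eq_int => y _; rewrite muleA muleA -EFinM mulfV ?gt_eqF// mul1e.
- exact: mhalfline.
- apply: emeasurable_funM; first by apply: emeasurable_funM => //; exact: measurable_cst.
  by case: (nonneg_mfun_kfun Mf measurable_sg sg01).
- move=> y Ly; rewrite -muleA mule_ge0// wk0//.
- by rewrite lee_fin ltW.
Qed.

End Key.

(** * Removing the boundedness assumption on the tail integral *)

Section Cutoff.
Context {R : realType}.
Variable I : R -> R.
Hypothesis I_01 : forall t, I01 R t -> I01 R (I t).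
Hypothesis I_mono : forall s t, I01 R s -> I01 R t -> (s <= t)%R -> (I s <= I t)%R.
Hypothesis I_quasi : forall s t, I01 R s -> I01 R t -> (s <= t)%R -> (I t / t <= I s / s)%R.
Variable d : R.
Hypothesis d_ge1 : (1 <= d)%R.
Hypothesis I_tail : forall t, I01 R t ->
  \int[lebm R]_(s in `]t, 1%R[) (I s / s ^+ 2)%:E <= (d * (I t / t))%:E.
Variable rho : (R -> \bar R) -> \bar R.
Hypothesis nr : ri_norm rho.
Hypothesis S_bound : S_bounded_on_assoc I rho.
Implicit Types (g : R -> \bar R).
Local Notation leb := (lebm R).

(** Beyond a the kernel is at most a^-2, since I < 1. This supplies the finite bound [p0] behind the
    construction of [sg]. *)
Lemma Pop_cutoff_le g (a : R) : Mplus g -> (0 < a)%R -> forall s : R,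
  Pop I (fun t => g t * chi (a%:E < t%:E)) s <=
  (a ^- 2)%:E * \int[leb]_(t in I01 R) g t.
Proof.
move=> Mg a0 s.
have ia0 : 0 <= (a ^- 2)%:E by rewrite lee_fin invr_ge0 sqr_ge0.
have Mga := Mplus_mul Mg (Mplus_chi_ltl a%:E).
have MK := Mplus_mul (Mplus_kernel I_01 I_quasi) Mga.
rewrite -int_scale//; apply: integral_mono.
- exact: (Mplus_mul (Mplus_chi_ltl s%:E) MK).
- exact: Mplus_scale.
move=> t It; have [t0 t1] := (I01P t).1 It.
apply: (@le_trans _ _ (1 * ((I t / t ^+ 2)%:E * (g t * chi (a%:E < t%:E))))).
  by apply: lee_wpmul2r; [exact: (Mplus_ge0 MK)|exact: chi_le1].
rewrite mul1e; case: (ltP a%:E) => [|_]; last first.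
  by rewrite chi0 !mule0 mule_ge0// (Mplus_ge0 Mg).
rewrite lte_fin => at_; rewrite chi1 mule1; apply: lee_wpmul2r; first exact: (Mplus_ge0 Mg).
have [It0 It1] := (I01P _).1 (I_01 It).
rewrite lee_fin -[leRHS]mul1r; apply: ler_pM; rewrite ?invr_ge0 ?sqr_ge0 ?(ltW It0) ?(ltW It1)//.
by rewrite lef_pV2 ?posrE ?exprn_gt0// ler_pXn2r ?nnegrE ?(ltW a0) ?(ltW t0) ?(ltW at_).
Qed.

(** By duality it is enough to pair with g in the unit ball of X'. The cutoffs of g to t > 1/(n+1)
    stay in that ball, and [key_const] is the same for all n although the bounds on [Pop] blow up,
    so monotone convergence removes the cutoff. *)
Lemma rho_osc_le_Wnorm : exists C : R, (0 < C)%R /\ forall f : R -> R, Mplus (EFin \o f) ->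
  rho (osc I (EFin \o f)) <= C%:E * Wnorm I rho (EFin \o f).
Proof.
have [CS [CS0 hS]] := S_bound.
have [A [A0 hA]] := int_le_assoc nr; have [B [B0 hB]] := assoc_one nr.
have d0 : (0 < d)%R by exact: lt_le_trans ltr01 d_ge1.
have I_half : I01 R (2^-1)%R by apply/I01P; rewrite invr_gt0 invf_lt1// ltr1n.
have Ih0 := I_gt0 I_01 I_half.
pose C := key_const I d CS A B.
have C0 : (0 < C)%R.
  by rewrite /C /key_const ltr_pwDl ?mulr_gt0 ?invr_gt0// ltW// !mulr_gt0.
exists C; split => // f Mf.
have MW : 0 <= C%:E * Wnorm I rho (EFin \o f).
  by rewrite mule_ge0 ?lee_fin ?(ltW C0)//; exact: (Wnorm_ge0 I_01 I_mono I_quasi nr Mf).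
have MO := Mplus_osc I_01 I_quasi Mf.
apply: (rho_le_assoc_assoc nr MO MW) => g Mg g1.
pose gn n t := g t * chi ((n.+1%:R^-1)%:E < t%:E).
have Mgn n : Mplus (gn n) by exact: (Mplus_mul Mg (Mplus_chi_ltl _)).
have : \int[leb]_(t in I01 R) (osc I (EFin \o f) t * gn n t) @[n --> \oo] -->
    \int[leb]_(t in I01 R) (osc I (EFin \o f) t * g t).
  apply: int_cvg => [n|t It n m nm|t It]; first exact: (Mplus_mul MO).
    apply: lee_wpmul2l; first exact: (Mplus_ge0 MO).
    apply: lee_wpmul2l; first exact: (Mplus_ge0 Mg).
    apply: le_chi; rewrite !lte_fin; apply: le_lt_trans.
    by rewrite lef_pV2 ?posrE// ler_nat.
  have [t0 t1] := (I01P t).1 It.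
  apply: cvg_near_cst; exists (Num.bound t^-1) => // n /= nt.
  rewrite /gn (_ : (_ < _) = true) ?chi1 ?mule1// lte_fin invf_plt ?posrE//.
  apply: (lt_le_trans (archi_boundP _)); first by rewrite invr_ge0 ltW.
  by rewrite ler_nat ltnW.
move/cvge_to_le; apply; apply: nearW => n.
have n0 : (0 < n.+1%:R^-1 :> R)%R by rewrite invr_gt0.
have gn1 : assoc_norm rho (gn n) <= 1.
  apply: le_trans g1; apply: assoc_le => // t It.
  by rewrite -[leRHS]mule1; apply: lee_wpmul2l; [exact: (Mplus_ge0 Mg)|exact: chi_le1].
have Pn s : Pop I (gn n) s <= ((n.+1%:R^-1) ^- 2 * (A * 1))%:E.
  apply: (le_trans (Pop_cutoff_le Mg n0 s)); rewrite EFinM; apply: lee_wpmul2l.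
    by rewrite lee_fin invr_ge0 sqr_ge0.
  apply: (le_trans (hA g Mg)); rewrite EFinM; apply: lee_wpmul2l => //.
  by rewrite lee_fin ltW.
have [w [sg [adm H]]] := exists_admissible I_01 I_mono I_quasi (Mgn n) Pn d_ge1 I_tail nr
  CS0 hS gn1 A0 B0 hA hB.
apply: (le_trans (H f Mf)); apply: lee_wpmul2l; first by rewrite lee_fin ltW.
exact: wfun_le_Wnorm.
Qed.

End Cutoff.

(** * The two norm inequalities from optimality and duality *)

Unset Implicit Arguments.

Theorem theorem4p10 (R : realType) (I : R -> R)
    (rhoX : (R -> \bar R) -> \bar R) :
  classQ I -> ri_norm rhoX -> S_bounded_on_assoc I rhoX ->
  forall rhoY : (R -> \bar R) -> \bar R, optimal_target I rhoX rhoY ->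
  exists C1 C2 : R, (0 < C1)%R /\ (0 < C2)%R /\
    forall f : R -> R, Mplus (EFin \o f) ->
      rhoY (EFin \o f) <= C1%:E * (rhoX (osc I (EFin \o f)) + L1norm (EFin \o f)) /\
      rhoX (osc I (EFin \o f)) + L1norm (EFin \o f) <= C2%:E * rhoY (EFin \o f).
Proof.
move=> [[[I_01 _ _] I_mono _ _ I_quasi] [C1 [C10 h1]] _ [C3 [C30 h3]] _] nr S_bound.
move=> rhoY [nrY [CH [CH0 hH]] opt].
(* Chaining two of the integral conditions gives int_t^1 I/s^2 <= (C3/t) int_0^t I/s <= C3 C1
   I(t)/t. The maximum with 1 provides the factor at least 1 required by [kfun_mul_le]. *)
pose d := Num.max 1%R (C3 * C1)%R.
have d_ge1 : (1 <= d)%R by rewrite le_max lexx.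
have I_tail t : I01 R t ->
    \int[lebm R]_(s in `]t, 1%R[) (I s / s ^+ 2)%:E <= (d * (I t / t))%:E.
  move=> It; have [t0 t1] := (I01P t).1 It; have It0 := I_gt0 I_01 It.
  apply: (le_trans (h3 t It)); apply: (@le_trans _ _ ((C3 / t)%:E * (C1 * I t)%:E)).
    by apply: lee_wpmul2l; [rewrite lee_fin divr_ge0// ltW|exact: h1].
  rewrite -EFinM lee_fin (_ : C3 / t * (C1 * I t) = C3 * C1 * (I t / t))%R; last by ring.
  by rewrite ler_wpM2r ?divr_ge0 ?(ltW It0) ?(ltW t0)// le_max lexx orbT.
have [KC [KC0 hK]] := rho_osc_le_Wnorm I_01 I_mono I_quasi d_ge1 I_tail nr S_bound.
(* Optimality of Y is invoked once, against W. *)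
have [|CE [CE0 hE]] := opt _ (Wnorm_ri I_01 I_mono I_quasi nr).
  exists 1%R; split => // h Mh; rewrite mul1e.
  exact: (Wnorm_H_op I_01 I_mono rhoX Mh).
have [CL [CL0 hL]] := rho_local nrY (@mI01 R) (@subset_refl _ _).
pose one : R -> \bar R := cst 1.
have M1 : Mplus one by exact: Mplus_cst.
have r1 : rhoY one < +oo by exact: (rho_cst_lty nrY ler01).
have rE : (fine (rhoY one))%:E = rhoY one by rewrite fineK// ge0_fin_numE// (rho_ge0 nrY).
have r0 : (0 <= fine (rhoY one))%R by rewrite fine_ge0// (rho_ge0 nrY).
exists (CH + fine (rhoY one))%R, (KC * CE + CL)%R; split; first by rewrite ltr_pwDl.
split; first by rewrite ltr_pwDl// mulr_gt0.
move=> f Mf; have MO := Mplus_osc I_01 I_quasi Mf.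
have X0 := rho_ge0 nr MO; have Y0 := rho_ge0 nrY Mf.
have L0 : 0 <= L1norm (EFin \o f) by exact: int_ge0.
split.
  (* An infinite L1 norm makes the right side infinite; otherwise it is a real constant, whose norm
     in Y is a multiple of that of the function 1. *)
  have [Ly|Ly] := eqVneq (L1norm (EFin \o f)) +oo.
    rewrite Ly addey; last by rewrite gt_eqF// (lt_le_trans _ X0)// ltNyr.
    by rewrite gt0_muley ?leey// lte_fin ltr_pwDl.
  have LE : (fine (L1norm (EFin \o f)))%:E = L1norm (EFin \o f).
    by rewrite fineK// ge0_fin_numE// lt_neqAle Ly leey.
  set a := fine _ in LE; have a0 : (0 <= a)%R by rewrite -lee_fin LE.
  have MH := Mplus_H_op I_01 I_mono MO.
  have Ma : Mplus (fun x => a%:E * one x) by apply: Mplus_scale; rewrite ?lee_fin.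
  (* The pointwise estimate concerns the rearrangement of f, which has the same norm in Y. *)
  rewrite -(rho_fstar nrY Mf).
  apply: (@le_trans _ _ (rhoY (H_op I (osc I (EFin \o f)) \+ (fun x => a%:E * one x)))).
    apply: (rho_le nrY); [exact: (Mplus_add MH Ma)|exact: Mplus_fstar|].
    by move=> t It; rewrite /= mule1 LE; apply: fstar_le_H_osc.
  apply: (le_trans (rho_add nrY MH Ma)); rewrite (rho_scale nrY)//.
  have s0 : 0 <= rhoX (osc I (EFin \o f)) + L1norm (EFin \o f) by exact: adde_ge0.
  rewrite EFinD ge0_muleDl ?lee_fin ?(ltW CH0)//; apply: leeD.
    apply: (le_trans (hH _ MO)); apply: lee_wpmul2l; first by rewrite lee_fin ltW.
    by rewrite leeDl.
  rewrite LE rE muleC; apply: lee_wpmul2l; first exact: (rho_ge0 nrY).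
  by rewrite leeDr.
rewrite EFinD ge0_muleDl ?lee_fin ?mulr_ge0 ?(ltW KC0) ?(ltW CE0)//; apply: leeD; last exact: hL.
apply: (le_trans (hK f Mf)); rewrite EFinM -muleA; apply: lee_wpmul2l; first by rewrite lee_fin ltW.
exact: hE.
Qed.
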